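(* Assume the following. (1) For every $n$, $(X_{n,i})_{1\le i\le n}$ is stationary. (2) $l_n,r_n,s_n\in\mathbb N$ satisfy $s_n\le l_n=o(r_n)$, $r_n=o(n)$, $p_n\to0$ and $r_n=o\big(\sqrt{p_n}\,\inf_{g\in\mathcal G}b_n(g)\big)$. (3) $m_n\beta^X_{n,l_n-s_n}\to0$. (4) The processes $(V_n(g))_{g\in\mathcal G}$, $n\in\mathbb N$, are separable. (5) $g_{\max}:=\sup_{g\in\mathcal G}|g|$ is bounded and measurable. (6) For all $g\in\mathcal G$, $$E\Big[\Big(\sum_{j=1}^{r_n}\mathbf 1_{\{g(Y_{n,j})\neq0\}}\Big)^2\Big]=O\Big(\frac{p_nb_n^2(g)}{m_n}\Big).$$ Then $\sup_{g\in\mathcal G}|Z_n(g)-\bar Z_n(g)|\to0$ in outer probability. If, in addition, there exists a function $c:\mathcal G^2\to\mathbb R$ such that $\frac{m_n}{p_n}\mathrm{Cov}(V_n(g),V_n(h))\to c(g,h)$ for all $g,h\in\mathcal G$, then the finite dimensional marginal distributions of each of the empirical processes $(Z_n(g))_{g\in\mathcal G}$ and $(\bar Z_n(g))_{g\in\mathcal G}$ converge weakly to those of a (centered) Gaussian process $(Z(g))_{g\in\mathcal G}$ with covariance function $c$.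
   Context: All limits and $o,O$ are for $n\to\infty$. $(E,\|\cdot\|)$ is a complete normed vector space, $E_\cup:=\bigcup_{k\in\mathbb N}E^k$. $(X_{n,i})_{1\le i\le n,\,n\in\mathbb N}$ is a triangular array of $E$-valued random variables, stationary within each row. $\mathcal G$ is a set of (measurable) functionals $g:E_\cup\to\mathbb R$ which vanish on every null vector. $s_n,r_n,l_n\in\mathbb N$ are sequences and $b_n(g)>0$, $g\in\mathcal G$, are normalizing constants. Sliding blocks: $Y_{n,j}:=(X_{n,j},\dots,X_{n,j+s_n-1})$, $1\le j\le n-s_n+1$. Put $m_n:=\lfloor (n-s_n+1)/r_n\rfloor$, $$V_{n,i}(g):=\frac1{b_n(g)}\sum_{j=1}^{r_n}g(Y_{n,(i-1)r_n+j}),\quad 1\le i\le m_n,$$ and let $V_n$ denote a generic process with the same distribution as $V_{n,1}$. Put $p_n:=P\{\exists g\in\mathcal G:V_n(g)\ne0\}$, $$\bar Z_n(g):=\frac1{\sqrt{p_n}\,b_n(g)}\sum_{j=1}^{n-s_n+1}\big(g(Y_{n,j})-Eg(Y_{n,j})\big),\qquad Z_n(g):=\frac1{\sqrt{p_n}\,b_n(g)}\sum_{j=1}^{m_nr_n}\big(g(Y_{n,j})-Eg(Y_{n,j})\big).$$ Mixing coefficients: $\beta^X_{n,k}:=\sup_{1\le l\le n-k-1}E\big[\sup_{B\in\mathcal B_{n,l+k+1}^n}|P(B\mid\mathcal B_{n,1}^l)-P(B)|\big]$, where $\mathcal B_{n,i}^j$ is the $\sigma$-field generated by $(X_{n,l})_{i\le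 l\le j}$. Separability is meant in the usual sense of the theory of stochastic processes; it holds in particular if $\mathcal G$ is finite. Convergence in outer probability: $P^*\{\cdot>\eta\}\to0$ for all $\eta>0$, $P^*$ the outer probability. *)

(* Defs.v *)
From HB Require Import structures.
From mathcomp Require Import all_boot all_order all_algebra.
From mathcomp Require Import all_classical all_reals all_analysis.
From mathcomp Require Import measurable_realfun.

Set Implicit Arguments.
Unset Strict Implicit.
Unset Printing Implicit Defensive.

Import Order.TTheory GRing.Theory Num.Theory.
Import numFieldNormedType.Exports.

Local Open Scope classical_set_scope.
Local Open Scope ring_scope.

Definition borel (E : topologicalType) := g_sigma_algebraType (@open E).

Section probability_notions.
Context {d} {Omega : measurableType d} {R : realType} (P : probability Omega R).

Definition outer_prob (A : set Omega) : \bar R := mu_ext P A.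

(* Separability in the sense of Doob, with respect to the topology of the index
   set. *)
Definition separable_process (T : topologicalType) (V : T -> Omega -> R) :=
  exists2 D : set T, countable D &
    {ae P, forall w, forall (U : set T) (F : set R), open U -> closed F ->
      (forall h, D h -> U h -> F (V h w)) -> forall t, U t -> F (V t w)}.

(* [f] is a version of the conditional probability of [B] given the
   sub-sigma-field [A]. *)
Definition is_cond_prob (A : set (set Omega)) (B : set Omega)
    (f : Omega -> R) :=
  [/\ forall S : set R, measurable S -> A (f @^-1` S),
      P.-integrable setT (EFin \o f) &
      forall S, A S -> (\int[P]_(w in S) (f w)%:E)%E = P (S `&` B)].

Definition cond_prob (A : set (set Omega)) (B : set Omega) : Omega -> R :=
  xget (fun=> 0) (is_cond_prob A B).

Definition ae_upper_bound (F : set (Omega -> R)) (h : Omega -> \bar R) :=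
  measurable_fun setT h /\
  forall f, F f -> {ae P, forall w, ((f w)%:E <= h w)%E}.

(* Essential supremum of a (possibly uncountable) family of functions; the
   library's [ess_sup] is the essential supremum of a single function. *)
Definition is_ess_supremum (F : set (Omega -> R)) (h : Omega -> \bar R) :=
  ae_upper_bound F h /\
  forall h', ae_upper_bound F h' -> {ae P, forall w, (h w <= h' w)%E}.

Definition ess_supremum (F : set (Omega -> R)) : Omega -> \bar R :=
  xget (fun=> +oo%E) (is_ess_supremum F).

(* E[sup_(B in B0) |P(B | A) - P(B)|].  Each P(B | A) is only determined up to a
   null set, so the supremum over the possibly uncountable family B0 is the
   essential one. *)
Definition abs_regularity (A B0 : set (set Omega)) : R :=
  let F := [set (fun w : Omega => `|cond_prob A B w - fine (P B)|) | B in B0] in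
  fine (\int[P]_w ess_supremum F w)%E.

(* The library's [normal_prob m 0] is the uniform law on [0, 1], hence the
   separate treatment of degenerate normal laws. *)
Definition is_normal (Y : Omega -> R) :=
  exists m s : R, forall A : set R, measurable A ->
    P (Y @^-1` A) = if s == 0 then \d_m A else normal_prob m s A.

Definition gaussian_process (T : Type) (Z : T -> Omega -> R) :=
  forall k (t : 'I_k -> T) (a : 'I_k -> R),
    is_normal (fun w => \sum_(i < k) a i * Z (t i) w).

Definition centered_gaussian_process (T : Type) (Z : T -> Omega -> R)
    (c : T -> T -> R) :=
  [/\ gaussian_process Z,
      forall t, 'E_P[Z t]%E = 0%E &
      forall t u, covariance P (Z t) (Z u) = (c t u)%:E].

End probability_notions.

Definition fidi_cvg (R : realType) (T : Type)
    d (Omega : measurableType d) (P : probability Omega R)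
    (Zs : nat -> T -> Omega -> R)
    d' (Omega' : measurableType d') (P' : probability Omega' R)
    (Z : T -> Omega' -> R) :=
  forall k (t : 'I_k -> T) (f : 'rV[R]_k -> R),
    continuous f -> (exists M : R, forall x, `|f x| <= M) ->
    'E_P[fun w => f (\row_i Zs n (t i) w)]%E @[n --> \oo] -->
    'E_P'[fun w => f (\row_i Z (t i) w)]%E.

Section sliding_blocks.
Context {R : realType} {E : completeNormedModType R}.
Context {d} {Omega : measurableType d} (P : probability Omega R).
Variable X : nat -> nat -> {RV P >-> borel E}.

Definition row_stationary n :=
  forall k h, (h + k <= n)%N ->
  forall A : set (k.-tuple (borel E)), measurable A ->
    P [set w | A [tuple X n (h + i.+1) w | i < k]] =
    P [set w | A [tuple X n i.+1 w | i < k]].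

Definition row_sigma n i j : set (set Omega) :=
  <<s \bigcup_(l in [set l | (i <= l <= j)%N])
        preimage_set_system setT (X n l) measurable >>.

(* The supremum of the empty set is 0 here. *)
Definition beta_mixing n k : R :=
  sup [set abs_regularity P (row_sigma n 1 l) (row_sigma n (l + k + 1) n)
      | l in [set l | (1 <= l)%N && (l + k + 1 <= n)%N]].

(* E_cup, the union of all E^k, is [seq E] (the empty vector, for k = 0, is a
   null vector and is never evaluated since s_n > 0).  The set G of functionals is
   the range of g; the topology of its index set T is arbitrary and only matters
   for separability. *)
Variables (T : topologicalType) (g : T -> seq E -> R).
Variables (s r : nat -> nat) (b : nat -> T -> R).

(* E^k carries the product of the Borel sigma-fields, so that g (Y_(n,j)) is
   measurable without separability of E. *)
Definition measurable_functional d' (U : measurableType d') (f : seq E -> U) :=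
  forall k, measurable_fun setT (fun x : k.-tuple (borel E) => f x).

Definition vanishes_on_null (f : seq E -> R) :=
  forall k, f (nseq k 0) = 0.

Definition gmax (x : seq E) : \bar R :=
  ereal_sup (range (fun t => `|g t x|%:E)).

Definition Yn n j (w : Omega) : seq E :=
  [seq (X n i w : E) | i <- iota j (s n)].

(* n - s_n + 1, with the successor inside because of truncated subtraction. *)
Definition nslide n : nat := n.+1 - s n.

Definition mn n : nat := nslide n %/ r n.

Definition Vn n i t (w : Omega) : R :=
  (b n t)^-1 * \sum_(1 <= j < (r n).+1) g t (Yn n ((i - 1) * r n + j) w).

(* The event is measurable up to a null set when V_n is separable. *)
Definition pn n : R :=
  fine (outer_prob P [set w | exists t, Vn n 1 t w != 0]).

Definition centered_sum n N t (w : Omega) : R :=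
  (Num.sqrt (pn n) * b n t)^-1 *
  \sum_(1 <= j < N.+1)
     (g t (Yn n j w) - fine 'E_P[fun w' => g t (Yn n j w')]%E).

Definition Zbarn n t w := centered_sum n (nslide n) t w.

Definition Zn n t w := centered_sum n (mn n * r n) t w.

Definition block_count n t (w : Omega) : R :=
  \sum_(1 <= j < (r n).+1) (g t (Yn n j w) != 0)%:R.

End sliding_blocks.

(* Main.v *)
(* Fewer than r_n summands separate Z_n from its barred version, and
   r_n = o(sqrt p_n inf b_n): this gives the first claim.

   For the second one, cut the first m_n r_n summands into blocks of length r_n
   and drop the last l_n summands of each block.  By stationarity
   floor(r_n/l_n) E[(number of nonzero summands in a dropped part)^2] is at most
   the second moment bounded in (6), so the dropped parts are negligible because
   l_n = o(r_n).  What remains of consecutive blocks is l_n - s_n observations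
   apart, so by beta-mixing the characteristic function of the sum is nearly the
   product of those of the blocks; each block sum is o(1) and a second order
   expansion gives the Gaussian limit for all linear combinations.

   The limit process is built on a Loeb space: over an ultraproduct of copies of
   Omega, G_t is the standard part of Z_n(t), so that expectations of bounded
   continuous functions of G are limits along the ultrafilter.  Characteristic
   functions determine finite dimensional laws, hence these limits do not depend
   on the ultrafilter, and they are genuine limits. *)

Require Import Defs.
From HB Require Import structures.
From mathcomp Require Import all_boot all_order all_algebra.
From mathcomp Require Import all_classical all_reals all_analysis.
From mathcomp Require Import measurable_realfun ring lra zify.

Set Implicit Arguments.
Unset Strict Implicit.
Unset Printing Implicit Defensive.

Import Order.TTheory GRing.Theory Num.Theory.
Import numFieldNormedType.Exports.

Local Open Scope classical_set_scope.
Local Open Scope ring_scope.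

(** * Bounded measurable functions *)

(** The Gaussian process is obtained without checking that [c] is positive semidefinite and without
    an extension theorem: the Loeb construction delivers the process at once, and the sign of each
    quadratic form of [c] is read off from the fact that a mean of cosines is at most 1. Tightness,
    needed so that standard parts are finite, comes from averaging characteristic functions over a
    normal frequency. Complex numbers are avoided: a characteristic function is a pair of means of
    [cos] and [sin], and a free phase packs both into cosines. The dropped parts are not summed in
    mean square, which would need covariances between blocks. They are separated from each other by
    the kept parts, so the same limit theorem applies to them with variance 0, and a mean cosine
    tending to 1 makes them negligible. Beta-mixing enters only through the covariance bound for two
    events that it implies; since the coefficient is defined with conditional probabilities and
    essential suprema picked by choice, existence of both is proved first. *)

Lemma cvg_ub (R : realType) (T : Type) (F : set_system T) (FF : ProperFilter F)
    (u : T -> R) (l M : R) :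
  u x @[x --> F] --> l -> (\forall x \near F, u x <= M) -> l <= M.
Proof.
by move=> ul uM; rewrite -(cvg_lim _ ul)//; apply: limr_le => //; apply/cvg_ex; exists l.
Qed.

Lemma norm_natb_le1 (R : realType) (c : bool) : `|c%:R| <= 1 :> R.
Proof. by case: c; rewrite ?normr1 ?normr0. Qed.

Lemma cvg_sumr (R : realType) (T : Type) (F : set_system T) (FF : Filter F) (I : Type)
    (s : seq I) (u : I -> T -> R) (l : I -> R) :
  (forall i, u i x @[x --> F] --> l i) ->
  \sum_(i <- s) u i x @[x --> F] --> \sum_(i <- s) l i.
Proof.
move=> ul; elim: s => [|i s IH].
  by rewrite big_nil; under eq_fun do rewrite big_nil; exact: cvg_cst.
by rewrite big_cons; under eq_fun do rewrite big_cons; exact: cvgD.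
Qed.

Section bounded_measurable.
Context {d} {W : measurableType d} {R : realType}.
Implicit Types f g : W -> R.

(** For fixed [n] the sums of the empirical process are bounded, because [gmax] is. This class is
    closed under the operations needed and settles integrability for the real-valued integral. *)
Definition bdm f := measurable_fun setT f /\ exists M, forall w, `|f w| <= M.

Lemma bdm_cst (a : R) : bdm (cst a).
Proof. by split; [exact: measurable_cst | exists `|a|]. Qed.

Lemma bdmD f g : bdm f -> bdm g -> bdm (fun w => f w + g w).
Proof.
move=> [mf [M hM]] [mg [N hN]]; split; first exact: measurable_funD.
by exists (M + N) => w; rewrite (le_trans (ler_normD _ _)) ?lerD.
Qed.

Lemma bdmM f g : bdm f -> bdm g -> bdm (fun w => f w * g w).
Proof.
move=> [mf [M hM]] [mg [N hN]]; split; first exact: measurable_funM.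
by exists (M * N) => w; rewrite normrM ler_pM.
Qed.

Lemma bdmZ a f : bdm f -> bdm (fun w => a * f w).
Proof. exact/bdmM/bdm_cst. Qed.

Lemma bdmN f : bdm f -> bdm (fun w => - f w).
Proof.
move=> /(bdmZ (-1)); congr bdm; apply/funext => w; exact: mulN1r.
Qed.

Lemma bdmB f g : bdm f -> bdm g -> bdm (fun w => f w - g w).
Proof. by move=> bf /bdmN; exact: bdmD. Qed.

Lemma bdmX f n : bdm f -> bdm (fun w => f w ^+ n).
Proof.
move=> bf; elim: n => [|n IH]; first exact: bdm_cst.
by have -> : (fun w => f w ^+ n.+1) = (fun w => f w * f w ^+ n);
  [apply/funext => w; rewrite exprS | exact: bdmM].
Qed.

Lemma bdm_sum (I : Type) (s : seq I) (p : pred I) (f : I -> W -> R) :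
  (forall i, p i -> bdm (f i)) -> bdm (fun w => \sum_(i <- s | p i) f i w).
Proof.
move=> bf; elim: s => [|i s IH].
  have -> : (fun w => \sum_(i <- [::] | p i) f i w) = cst 0.
    by apply/funext => w; rewrite big_nil.
  exact: bdm_cst.
case pi: (p i); last first.
  by rewrite (_ : (fun w => _) = fun w => \sum_(j <- s | p j) f j w)//;
    apply/funext => w; rewrite big_cons pi.
have -> : (fun w => \sum_(j <- i :: s | p j) f j w) =
    (fun w => f i w + \sum_(j <- s | p j) f j w).
  by apply/funext => w; rewrite big_cons pi.
by apply: bdmD => //; exact: bf.
Qed.

Lemma bdm_le f M : measurable_fun setT f -> (forall w, `|f w| <= M) -> bdm f.
Proof. by split => //; exists M. Qed.

Lemma bdm_norm f : bdm f -> bdm (fun w => `|f w|).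
Proof.
move=> [mf [M hM]]; apply: (@bdm_le _ M) => [|w]; last by rewrite normr_id.
exact: measurableT_comp.
Qed.

Lemma measurable_cosf f : measurable_fun setT f -> measurable_fun setT (fun w => cos (f w)).
Proof.
move=> mf; apply: (measurableT_comp _ mf).
exact: continuous_measurable_fun (@continuous_cos R).
Qed.

Lemma measurable_sinf f : measurable_fun setT f -> measurable_fun setT (fun w => sin (f w)).
Proof.
move=> mf; apply: (measurableT_comp _ mf).
exact: continuous_measurable_fun (@continuous_sin R).
Qed.

Lemma norm_cos_le1 (x : R) : `|cos x| <= 1.
Proof. by rewrite ler_norml cos_geN1 cos_le1. Qed.

Lemma norm_sin_le1 (x : R) : `|sin x| <= 1.
Proof. by rewrite ler_norml sin_geN1 sin_le1. Qed.

Lemma bdm_cos f : measurable_fun setT f -> bdm (fun w => cos (f w)).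
Proof.
by move=> mf; apply: (@bdm_le _ 1) => [|w]; [exact: measurable_cosf | exact: norm_cos_le1].
Qed.

Lemma bdm_sin f : measurable_fun setT f -> bdm (fun w => sin (f w)).
Proof.
by move=> mf; apply: (@bdm_le _ 1) => [|w]; [exact: measurable_sinf | exact: norm_sin_le1].
Qed.

Variable P : probability W R.

Lemma bdm_integrable f : bdm f -> P.-integrable setT (EFin \o f).
Proof.
move=> [mf [M hM]]; apply: measurable_bounded_integrable => //.
  by rewrite (le_lt_trans (probability_le1 _ _)) ?ltry.
by exists M; split; [exact: num_real|move=> x Mx w _; exact: le_trans (hM w) (ltW Mx)].
Qed.

Notation E f := (\int[P]_w f w).

Lemma E_fin f : bdm f -> (\int[P]_w (f w)%:E)%E = (E f)%:E.
Proof. by move=> bf; rewrite /Rintegral fineK// integrable_fin_num//; exact: bdm_integrable. Qed.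

Lemma expectation_E f : bdm f -> 'E_P[f]%E = (E f)%:E.
Proof. by move=> bf; rewrite unlock E_fin. Qed.

Lemma E_cst (a : R) : E (fun=> a) = a.
Proof. by rewrite Rintegral_cst//= probability_setT /= mulr1. Qed.

Lemma ED f g : bdm f -> bdm g -> E (fun w => f w + g w) = E f + E g.
Proof. by move=> bf bg; rewrite RintegralD//; exact: bdm_integrable. Qed.

Lemma EB f g : bdm f -> bdm g -> E (fun w => f w - g w) = E f - E g.
Proof. by move=> bf bg; rewrite RintegralB//; exact: bdm_integrable. Qed.

Lemma EZ a f : bdm f -> E (fun w => a * f w) = a * E f.
Proof. by move=> bf; rewrite RintegralZl//; exact: bdm_integrable. Qed.

Lemma E_sum (I : Type) (s : seq I) (p : pred I) (f : I -> W -> R) :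
  (forall i, p i -> bdm (f i)) ->
  E (fun w => \sum_(i <- s | p i) f i w) = \sum_(i <- s | p i) E (f i).
Proof.
move=> bf; elim: s => [|i s IH].
  by under eq_Rintegral do rewrite big_nil; rewrite big_nil E_cst.
under eq_Rintegral do rewrite big_cons; rewrite big_cons; case: ifP => // pi.
by rewrite ED ?IH//; [exact: bf|exact: bdm_sum].
Qed.

Lemma le_E f g : bdm f -> bdm g -> (forall w, f w <= g w) -> E f <= E g.
Proof. by move=> bf bg fg; apply: le_Rintegral => //; exact: bdm_integrable. Qed.

Lemma E_ge0 f : (forall w, 0 <= f w) -> 0 <= E f.
Proof. by move=> f0; exact: Rintegral_ge0. Qed.

Lemma norm_E_le f g : bdm f -> bdm g -> (forall w, `|f w| <= g w) -> `|E f| <= E g.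
Proof.
move=> bf bg fg; apply: le_trans (le_E (bdm_norm bf) bg fg).
by apply: le_normr_Rintegral => //; exact: bdm_integrable.
Qed.

Lemma norm_E_cst f (M : R) : bdm f -> (forall w, `|f w| <= M) -> `|E f| <= M.
Proof. by move=> bf fM; rewrite -(E_cst M) norm_E_le//; exact: bdm_cst. Qed.

Lemma E_indic (A : set W) : measurable A -> E (\1_A) = fine (P A).
Proof. by move=> mA; rewrite /Rintegral integral_indic// setIT. Qed.

Lemma bdm_cvg_lim (f_ : nat -> W -> R) f (M : R) :
  (forall n, measurable_fun setT (f_ n)) -> (forall n w, `|f_ n w| <= M) ->
  (forall w, f_ n w @[n --> \oo] --> f w) -> bdm f.
Proof.
move=> mf_ hM cf; apply: (@bdm_le _ M).
  by apply: measurable_fun_cvg mf_ _ => w _; exact: cf.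
move=> w; apply: cvg_ub (cvg_norm (cf w)) _; exact: nearW.
Qed.

Lemma cvg_E (f_ : nat -> W -> R) f (M : R) :
  (forall n, measurable_fun setT (f_ n)) -> (forall n w, `|f_ n w| <= M) ->
  (forall w, f_ n w @[n --> \oo] --> f w) ->
  E (f_ n) @[n --> \oo] --> E f.
Proof.
move=> mf_ hM cf; have bf := bdm_cvg_lim mf_ hM cf.
apply: fine_cvg; rewrite -E_fin//.
apply: (@dominated_cvg _ _ _ P _ _ (fun n w => (f_ n w)%:E) (EFin \o f) (cst M%:E)) => //.
- by move=> n; exact/measurable_EFinP.
- by move=> w _; apply: cvg_EFin; [exact: nearW|exact: cf].
- by apply: finite_measure_integrable_cst.
- by move=> n w _; rewrite lee_fin.
Qed.

End bounded_measurable.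

(** * Characteristic functions determine laws *)

Section square_wave.
Context {R : realType}.

Lemma bernoulli_le (u : R) n : 0 <= u <= 1 -> 1 - n%:R * u <= (1 - u) ^+ n.
Proof.
move=> /andP[u0 u1]; elim: n => [|n IH]; first by rewrite mul0r subr0 expr0.
rewrite exprS -natr1.
apply: (@le_trans _ _ ((1 - u) * (1 - n%:R * u))); last first.
  by rewrite ler_wpM2l// subr_ge0.
rewrite -subr_ge0 (_ : _ - _ = n%:R * u ^+ 2); last by ring.
by rewrite mulr_ge0// exprn_ge0.
Qed.

(** The left-hand side equals 1 at [n = 0] and does not increase with [n]. It bounds [n%:R * q ^+ n]
    by [(1 - q)^-1], uniformly in [n]. *)
Lemma natM_expr_le (q : R) n : 0 <= q < 1 -> (1 - q) * (n%:R * q ^+ n) + q ^+ n <= 1.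
Proof.
move=> /andP[q0 q1]; elim: n => [|n IH]; first by rewrite mul0r mulr0 expr0; lra.
apply: le_trans IH; rewrite exprS -natr1.
have h : 0 <= q ^+ n by exact: exprn_ge0.
have n0 : 0 <= (n%:R : R) by [].
rewrite -subr_ge0.
have -> : (1 - q) * (n%:R * q ^+ n) + q ^+ n -
  ((1 - q) * ((n%:R + 1) * (q * q ^+ n)) + q * q ^+ n) =
  q ^+ n * ((1 - q) ^+ 2 * n%:R + (1 - q) ^+ 2) by ring.
apply: mulr_ge0 => //; apply: addr_ge0; last exact: sqr_ge0.
by apply: mulr_ge0 => //; exact: sqr_ge0.
Qed.

(** With [p] the square root of [q], the product is [n%:R * p ^+ n], which stays bounded, times
    [p ^+ n], which tends to 0. *)
Lemma cvg_natM_expr (q : R) : 0 <= q < 1 -> n%:R * q ^+ n @[n --> \oo] --> (0 : R).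
Proof.
move=> /andP[q0 q1]; pose p := Num.sqrt q.
have p0 : 0 <= p by exact: sqrtr_ge0.
have p1 : p < 1 by rewrite -sqrtr1 ltr_sqrt.
have qE : q = p * p by rewrite -expr2 sqr_sqrtr.
have cp : (1 - p)^-1 * p ^+ n @[n --> \oo] --> (0 : R).
  rewrite -[X in _ --> X](mulr0 (1 - p)^-1); apply: cvgMr.
  by apply: cvg_expr; rewrite ger0_norm.
apply: (squeeze_cvgr _ (@cvg_cst _ (0 : R) _ _ _) cp).
near=> n; rewrite mulr_ge0//=; last exact: exprn_ge0.
rewrite qE exprMn mulrA ler_wpM2r ?exprn_ge0//.
rewrite -[leRHS]mul1r ler_pdivlMr ?subr_gt0// mulrC.
have := @natM_expr_le p n; rewrite p0 p1 => /(_ isT).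
by have := exprn_ge0 n p0; lra.
Unshelve. all: by end_near. Qed.

(** Polynomials in [v] that tend to a step at 1/2. The exponent [n * 2 ^ n] suits both sides: for
    [v >= 1/2] the outer power is at most [exp (- n)], while for [v < 1/2] Bernoulli's inequality
    leaves an error [n (2 v)^n], which still vanishes. *)
Lemma cvg_threshold (v : R) : 0 <= v <= 1 ->
  1 - (1 - v ^+ n) ^+ (n * 2 ^ n) @[n --> \oo] --> ((2^-1 <= v :> R)%R%:R : R).
Proof.
move=> /andP[v0 v1].
have vn n : 0 <= v ^+ n <= 1 by rewrite exprn_ge0//= exprn_ile1.
have [hv|hv] := leP 2^-1 v.
- rewrite -[X in _ --> X]subr0; apply: cvgB; first exact: cvg_cst.
  have ce : (expR (-1 : R)) ^+ n @[n --> \oo] --> (0 : R).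
    apply: cvg_expr; rewrite ger0_norm; first by rewrite expR_lt1 oppr_lt0.
    exact: expR_ge0.
  apply: (squeeze_cvgr _ (@cvg_cst _ (0 : R) _ _ _) ce).
  near=> n; have /andP[h0 h1] := vn n.
  rewrite exprn_ge0 ?subr_ge0//=.
  rewrite -expRM_natl.
  have -> : n%:R * (-1) = (n * 2 ^ n)%:R * (- (2^-1) ^+ n) :> R.
    rewrite natrM natrX exprVn -mulrA; congr (_ * _).
    by rewrite mulrN mulfV// expf_neq0.
  rewrite expRM_natl; apply: lerXn2r; rewrite ?nnegrE ?subr_ge0 ?expR_ge0//.
  apply: le_trans (expR_ge1Dx _); rewrite lerB//.
  by apply: lerXn2r; rewrite ?nnegrE ?invr_ge0.
- rewrite -[X in _ --> X](subrr (1 : R)); apply: cvgB; first exact: cvg_cst.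
  have c2 : 1 - n%:R * (2 * v) ^+ n @[n --> \oo] --> (1 : R).
    rewrite -[X in _ --> X]subr0; apply: cvgB; first exact: cvg_cst.
    by apply: cvg_natM_expr; lra.
  apply: (squeeze_cvgr _ c2 (@cvg_cst _ (1 : R) _ _ _)).
  near=> n; have /andP[h0 h1] := vn n; apply/andP; split.
    apply: le_trans (bernoulli_le _ (vn n)).
    by rewrite exprMn natrM natrX mulrA.
  by apply: exprn_ile1; rewrite ?subr_ge0//; lra.
Unshelve. all: by end_near. Qed.

(** Once the argument lies in [(- pi, pi)] its sine has the sign of [x]: stretching a square wave
    turns it into the indicator of a half-line. *)
Lemma cvg_sin_sign (x : R) :
  ((0 <= sin (n.+1%:R^-1 * x))%R%:R : R) @[n --> \oo] --> ((0 <= x)%R%:R : R).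
Proof.
have cx : n.+1%:R^-1 * x @[n --> \oo] --> (0 : R).
  by rewrite -[X in _ --> X](mul0r x); apply: cvgMl; exact: cvg_harmonic.
apply: (@cvg_near_cst _ _ ((0 <= x)%R%:R : R)).
have n0 n : 0 < (n.+1%:R^-1 : R) by rewrite invr_gt0 ltr0n.
near=> n; have hn : `|n.+1%:R^-1 * x| < pi.
  by near: n; apply: cvgr0_norm_lt cx _ (pi_gt0 R).
congr (_ %:R); have [x0|x0] := leP 0 x.
  rewrite sin_ge0_pi// (mulr_ge0 (ltW (n0 n)) x0)/= ltW//.
  by rewrite (le_lt_trans (ler_norm _) hn).
have : 0 < sin (- (n.+1%:R^-1 * x)).
  apply: sin_gt0_pi; rewrite oppr_gt0 pmulr_rlt0// x0/=.
  by rewrite (le_lt_trans (ler_norm _))// normrN.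
by rewrite sinN oppr_gt0 => /lt_geF ->.
Unshelve. all: by end_near. Qed.

End square_wave.

Section quantization.
Context {R : realType}.

Definition grid (N j : nat) : R := - N%:R + j.+1%:R / N.+1%:R.

(** For [|u| <= N] this rounds [u] down to a mesh of width [1 / (N + 1)]. Written as a count of
    thresholds, it depends on [u] only through finitely many half-line indicators. *)
Definition quant (N : nat) (u : R) : R :=
  - N%:R + (\sum_(j < 2 * N * N.+1) (grid N j <= u)%R%:R) / N.+1%:R.

Lemma quant_close N u : `|u| <= N%:R -> `|quant N u - u| <= N.+1%:R^-1.
Proof.
rewrite ler_norml => /andP[uN Nu]; pose y := (u + N%:R) * N.+1%:R.
have N0 : 0 < (N.+1%:R : R) by rewrite ltr0n.
have y0 : 0 <= y by apply: mulr_ge0 (ltW N0); lra.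
have yL : y <= (2 * N * N.+1)%:R.
  by rewrite natrM ler_pM2r// natrM; lra.
have tL : (Num.trunc y <= 2 * N * N.+1)%N.
  by rewrite -(ler_nat R); apply: le_trans yL; rewrite truncn_le.
rewrite /quant; have -> : \sum_(j < 2 * N * N.+1) (grid N j <= u)%R%:R = (Num.trunc y)%:R :> R.
  rewrite -natr_sum; congr _%:R.
  have E (j : 'I_(2 * N * N.+1)) : (grid N j <= u) = (j < Num.trunc y)%N.
    by rewrite truncn_gt_nat /grid /y -lerBrDl opprK ler_pdivrMr.
  under eq_bigr => j _ do rewrite E.
  by rewrite -big_mkcond/= -(big_ord_widen _ (fun=> 1%N) tL) sum1_card card_ord.
have /andP[t1 t2] := truncn_itv y0.
rewrite -[u in X in X <= _](addrK N%:R) -[u + _](mulfK (lt0r_neq0 N0)) -/y.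
rewrite (_ : _ - _ = - ((y - (Num.trunc y)%:R) / N.+1%:R)); last by field.
rewrite normrN ger0_norm; last by rewrite divr_ge0 ?subr_ge0// ltW.
by rewrite ler_pdivrMr// mulVf ?gt_eqF// lerBlDl natr1 ltW.
Qed.

Lemma cvg_quant u : quant N u @[N --> \oo] --> u.
Proof.
apply/cvgrPdist_le => e e0; near=> N.
have uN : `|u| <= N%:R.
  by near: N; exact: nbhs_infty_ger.
rewrite distrC (le_trans (quant_close uN))//.
by apply: ltW; near: N; exact: (near_infty_natSinv_lt (PosNum e0)).
Unshelve. all: by end_near. Qed.

End quantization.

Section chf_uniqueness.
Context {R : realType} {d1} {W1 : measurableType d1} (P1 : probability W1 R)
  {d2} {W2 : measurableType d2} (P2 : probability W2 R) (k : nat)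
  (x : 'I_k -> W1 -> R) (y : 'I_k -> W2 -> R).
Hypothesis mx : forall i, measurable_fun setT (x i).
Hypothesis my : forall i, measurable_fun setT (y i).

Definition dotp (a u : 'I_k -> R) := \sum_i a i * u i.

Hypothesis chf_eq : forall a b,
  \int[P1]_w cos (dotp a (x ^~ w) + b) = \int[P2]_w cos (dotp a (y ^~ w) + b).

Implicit Types phi psi : ('I_k -> R) -> R.

Let pull1 phi w := phi (x ^~ w).
Let pull2 phi w := phi (y ^~ w).

Lemma measurable_dotp d (W : measurableType d) (z : 'I_k -> W -> R) a b :
  (forall i, measurable_fun setT (z i)) ->
  measurable_fun setT (fun w => dotp a (z ^~ w) + b).
Proof.
move=> mz; apply: measurable_funD => //; apply: measurable_sum => i.
exact: measurable_funM.
Qed.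

(** The free phase [b] lets cosines carry the whole characteristic function, as the sine is a cosine
    shifted by [pi / 2], and it keeps the test functions stable under the product formula for
    cosines. *)
Definition chf_agree phi := [/\ bdm (pull1 phi), bdm (pull2 phi) &
  forall a b, \int[P1]_w (pull1 phi w * cos (dotp a (x ^~ w) + b)) =
              \int[P2]_w (pull2 phi w * cos (dotp a (y ^~ w) + b))].

(* Multiplication by cosines preserves [chf_agree]; so does multiplication by
   any bounded pointwise limit of trigonometric polynomials, such as the
   indicators of orthants. *)
Definition chf_mult psi := [/\ bdm (pull1 psi), bdm (pull2 psi) &
  forall phi, chf_agree phi -> chf_agree (fun u => phi u * psi u)].

Lemma chf_agree_cst c : chf_agree (fun=> c).
Proof.
split; [exact: bdm_cst|exact: bdm_cst|move=> a b].
by rewrite !EZ ?chf_eq//; exact/bdm_cos/measurable_dotp.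
Qed.

Lemma chf_agreeD phi psi : chf_agree phi -> chf_agree psi ->
  chf_agree (fun u => phi u + psi u).
Proof.
move=> [b1 b2 e] [b1' b2' e']; split; [exact: bdmD|exact: bdmD|move=> a b].
rewrite /pull1 /pull2.
under eq_Rintegral do rewrite mulrDl; under [RHS]eq_Rintegral do rewrite mulrDl.
by rewrite !ED ?e ?e'//; apply: bdmM => //; exact/bdm_cos/measurable_dotp.
Qed.

Lemma chf_mult_cst c : chf_mult (fun=> c).
Proof.
split; [exact: bdm_cst|exact: bdm_cst|move=> phi [b1 b2 e]].
split; [exact: bdmM b1 (bdm_cst c)|exact: bdmM b2 (bdm_cst c)|move=> a b].
rewrite /pull1 /pull2.
under eq_Rintegral do rewrite mulrAC mulrC.
under [RHS]eq_Rintegral do rewrite mulrAC mulrC.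
by rewrite !EZ ?e//; apply: bdmM => //; exact/bdm_cos/measurable_dotp.
Qed.

Lemma chf_multD psi1 psi2 : chf_mult psi1 -> chf_mult psi2 ->
  chf_mult (fun u => psi1 u + psi2 u).
Proof.
move=> [b1 b2 e] [b1' b2' e']; split; [exact: bdmD|exact: bdmD|move=> phi ph].
rewrite (_ : (fun u => _) = fun u => phi u * psi1 u + phi u * psi2 u); last first.
  by apply/funext => u; rewrite mulrDr.
by apply: chf_agreeD; [exact: e|exact: e'].
Qed.

Lemma chf_multM psi1 psi2 : chf_mult psi1 -> chf_mult psi2 ->
  chf_mult (fun u => psi1 u * psi2 u).
Proof.
move=> [b1 b2 e] [b1' b2' e']; split; [exact: bdmM|exact: bdmM|move=> phi ph].
rewrite (_ : (fun u => _) = fun u => phi u * psi1 u * psi2 u); last first.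
  by apply/funext => u; rewrite mulrA.
exact/e'/e.
Qed.

Lemma chf_multX psi n : chf_mult psi -> chf_mult (fun u => psi u ^+ n).
Proof.
move=> h; elim: n => [|n IH]; first exact: chf_mult_cst.
rewrite (_ : (fun u => _) = fun u => psi u * psi u ^+ n); first exact: chf_multM.
by apply/funext => u; rewrite exprS.
Qed.

Lemma chf_mult1B psi : chf_mult psi -> chf_mult (fun u => 1 - psi u).
Proof.
move=> h; rewrite (_ : (fun u => _) = fun u => 1 + (-1) * psi u).
  by apply: chf_multD; [|apply: chf_multM => //]; exact: chf_mult_cst.
by apply/funext => u; rewrite mulN1r.
Qed.

Lemma chf_mult_sum (I : finType) (psi : I -> ('I_k -> R) -> R) :
  (forall i, chf_mult (psi i)) -> chf_mult (fun u => \sum_i psi i u).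
Proof.
move=> h; elim: (index_enum I) => [|i s IH].
  rewrite (_ : (fun u => _) = fun=> 0); first exact: chf_mult_cst.
  by apply/funext => u; rewrite big_nil.
rewrite (_ : (fun u => _) = fun u => psi i u + \sum_(j <- s) psi j u).
  exact: chf_multD.
by apply/funext => u; rewrite big_cons.
Qed.

Lemma chf_mult_prod (I : finType) (psi : I -> ('I_k -> R) -> R) :
  (forall i, chf_mult (psi i)) -> chf_mult (fun u => \prod_i psi i u).
Proof.
move=> h; elim: (index_enum I) => [|i s IH].
  rewrite (_ : (fun u => _) = fun=> 1); first exact: chf_mult_cst.
  by apply/funext => u; rewrite big_nil.
rewrite (_ : (fun u => _) = fun u => psi i u * \prod_(j <- s) psi j u).
  exact: chf_multM.
by apply/funext => u; rewrite big_cons.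
Qed.

(** A product of two cosines is half the sum of the cosines of the sum and of the difference, and
    both arguments are again of the form [dotp _ u + _]. *)
Lemma chf_mult_cos a b : chf_mult (fun u => cos (dotp a u + b)).
Proof.
split; [exact/bdm_cos/measurable_dotp|exact/bdm_cos/measurable_dotp|].
move=> phi [b1 b2 e]; split.
- by apply: bdmM => //; exact/bdm_cos/measurable_dotp.
- by apply: bdmM => //; exact/bdm_cos/measurable_dotp.
move=> a' b'.
have prodE d (W : measurableType d) (Q : probability W R) (z : 'I_k -> W -> R) :
    (forall i, measurable_fun setT (z i)) -> bdm (fun w => phi (z ^~ w)) ->
    \int[Q]_w (phi (z ^~ w) * cos (dotp a (z ^~ w) + b) * cos (dotp a' (z ^~ w) + b')) =
    2^-1 * (\int[Q]_w (phi (z ^~ w) * cos (dotp (fun i => a i + a' i) (z ^~ w) + (b + b'))) +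
            \int[Q]_w (phi (z ^~ w) * cos (dotp (fun i => a i - a' i) (z ^~ w) + (b - b')))).
  move=> mz bz.
  have bc a0 b0 : bdm (fun w => phi (z ^~ w) * cos (dotp a0 (z ^~ w) + b0)).
    by apply: bdmM => //; exact/bdm_cos/measurable_dotp.
  rewrite -ED// -EZ; last exact: bdmD.
  apply: eq_Rintegral => w _.
  have -> : dotp (fun i => a i + a' i) (z ^~ w) = dotp a (z ^~ w) + dotp a' (z ^~ w).
    by rewrite /dotp -big_split; apply: eq_bigr => i _; rewrite mulrDl.
  have -> : dotp (fun i => a i - a' i) (z ^~ w) = dotp a (z ^~ w) - dotp a' (z ^~ w).
    by rewrite /dotp -sumrB; apply: eq_bigr => i _; rewrite mulrBl.
  rewrite addrACA; have -> : dotp a (z ^~ w) - dotp a' (z ^~ w) + (b - b') =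
    (dotp a (z ^~ w) + b) - (dotp a' (z ^~ w) + b') by ring.
  set A := dotp a _ + b; set B := _ + b'.
  by rewrite (cosD A B) (cosB A B); field.
by rewrite /pull1 /pull2 !prodE// !e.
Qed.

Lemma chf_mult_lim (psi_ : nat -> ('I_k -> R) -> R) psi (M : R) :
  (forall n, chf_mult (psi_ n)) -> (forall n u, `|psi_ n u| <= M) ->
  (forall u, psi_ n u @[n --> \oo] --> psi u) -> chf_mult psi.
Proof.
move=> h hM hc.
have b1 : bdm (pull1 psi).
  by apply: (bdm_cvg_lim (f_ := fun n => pull1 (psi_ n)) (M := M)) => [n|n w|w];
    [have [[]] := h n|exact: hM|exact: hc].
have b2 : bdm (pull2 psi).
  by apply: (bdm_cvg_lim (f_ := fun n => pull2 (psi_ n)) (M := M)) => [n|n w|w];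
    [have [_ []] := h n|exact: hM|exact: hc].
split=> // phi ph; have [bp1 bp2 _] := ph.
split; [exact: bdmM|exact: bdmM|move=> a b].
have cvgz d (W : measurableType d) (Q : probability W R) (z : 'I_k -> W -> R) :
    (forall i, measurable_fun setT (z i)) -> bdm (fun w => phi (z ^~ w)) ->
    (forall n, bdm (fun w => psi_ n (z ^~ w))) ->
    \int[Q]_w (phi (z ^~ w) * psi_ n (z ^~ w) * cos (dotp a (z ^~ w) + b)) @[n --> \oo] -->
    \int[Q]_w (phi (z ^~ w) * psi (z ^~ w) * cos (dotp a (z ^~ w) + b)).
  move=> mz bz bn; have [K hK] := bz.2.
  apply: (cvg_E (M := K * M)) => [n|n w|w].
  - have [] // : bdm (fun w => phi (z ^~ w) * psi_ n (z ^~ w) * cos (dotp a (z ^~ w) + b)).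
    by apply: bdmM; [exact: bdmM|exact/bdm_cos/measurable_dotp].
  - rewrite !normrM -[leRHS]mulr1; apply: ler_pM => //; last exact: norm_cos_le1.
    by apply: ler_pM.
  - by apply: cvgMl; apply: cvgMr; exact: hc.
have c1 := cvgz _ _ P1 _ mx bp1 (fun n => let: And3 a1 _ _ := h n in a1).
have c2 := cvgz _ _ P2 _ my bp2 (fun n => let: And3 _ a2 _ := h n in a2).
have c12 : (fun n => \int[P1]_w (phi (x ^~ w) * psi_ n (x ^~ w) * cos (dotp a (x ^~ w) + b))) =
    (fun n => \int[P2]_w (phi (y ^~ w) * psi_ n (y ^~ w) * cos (dotp a (y ^~ w) + b))).
  by apply/funext => n; have [_ _ /(_ _ ph)[_ _ /(_ a b)]] := h n.
by rewrite c12 in c1; exact: (cvg_unique _ c1 c2).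
Qed.

(** Two limits. The map [v] sends a sine into [[0, 1]] so that [v >= 1/2] exactly where the sine is
    nonnegative; thresholding it gives a square wave. The period then tends to infinity. *)
Lemma chf_mult_ge i (c : R) : chf_mult (fun u => (c <= u i)%R%:R).
Proof.
have ms (m : nat) : chf_mult (fun u => (0 <= sin (m.+1%:R^-1 * (u i - c)))%R%:R).
  pose v u := 2^-1 + 2^-1 * sin (m.+1%:R^-1 * (u i - c)) : R.
  have mv : chf_mult v.
    apply: chf_multD; first exact: chf_mult_cst.
    apply: chf_multM; first exact: chf_mult_cst.
    pose a := fun j => if j == i then m.+1%:R^-1 else 0 : R.
    rewrite (_ : (fun u => _) = fun u => cos (dotp a u + (- (m.+1%:R^-1 * c) - pi / 2))).
      exact: chf_mult_cos.
    apply/funext => u; rewrite addrA cosBpihalf; congr sin.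
    rewrite /dotp (bigD1 i)//= big1 ?addr0; last first.
      by move=> j /negbTE ji; rewrite /a ji mul0r.
    by rewrite /a eqxx mulrBr.
  have v01 u : 0 <= v u <= 1.
    have := sin_geN1 (m.+1%:R^-1 * (u i - c)); have := sin_le1 (m.+1%:R^-1 * (u i - c)).
    by rewrite /v; lra.
  apply: (@chf_mult_lim (fun n u => 1 - (1 - v u ^+ n) ^+ (n * 2 ^ n)) _ 1) => [n|n u|u].
  - exact/chf_mult1B/chf_multX/chf_mult1B/chf_multX.
  - have /andP[v0 v1] := v01 u.
    have : 0 <= (1 - v u ^+ n) ^+ (n * 2 ^ n) <= 1.
      have : 0 <= v u ^+ n <= 1 by rewrite exprn_ge0// exprn_ile1.
      by move=> /andP[w0 w1]; rewrite exprn_ge0 ?exprn_ile1//; lra.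
    by move=> /andP[q0 q1]; rewrite ger0_norm; lra.
  - rewrite [X in _ --> X](_ : _ = ((2^-1 <= v u :> R)%R%:R : R)); last first.
      by congr (nat_of_bool _)%:R; rewrite /v lerDl pmulr_rge0// invr_gt0.
    exact: cvg_threshold.
apply: (chf_mult_lim (M := 1) ms) => [n u|u]; first exact: norm_natb_le1.
rewrite -(subr_ge0 c (u i)); exact: cvg_sin_sign.
Qed.

(** A function of finitely many bits is a polynomial in them: for each pattern [z] the product is 1
    if the bits equal [z] and 0 otherwise. *)
Lemma chf_mult_bits (I : finType) (A : I -> ('I_k -> R) -> bool) (F : {ffun I -> bool} -> R) :
  (forall i, chf_mult (fun u => (A i u)%:R)) ->
  chf_mult (fun u => F [ffun i => A i u]).
Proof.
move=> h; rewrite (_ : (fun u => _) = fun u => \sum_(z : {ffun I -> bool})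
    F z * \prod_i (if z i then (A i u)%:R else 1 - (A i u)%:R)); last first.
  apply/funext => u; rewrite (bigD1 [ffun i => A i u])//= [X in _ + X]big1; last first.
    move=> z zA; have [i zi] : exists i, z i != A i u.
      apply/existsP; rewrite -negb_forall; apply: contra zA => /forallP za.
      by apply/eqP/ffunP => i; rewrite ffunE; exact/eqP.
    rewrite (bigD1 i)//=; move: zi.
    by case: (z i); case: (A i u) => //= _; rewrite ?subrr mul0r mulr0.
  by rewrite addr0 big1 ?mulr1// => i _; rewrite ffunE; case: (A i u); rewrite ?subr0.
apply: chf_mult_sum => z; apply: chf_multM; first exact: chf_mult_cst.
apply: chf_mult_prod => i; case: (z i) => //; exact: chf_mult1B.
Qed.

Lemma cvg_row (T : Type) (F : set_system T) (FF : Filter F) (u_ : T -> 'I_k -> R)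
    (u : 'I_k -> R) : (forall i, u_ t i @[t --> F] --> u i) ->
  (\row_i u_ t i) @[t --> F] --> (\row_i u i : 'rV[R]_k).
Proof.
move=> h; apply/cvgrPdist_le => e e0.
have H i : \forall t \near F, `|u i - u_ t i| <= e by move/cvgrPdist_le : (h i); exact.
apply: (@filterS _ F FF _ _ _ (filter_forall FF H)) => t ht.
rewrite [leLHS]mx_normrE; apply: bigmax_le; first exact: ltW.
by move=> [i j] _ /=; rewrite !mxE.
Qed.

(** After rounding every coordinate, [f] reads only finitely many half-line indicators; continuity
    removes the rounding in the limit. This handles bounded continuous functions directly, without
    first identifying the joint laws. *)
Lemma chf_mult_continuous (f : 'rV[R]_k -> R) (M : R) : continuous f ->
  (forall v, `|f v| <= M) -> chf_mult (fun u => f (\row_i u i)).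
Proof.
move=> cf fM.
pose I (N : nat) := ('I_k * 'I_(2 * N * N.+1))%type.
pose F N (z : {ffun I N -> bool}) := f (\row_i (- N%:R + (\sum_j (z (i, j))%:R) / N.+1%:R)).
apply: (@chf_mult_lim (fun N u => f (\row_i quant N (u i))) _ M) => [N|N u|u] //.
- have := @chf_mult_bits (I N) (fun p u => grid N p.2 <= u p.1) (F N) (fun p => chf_mult_ge p.1 _).
  congr chf_mult; apply/funext => u; rewrite /F /quant; congr f.
  by apply/rowP => i; rewrite !mxE; under eq_bigr do rewrite ffunE.
- apply: (cvg_comp _ f); last exact: cf.
  by apply: cvg_row => i; exact: cvg_quant.
Qed.

Lemma chf_mult_E psi : chf_mult psi ->
  \int[P1]_w psi (x ^~ w) = \int[P2]_w psi (y ^~ w).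
Proof.
move=> [_ _ /(_ _ (chf_agree_cst 1))[_ _ /(_ (fun=> 0) 0)]].
have dot0 u : dotp (fun=> 0) u = 0 by rewrite /dotp big1// => i _; rewrite mul0r.
rewrite /pull1 /pull2; under eq_Rintegral do rewrite dot0 addr0 cos0 mulr1 mul1r.
by under [RHS]eq_Rintegral do rewrite dot0 addr0 cos0 mulr1 mul1r.
Qed.

End chf_uniqueness.

(** Measurability is a by-product of the rounding argument, which exhibits the function as a
    pointwise limit of functions of finitely many indicators. The Dirac masses are mere placeholders
    for the two laws. *)
Lemma bdm_row (R : realType) d (W : measurableType d) (k : nat) (z : 'I_k -> W -> R)
    (f : 'rV[R]_k -> R) (M : R) : (forall i, measurable_fun setT (z i)) ->
  continuous f -> (forall v, `|f v| <= M) -> bdm (fun w => f (\row_i z i w)).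
Proof.
move=> mz cf fM.
by have [] := @chf_mult_continuous R _ W (@dirac _ W point R : probability W R) _ W (@dirac _ W point R : probability W R) k z z mz mz
  f M cf fM.
Qed.

(** * Conditional probabilities and strong mixing *)

Section conditional_probability.
Context {d} {W : measurableType d} {R : realType} (P : probability W R).
Variables (G : set (set W)) (hG : G `<=` measurable).

Lemma sub_sigma_measurable : <<s G >> `<=` measurable.
Proof.
apply: smallest_sub => //; exact: sigma_algebra_measurable.
Qed.

(** The identity towards the coarser sigma-field: its distribution is the restriction of [P], so
    integrals over the two sigma-fields are linked by a change of variables. *)
Definition sub_id : W -> g_sigma_algebraType G := idfun.

Lemma measurable_sub_id : measurable_fun setT sub_id.
Proof. by move=> _ Y mY; rewrite setTI; exact: sub_sigma_measurable. Qed.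

HB.instance Definition _ := isMeasurableFun.Build _ _ _ _ sub_id measurable_sub_id.

Variables (B : set W) (mB : measurable B).

Definition sub_restr (A : set (g_sigma_algebraType G)) : \bar R :=
  mrestr P mB (A : set W).

Let sub_restr0 : sub_restr set0 = 0%E.
Proof. exact: (measure0 (mrestr P mB)). Qed.

Let sub_restr_ge0 A : (0 <= sub_restr A)%E.
Proof. exact: (measure_ge0 (mrestr P mB)). Qed.

Let sub_restr_sigma_additive : semi_sigma_additive sub_restr.
Proof.
move=> A mA tA mUA; apply: (@measure_semi_sigma_additive _ _ _ (mrestr P mB)) => //.
- by move=> i; exact: sub_sigma_measurable (mA i).
- exact: sub_sigma_measurable mUA.
Qed.

HB.instance Definition _ := isMeasure.Build _ _ _ sub_restr
  sub_restr0 sub_restr_ge0 sub_restr_sigma_additive.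

Let fin_sub_restr : fin_num_fun sub_restr.
Proof.
move=> U mU; rewrite /sub_restr /mrestr ge0_fin_numE ?measure_ge0//.
by rewrite (le_lt_trans (probability_le1 _ _)) ?ltry//; apply: measurableI => //;
  exact: sub_sigma_measurable.
Qed.

HB.instance Definition _ := @Measure_isFinite.Build _ _ _ sub_restr fin_sub_restr.

(** The density of [sub_restr] with respect to the restriction of [P], pulled back along [sub_id].
    It has to be replaced by its finite part, which agrees with it almost everywhere. *)
Lemma cond_prob_exists : exists f, is_cond_prob P <<s G >> B f.
Proof.
pose mu := distribution P sub_id.
have mu_dom : sub_restr `<< mu.
  apply/null_content_dominatesP => A mA muA0.
  have mA' : d.-measurable A by exact: sub_sigma_measurable.
  by apply: (subset_measure0 (measurableI _ _ mA' mB) mA' _ muA0); exact: subIsetl.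
have [f [f0 fi fE]] := radon_nikodym_finite mu_dom.
have mf : measurable_fun setT f by exact: measurable_int fi.
have mff : measurable_fun setT (fine \o f) by exact: measurableT_comp.
have fae : ae_eq mu setT f (EFin \o (fine \o f)).
  have := integrable_ae measurableT fi; apply: filterS => w h _.
  by rewrite /= fineK//; exact: h.
have int_abs : (\int[mu]_x `|(fine (f x))%:E| < +oo)%E.
  have [_] := integrableP _ _ _ fi; apply: le_lt_trans.
  rewrite le_eqVlt; apply/orP; left; apply/eqP; apply: ae_eq_integral => //.
  - by apply: measurableT_comp => //; exact/measurable_EFinP.
  - by apply: measurableT_comp.
  - by apply: filterS fae => w h _; rewrite /= h.
have iff : P.-integrable setT (EFin \o (fine \o f)).
  apply/integrableP; split.
    apply/measurable_EFinP.
    exact: (measurableT_comp mff measurable_sub_id).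
  move: int_abs; rewrite /mu /distribution ge0_integral_pushforward//.
  by apply: measurableT_comp => //; exact/measurable_EFinP.
exists (fine \o f); split => // [S mS|S gS].
  by have := mff measurableT S mS; rewrite setTI.
have mS : d.-measurable S by exact: sub_sigma_measurable.
transitivity (\int[mu]_(w in S) (fine (f w))%:E)%E.
  rewrite /mu /distribution integral_pushforward//.
  - exact/measurable_EFinP.
  - by apply: integrableS iff.
transitivity (\int[mu]_(w in S) f w)%E.
  apply: ae_eq_integral => //.
  - by apply: measurable_funTS => //; exact/measurable_EFinP.
  - exact: measurable_funTS.
  - by apply: filterS fae => w h _; rewrite h.
by rewrite -fE.
Qed.

Let f := cond_prob P <<s G >> B.

Lemma cond_probP : is_cond_prob P <<s G >> B f.
Proof. by have [f0 hf0] := cond_prob_exists; exact: (xgetPex _ cond_prob_exists). Qed.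

Lemma cond_prob_measurable : measurable_fun setT f.
Proof.
by have [mf _ _] := cond_probP => _ S mS; rewrite setTI; apply: sub_sigma_measurable; exact: mf.
Qed.

Lemma gt0_integral_le0_null (h : W -> R) (N : set W) : measurable N ->
  P.-integrable setT (EFin \o h) -> (forall w, N w -> 0 < h w) ->
  (\int[P]_(w in N) (h w)%:E <= 0)%E -> P N = 0%E.
Proof.
move=> mN ih h0 hN.
have : (\int[P]_(w in N) `|(h w)%:E| = 0)%E.
  apply/eqP; rewrite eq_le integral_ge0// andbT; apply: le_trans hN.
  by rewrite le_eqVlt; apply/orP; left; apply/eqP; apply: eq_integral => w;
    rewrite inE => Nw; rewrite gee0_abs// lee_fin ltW// h0.
move/ae_eq_integral_abs => /(_ mN); case.
  by apply: measurable_funTS; exact: measurable_int ih.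
move=> A [mA A0 hA]; apply/eqP; rewrite eq_le measure_ge0 andbT -A0.
apply: le_measure; rewrite ?inE// => w Nw; apply: hA => /(_ Nw)[] hw.
by have := h0 w Nw; rewrite hw ltxx.
Qed.

(** The sets where [f] is negative or exceeds 1 belong to the sub-sigma-field, so the defining
    identity may be tested on them; there it forces them to be null. *)
Lemma cond_prob_ae01 : {ae P, forall w, 0 <= f w <= 1}.
Proof.
have [mf fi fE] := cond_probP; have mfW := cond_prob_measurable.
have N0 : P (f @^-1` `]-oo, 0[) = 0%E.
  have gN : <<s G >> (f @^-1` `]-oo, 0[) by exact: mf.
  have mN := sub_sigma_measurable gN.
  apply: (gt0_integral_le0_null (h := \- f)) => //.
  - exact: (integrableN fi).
  - by move=> w /=; rewrite in_itv/= oppr_gt0.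
  - under eq_integral do rewrite EFinN.
    rewrite integralN; last exact: integrable_add_def (integrableS measurableT mN (@subsetT _ _) fi).
    by rewrite fE// oppe_le0 measure_ge0.
have N1 : P (f @^-1` `]1, +oo[) = 0%E.
  have gN : <<s G >> (f @^-1` `]1, +oo[) by exact: mf.
  have mN := sub_sigma_measurable gN.
  have i1 : P.-integrable setT (EFin \o cst (1:R)) by exact/bdm_integrable/bdm_cst.
  apply: (gt0_integral_le0_null (h := fun w => f w - 1)) => //.
  - exact: (integrableB measurableT fi i1).
  - by move=> w /=; rewrite in_itv/= andbT subr_gt0.
  - rewrite integralB_EFin//; [|exact: integrableS fi|exact: integrableS i1].
    rewrite fE// integral_cst// mul1e sube_le0.
    by apply: le_measure; rewrite ?inE//; exact: measurableI.
exists (f @^-1` `]-oo, 0[ `|` f @^-1` `]1, +oo[); split.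
- by apply: measurableU; apply: sub_sigma_measurable; exact: mf.
- apply/eqP; rewrite eq_le measure_ge0 andbT -(adde0 0%E) -{1}N0 -N1.
  by apply: measureU2; apply: sub_sigma_measurable; exact: mf.
- move=> w /=; rewrite !in_itv/= andbT => /negP; rewrite negb_and -!ltNge.
  by case/orP; [left|right].
Qed.

End conditional_probability.

(** * Essential suprema of families of random variables *)

Section essential_supremum.
Context {d} {W : measurableType d} {R : realType} (P : probability W R).
Variable F : set (W -> R).
Hypothesis F0 : F !=set0.
Hypothesis mF : forall f, F f -> measurable_fun setT f.
Hypothesis F_ge0 : forall f, F f -> forall w, 0 <= f w.
Hypothesis F_le1 : forall f, F f -> {ae P, forall w, f w <= 1}.

(** Members of [F] are at most 1 only almost everywhere. Truncating at 1 bounds the supremum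
    everywhere, hence makes it integrable. *)
Let S (u : nat -> W -> R) (w : W) : \bar R :=
  ereal_sup (range (fun n => (Num.min (u n w) 1)%:E)).

Let mS u : (forall n, F (u n)) -> measurable_fun setT (S u).
Proof.
move=> Fu; rewrite (_ : S u = fun w => esups (fun n => (Num.min (u n w) 1)%:E) 0%N).
  apply: measurable_fun_esups => n; apply/measurable_EFinP.
  by apply: measurable_minr => //; exact: mF.
apply/funext => w; congr ereal_sup; apply/seteqP; split => x /=.
  by move=> [n _ <-]; exists n.
by move=> [n _ <-]; exists n.
Qed.

Let S_ub u n w : ((Num.min (u n w) 1)%:E <= S u w)%E.
Proof. by apply: ereal_sup_ubound; exists n. Qed.

Let S_le1 u w : (S u w <= 1)%E.
Proof. by apply: ge_ereal_sup => _ [n _ <-]; rewrite lee_fin ge_min lexx orbT. Qed.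

Let S_ge0 u w : (forall n, F (u n)) -> (0 <= S u w)%E.
Proof.
move=> Fu; apply: le_trans (S_ub u 0%N w).
by rewrite lee_fin le_min ler01 (F_ge0 (Fu _)).
Qed.

Let IS u := (\int[P]_w S u w)%E.

Let IS_le1 u : (forall n, F (u n)) -> (IS u <= 1)%E.
Proof.
move=> Fu; apply: (@le_trans _ _ (\int[P]_w cst 1 w)%E).
  by apply: ge0_le_integral => //; [move=> w _; exact: S_ge0|exact: mS].
rewrite integral_cst//= probability_setT mule1; exact: lexx.
Qed.

Let IS_int u : (forall n, F (u n)) -> P.-integrable setT (S u).
Proof.
move=> Fu; apply/integrableP; split; first exact: mS.
under eq_integral do rewrite gee0_abs ?S_ge0//.
by rewrite (le_lt_trans (IS_le1 Fu)) ?ltry.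
Qed.

(** Exhaustion: among countable subfamilies, one attains the largest integral of the supremum.
    Adding a further [f] to it cannot raise the integral, so [f] lies below that supremum almost
    everywhere. *)
Lemma ess_supremum_exists : exists h, is_ess_supremum P F h.
Proof.
pose A := [set IS u | u in [set u | forall n, F (u n)]].
have [f0 Ff0] := F0.
have A0 : A (IS (fun=> f0)) by exists (fun=> f0).
have s_fin : ereal_sup A \is a fin_num.
  rewrite ge0_fin_numE; last first.
    apply: le_trans (ereal_sup_ubound A0); apply: integral_ge0 => w _.
    exact: S_ge0.
  apply: (@le_lt_trans _ _ 1%E); last exact: ltry.
  by apply: ge_ereal_sup => _ [u Fu <-]; exact: IS_le1.
have : forall k : nat, exists u, (forall n, F (u n)) /\
    (ereal_sup A - (k.+1%:R^-1 : R)%:E < IS u)%E.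
  move=> k; have k0 : 0 < (k.+1%:R^-1 : R) by rewrite invr_gt0.
  by have [_ [u Fu <-] hu] := ub_ereal_sup_adherent k0 s_fin; exists u.
move/choice => [v hv].
(* The sequences [v k], nearly optimal up to [1 / (k + 1)], are merged into one by coding pairs of
   integers. *)
pose U m := let p := odflt (0%N, 0%N) (unpickle m) in v p.1 p.2.
have FU m : F (U m) by exact: (hv _).1.
have SvU k w : (S (v k) w <= S U w)%E.
  apply: ge_ereal_sup => _ [n _ <-].
  by have := S_ub U (pickle (k, n)) w; rewrite /U pickleK.
have IU : IS U = ereal_sup A.
  apply/eqP; rewrite eq_le ereal_sup_ubound/=; last by exists U.
  apply/lee_addgt0Pr => e e0.
  have [k hk] : exists k : nat, k.+1%:R^-1 < e.
    by have [k _ /(_ k (leqnn k)) hk] := near_infty_natSinv_lt (PosNum e0); exists k.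
  rewrite -leeBlDr//; apply: (@le_trans _ _ (ereal_sup A - (k.+1%:R^-1 : R)%:E)%E).
    by rewrite leeB// lee_fin ltW.
  apply: ltW (lt_le_trans (hv k).2 _).
  by apply: ge0_le_integral => //; [move=> w _; apply: S_ge0; exact: (hv k).1
    |apply: mS; exact: (hv k).1|exact: mS].
exists (S U); split; [split; first exact: mS|].
(* [V] is [U] with [f] put in front; both suprema have the same finite integral. *)
- move=> f Ff; pose V m := if m is m'.+1 then U m' else f.
  have FV m : F (V m) by case: m => //=.
  have SUV w : (S U w <= S V w)%E.
    by apply: ge_ereal_sup => _ [n _ <-]; exact: (S_ub V n.+1).
  have IV : IS V = IS U.
    apply/eqP; rewrite eq_le {1}IU ereal_sup_ubound/=; last by exists V.
    by apply: ge0_le_integral => //; [move=> w _; exact: S_ge0|exact: mS|exact: mS].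
  have : ae_eq P setT (fun w => S V w - S U w)%E (cst 0%E).
    apply/ae_eq_integral_abs => //; first by apply: emeasurable_funB; exact: mS.
    have Ufin w : S U w \is a fin_num.
      by rewrite ge0_fin_numE ?S_ge0// (le_lt_trans (S_le1 U w)) ?ltry.
    under eq_integral do rewrite gee0_abs ?sube_ge0 ?SUV ?Ufin//.
    rewrite integralB//; [|exact: IS_int|exact: IS_int].
    rewrite [X in (X - _)%E]IV subee// IU; exact: s_fin.
  have := F_le1 Ff; apply: filterS2 => w f1 /(_ I) h.
  have Ufin : S U w \is a fin_num.
    by rewrite ge0_fin_numE ?S_ge0// (le_lt_trans (S_le1 U w)) ?ltry.
  have <- : S V w = S U w by rewrite -(subeK (S V w) Ufin) h add0e.
  by have := S_ub V 0%N w; rewrite /V min_l.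
(* Minimality: [S U] involves countably many functions, so their exceptional sets have a null
   union. *)
- move=> h' [mh' hh'].
  have /choice [N hN] n : exists N, [/\ measurable N, P N = 0%E &
     ~` [set w | ((U n w)%:E <= h' w)%E] `<=` N] by exact: (hh' _ (FU n)).
  exists (\bigcup_n N n); split.
  + by apply: bigcup_measurable => n _; have [] := hN n.
  + apply/negligibleP; first by apply: bigcup_measurable => n _; have [] := hN n.
    apply: negligible_bigcup => n; exists (N n); have [mNn N0 _] := hN n; split=> //.
  + move=> w /= Sw; apply: contrapT => nN; apply: Sw.
    apply: ge_ereal_sup => _ [n _ <-].
    have : ((U n w)%:E <= h' w)%E.
      by apply: contrapT => nh; apply: nN; exists n => //; have [_ _] := hN n; apply.
    by apply: le_trans; rewrite lee_fin ge_min lexx.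
Qed.

(** The upper bound matters because [fine] sends an infinite integral to 0. As the essential
    supremum lies in [[0, 1]] only almost everywhere, it is compared with a clamped copy [h1]. *)
Lemma le_integral_ess_supremum f : F f ->
  \int[P]_w f w <= fine (\int[P]_w ess_supremum P F w)%E <= 1.
Proof.
move=> Ff; set h := ess_supremum P F.
have [[mh hub] hmin] : is_ess_supremum P F h.
  by have [h0 hh0] := ess_supremum_exists; exact: (xgetPex _ ess_supremum_exists).
have h_le1 : {ae P, forall w, (h w <= 1)%E}.
  apply: (hmin (cst 1%E)); split; first exact: measurable_cst.
  by move=> f' /F_le1; apply: filterS => w; rewrite lee_fin.
pose h1 w := maxe 0%E (mine (h w) 1%E).
have mh1 : measurable_fun setT h1.
  by apply: measurable_maxe => //; apply: measurable_mine.
have h1E : (\int[P]_w h w = \int[P]_w h1 w)%E.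
  apply: ae_eq_integral => //.
  have := hub _ Ff; move: h_le1; apply: filterS2 => w hw fh _.
  rewrite /h1 min_l// max_r//; apply: le_trans fh.
  by rewrite lee_fin F_ge0.
have h1_ge0 w : (0 <= h1 w)%E by rewrite le_max lexx.
have h1_le1 w : (h1 w <= 1)%E by rewrite ge_max lee01 ge_min lexx orbT.
have I1 : (\int[P]_w h1 w <= 1)%E.
  apply: (@le_trans _ _ (\int[P]_w cst 1 w)%E); first exact: ge0_le_integral.
  by rewrite integral_cst//= probability_setT mule1.
have f1 : (\int[P]_w (f w)%:E <= \int[P]_w h1 w)%E.
  apply: ae_ge0_le_integral => //.
  - by move=> w _; rewrite lee_fin F_ge0.
  - by apply/measurable_EFinP; exact: mF.
  - have := hub _ Ff; move: (F_le1 Ff); apply: filterS2 => w hw fh _.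
    have {}hw : ((f w)%:E <= 1)%E by rewrite lee_fin.
    by rewrite /h1 le_max le_min fh hw orbT.
have I1fin : (\int[P]_w h1 w)%E \is a fin_num.
  by rewrite ge0_fin_numE ?integral_ge0// (le_lt_trans I1) ?ltry.
rewrite h1E /Rintegral -!lee_fin !fineK// ?I1 ?f1//.
rewrite ge0_fin_numE ?(le_lt_trans f1)// ?ltey_eq ?I1fin//.
by apply: integral_ge0 => w _; rewrite lee_fin F_ge0.
Qed.

End essential_supremum.

(** * From absolute regularity to covariances of events *)

Section alpha_beta.
Context {d} {W : measurableType d} {R : realType} (P : probability W R).
Variables (G : set (set W)) (hG : G `<=` measurable) (H : set (set W)).
Hypotheses (mH : H `<=` measurable).

Let F : set (W -> R) := [set (fun w : W => `|cond_prob P <<s G >> B w - fine (P B)|) | B in H].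

Let F_le1 f : F f -> {ae P, forall w, f w <= 1}.
Proof.
move=> [B HB <-]; have mB := mH HB.
have PB : 0 <= fine (P B) <= 1.
  by rewrite fine_ge0//= -lee_fin fineK ?probability_le1 ?fin_num_measure.
move: PB (cond_prob_ae01 P hG mB) => /andP[b0 b1]; apply: filterS => w /andP[a0 a1].
by rewrite ler_norml; lra.
Qed.

Let mF f : F f -> measurable_fun setT f.
Proof.
move=> [B HB <-]; apply: measurableT_comp => //; apply: measurable_funB => //.
exact: cond_prob_measurable hG _ (mH HB).
Qed.

Let F_ge0 f : F f -> forall w, 0 <= f w.
Proof. by move=> [B HB <-] w. Qed.

Lemma abs_regularity_le1 : H !=set0 -> 0 <= abs_regularity P <<s G >> H <= 1.
Proof.
move=> [B HB]; have FB : F (fun w : W => `|cond_prob P <<s G >> B w - fine (P B)|).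
  by exists B.
have F0 : F !=set0 by eexists; exact: FB.
have /andP[h0 ->] := le_integral_ess_supremum F0 mF F_ge0 F_le1 FB.
by rewrite andbT; apply: le_trans h0; apply: Rintegral_ge0.
Qed.

(** The covariance of the two events is the integral over [A] of the conditional minus the
    unconditional probability of [B]; its absolute value lies below the essential supremum. *)
Lemma alpha_le_abs_regularity A B : <<s G >> A -> H B ->
  `|fine (P (A `&` B)) - fine (P A) * fine (P B)| <= abs_regularity P <<s G >> H.
Proof.
move=> GA HB; have mB := mH HB; have mA := sub_sigma_measurable hG GA.
have [mf fi fE] := cond_probP P hG mB.
have FB : F (fun w : W => `|cond_prob P <<s G >> B w - fine (P B)|) by exists B.
have F0 : F !=set0 by eexists; exact: FB.
have /andP[h0 _] := le_integral_ess_supremum F0 mF F_ge0 F_le1 FB.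
apply: le_trans h0.
have ic : P.-integrable setT (EFin \o cst (fine (P B))) by exact/bdm_integrable/bdm_cst.
have iB : P.-integrable setT (EFin \o (fun w => cond_prob P <<s G >> B w - fine (P B))).
  exact: (integrableB measurableT fi ic).
have -> : fine (P (A `&` B)) - fine (P A) * fine (P B) =
    \int[P]_(w in A) (cond_prob P <<s G >> B w - fine (P B)).
  rewrite RintegralB//; [|exact: integrableS fi|exact: integrableS ic].
  by rewrite Rintegral_cst// [X in _ = X - _]/Rintegral fE// mulrC.
apply: le_trans (le_normr_Rintegral mA _) _; first exact: integrableS iB.
rewrite Rintegral_mkcond; apply: le_Rintegral => //.
- rewrite -restrict_EFin; apply/integrable_restrict => //.
  by rewrite setTI; apply: integrableS (integrable_norm iB).
- exact: integrable_norm iB.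
- by move=> w _; rewrite patchE; case: ifP => // _; exact: normr_ge0.
Qed.

End alpha_beta.

(** * Characteristic functions of nearly independent sums *)

Section taylor.
Context {R : realType}.

(** Each Taylor bound below follows from the previous one through this mean value estimate, which is
    why the constants are 1/2 rather than inverse factorials. *)
Lemma mvt0 (f df : R -> R) (y D : R) : (forall x : R, is_derive x 1 f (df x)) ->
  f 0 = 0 -> (forall c, `|c| <= `|y| -> `|df c| <= D) -> `|f y| <= D * `|y|.
Proof.
move=> fd f0 hD.
have cf a b : {within `[a, b], continuous f}.
  by apply: derivable_within_continuous => x _; have [] := fd x.
have [y0|y0] := leP 0 y.
  have [c] := MVT_segment y0 (fun x _ => fd x) (cf _ _).
  rewrite in_itv/= f0 !subr0 => /andP[c0 cy] ->.
  by rewrite normrM ler_wpM2r// hD// !ger0_norm.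
have [c] := MVT_segment (ltW y0) (fun x _ => fd x) (cf _ _).
rewrite in_itv/= f0 !sub0r => /andP[c0 cy] fy.
rewrite -normrN fy normrM normrN ler_wpM2r// hD//.
by rewrite !ler0_norm ?lerN2// ltW.
Qed.

Lemma norm_sin_le (y : R) : `|sin y| <= `|y|.
Proof.
rewrite -[leRHS]mul1r; apply: (@mvt0 sin cos) => [|c _]; first exact: sin0.
by rewrite ler_norml cos_geN1 cos_le1.
Qed.

Lemma one_sub_cosE (y : R) : 1 - cos y = 2 * sin (y / 2) ^+ 2.
Proof.
by rewrite [in cos y](_ : y = (y / 2) *+ 2) ?cos_mulr2n ?cos2sin2; [ring|field].
Qed.

Lemma one_sub_cos_bound (y : R) : 0 <= 1 - cos y <= y ^+ 2 / 2.
Proof.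
rewrite one_sub_cosE mulr_ge0 ?sqr_ge0//=.
have : sin (y / 2) ^+ 2 <= (y / 2) ^+ 2.
  rewrite -[leLHS]real_normK ?num_real// -[leRHS]real_normK ?num_real//.
  by rewrite lerXn2r ?nnegrE// norm_sin_le.
by rewrite expr_div_n; lra.
Qed.

Lemma norm_sin_sub (y : R) : `|sin y - y| <= `|y| ^+ 3 / 2.
Proof.
have -> : `|y| ^+ 3 / 2 = (y ^+ 2 / 2) * `|y|.
  by rewrite exprSr real_normK ?num_real//; ring.
apply: (@mvt0 (fun x => sin x - x) (fun x => cos x - 1)) => [|c cy].
- by rewrite sin0 subrr.
- rewrite distrC ger0_norm; last by have /andP[] := one_sub_cos_bound c.
  have /andP[_ h] := one_sub_cos_bound c; apply: le_trans h _.
  rewrite ler_pM2r ?invr_gt0// -(real_normK (num_real c)) -(real_normK (num_real y)).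
  by rewrite lerXn2r ?nnegrE.
Qed.

Lemma norm_cos_sub (y : R) : `|cos y - 1 + y ^+ 2 / 2| <= `|y| ^+ 4 / 2.
Proof.
have -> : `|y| ^+ 4 / 2 = (`|y| ^+ 3 / 2) * `|y| by rewrite [in LHS]exprSr; ring.
apply: (@mvt0 (fun x => cos x - 1 + x ^+ 2 / 2) (fun x => - sin x + x)) => [x||c cy].
- by apply: is_derive_eq; rewrite /GRing.scale/=; field.
- by rewrite cos0 subrr expr0n mul0r addr0.
- rewrite addrC distrC; apply: le_trans (norm_sin_sub c) _.
  by rewrite ler_pM2r ?invr_gt0// lerXn2r ?nnegrE.
Qed.

(** For the upper bound, [(1 - u + u^2) (1 + u) = 1 + u^3 >= 1] and [1 + u <= exp u]. *)
Lemma expRN_bound (u : R) : 0 <= u -> 0 <= expR (- u) - (1 - u) <= u ^+ 2.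
Proof.
move=> u0; have := expR_ge1Dx (- u); have := expR_ge1Dx u => h1 h2.
rewrite subr_ge0 h2/=.
have e0 := expR_gt0 u.
have : expR (- u) <= 1 - u + u ^+ 2.
  rewrite expRN -[leLHS]mul1r ler_pdivrMr//.
  apply: (@le_trans _ _ ((1 - u + u ^+ 2) * (1 + u))).
    rewrite -subr_ge0 (_ : _ - _ = u ^+ 3); last by ring.
    exact: exprn_ge0.
  by rewrite ler_wpM2l//; nra.
lra.
Qed.

End taylor.

Section layers.
Context {R : realType}.

(** Layer-cake form of rounding down: an average of indicators of level sets. It reduces statements
    on functions with values in [[0, 1]] to events, both for covariances and for Loeb integrals. *)
Definition layer (N : nat) (h : R) : R :=
  (\sum_(j < N.+1) (j.+1%:R / N.+1%:R <= h)%R%:R) / N.+1%:R.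

Lemma layer_bound N h : 0 <= h <= 1 -> 0 <= h - layer N h <= N.+1%:R^-1.
Proof.
move=> /andP[h0 h1]; have N0 : 0 < (N.+1%:R : R) by rewrite ltr0n.
pose y := h * N.+1%:R.
have y0 : 0 <= y by rewrite mulr_ge0// ltW.
have tL : (Num.trunc y <= N.+1)%N.
  rewrite -(ler_nat R); apply: (@le_trans _ _ y); first by rewrite truncn_le.
  by rewrite -[leRHS]mul1r ler_pM2r.
rewrite /layer; have -> : \sum_(j < N.+1) (j.+1%:R / N.+1%:R <= h)%R%:R = (Num.trunc y)%:R :> R.
  rewrite -natr_sum; congr _%:R.
  have E (j : 'I_(N.+1)) : (j.+1%:R / N.+1%:R <= h) = (j < Num.trunc y)%N.
    by rewrite truncn_gt_nat /y ler_pdivrMr.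
  under eq_bigr => j _ do rewrite E.
  by rewrite -big_mkcond/= -(big_ord_widen _ (fun=> 1%N) tL) sum1_card card_ord.
have /andP[t1 t2] := truncn_itv y0.
rewrite -[h in _ <= h - _](mulfK (lt0r_neq0 N0)) -[h in h - _ <= _](mulfK (lt0r_neq0 N0)) -/y.
rewrite -mulrBl divr_ge0 ?subr_ge0 ?(ltW N0)//=.
by rewrite ler_pdivrMr// mulVf ?gt_eqF// lerBlDl natr1 ltW.
Qed.

Lemma layer_ge0_le1 N h : 0 <= h <= 1 -> 0 <= layer N h <= 1.
Proof.
move=> hh; have /andP[a b] := layer_bound N hh.
apply/andP; split; last by lra.
by rewrite divr_ge0// sumr_ge0.
Qed.

Lemma cvg_layer h : 0 <= h <= 1 -> layer N h @[N --> \oo] --> h.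
Proof.
move=> hh; apply/cvgrPdist_le => e e0; near=> N.
have /andP[a b] := layer_bound N hh.
rewrite ger0_norm//; apply: le_trans b _; apply: ltW.
near: N; exact: (near_infty_natSinv_lt (PosNum e0)).
Unshelve. all: by end_near. Qed.

End layers.

Section alpha_mixing.
Context {d} {W : measurableType d} {R : realType} (P : probability W R).
Notation E f := (\int[P]_w f w).
Variables (A B : set (set W)) (al : R).
Hypotheses (mA : A `<=` measurable) (mB : B `<=` measurable).
Hypothesis hal : forall a b, A a -> B b ->
  `|fine (P (a `&` b)) - fine (P a) * fine (P b)| <= al.

Definition adapted (C : set (set W)) (f : W -> R) :=
  forall S : set R, measurable S -> C (f @^-1` S).

Lemma adapted_measurable C f : C `<=` measurable -> adapted C f -> measurable_fun setT f.
Proof. by move=> mC aC _ S mS; rewrite setTI; apply: mC; exact: aC. Qed.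

(** The covariance of two layer averages is the average of [(N + 1)^2] covariances of events, each
    at most [al]; hence the bound for events carries over without loss. *)
Lemma alpha_cov01 f h : adapted A f -> adapted B h ->
  (forall w, 0 <= f w <= 1) -> (forall w, 0 <= h w <= 1) ->
  `|E (fun w => f w * h w) - E f * E h| <= al.
Proof.
move=> af bh f01 h01.
have mf := adapted_measurable mA af; have mh := adapted_measurable mB bh.
pose If (j N : nat) := f @^-1` `[(j.+1%:R / N.+1%:R : R), +oo[.
pose Ih (j N : nat) := h @^-1` `[(j.+1%:R / N.+1%:R : R), +oo[.
have aIf j N : A (If j N) by exact: af.
have bIh j N : B (Ih j N) by exact: bh.
have layerE (k : W -> R) N w : layer N (k w) =
    (\sum_(j < N.+1) \1_(k @^-1` `[(j.+1%:R / N.+1%:R : R), +oo[) w) / N.+1%:R.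
  rewrite /layer; congr (_ / _); apply: eq_bigr => j _; rewrite indicE.
  congr (nat_of_bool _)%:R; apply/idP/idP; rewrite inE/= in_itv/= andbT//.
have bI (C : set (set W)) c : C `<=` measurable -> C c -> bdm (\1_c : W -> R).
  move=> mC /mC mc; apply: (@bdm_le _ _ _ _ 1); first exact: measurable_indic.
  by move=> w; rewrite indicE norm_natb_le1.
have bLf N : bdm (fun w => layer N (f w)).
  under eq_fun do rewrite layerE.
  apply: bdmM (bdm_cst _); apply: bdm_sum => j _; exact: bI mA (aIf j N).
have bLh N : bdm (fun w => layer N (h w)).
  under eq_fun do rewrite layerE.
  apply: bdmM (bdm_cst _); apply: bdm_sum => j _; exact: bI mB (bIh j N).
have n01 (u : R) : 0 <= u <= 1 -> `|u| <= 1 by move=> /andP[u0 u1]; rewrite ger0_norm.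
have cf : E (fun w => layer N (f w)) @[N --> \oo] --> E f.
  apply: (cvg_E (M := 1)) => [N|N w|w]; first exact: (bLf N).1.
  - exact/n01/layer_ge0_le1.
  - exact: cvg_layer.
have ch : E (fun w => layer N (h w)) @[N --> \oo] --> E h.
  apply: (cvg_E (M := 1)) => [N|N w|w]; first exact: (bLh N).1.
  - exact/n01/layer_ge0_le1.
  - exact: cvg_layer.
have cfh : E (fun w => layer N (f w) * layer N (h w)) @[N --> \oo] --> E (fun w => f w * h w).
  apply: (cvg_E (M := 1)) => [N|N w|w]; first exact: (bdmM (bLf N) (bLh N)).1.
  - by rewrite normrM -[leRHS]mul1r ler_pM//; exact/n01/layer_ge0_le1.
  - by apply: cvgM; exact: cvg_layer.
apply: cvg_ub (cvg_norm (cvgB cfh (cvgM cf ch))) _.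
apply: nearW => N.
have N0 : 0 < (N.+1%:R : R) by rewrite ltr0n.
have EL (k : W -> R) C : C `<=` measurable -> (forall j, C (k @^-1` `[(j.+1%:R / N.+1%:R : R), +oo[)) ->
    E (fun w => layer N (k w)) =
    N.+1%:R^-1 * \sum_(j < N.+1) fine (P (k @^-1` `[(j.+1%:R / N.+1%:R : R), +oo[)).
  move=> mC Ck; under eq_Rintegral do rewrite layerE mulrC.
  rewrite EZ; last by apply: bdm_sum => j _; exact: bI mC _.
  rewrite E_sum; last by move=> j _; exact: bI mC _.
  by congr (_ * _); apply: eq_bigr => j _; rewrite E_indic//; exact: mC.
rewrite -[X in `|X| <= _]/(\int[P]_w (layer N (f w) * layer N (h w)) -
  (\int[P]_w layer N (f w)) * (\int[P]_w layer N (h w))).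
rewrite (EL f A mA (fun j => aIf j N)) (EL h B mB (fun j => bIh j N)).
have bIJ (i j : nat) : bdm (\1_(If i N `&` Ih j N) : W -> R).
  by apply: (bI measurable) => //; apply: measurableI; [exact: mA|exact: mB].
have -> : E (fun w => layer N (f w) * layer N (h w)) = N.+1%:R^-1 * N.+1%:R^-1 *
   \sum_(i < N.+1) \sum_(j < N.+1) fine (P (If i N `&` Ih j N)).
  transitivity (E (fun w => (N.+1%:R^-1 * N.+1%:R^-1) *
      \sum_(i < N.+1) \sum_(j < N.+1) \1_(If i N `&` Ih j N) w)).
    apply: eq_Rintegral => w _; rewrite !layerE mulrACA mulrC big_distrlr/=.
    by congr (_ * _); apply: eq_bigr => i _; apply: eq_bigr => j _; rewrite indicI.
  rewrite EZ; last by apply: bdm_sum => i _; exact: bdm_sum.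
  rewrite E_sum; last by move=> i _; exact: bdm_sum.
  congr (_ * _); apply: eq_bigr => i _; rewrite E_sum//.
  apply: eq_bigr => j _; rewrite E_indic//.
  by apply: measurableI; [exact: mA|exact: mB].
rewrite [X in _ - X]mulrACA big_distrlr/= -mulrBr -sumrB.
rewrite normrM ger0_norm; last by rewrite mulr_ge0 ?invr_ge0// ltW.
rewrite -[leRHS](mulKf (lt0r_neq0 N0)) -[in leRHS](mulKf (lt0r_neq0 N0) (_ * _)) mulrA.
rewrite ler_wpM2l ?mulr_ge0 ?invr_ge0//.
apply: le_trans (ler_norm_sum _ _ _) _.
apply: (@le_trans _ _ (\sum_(i < N.+1) \sum_(j < N.+1) al)).
  apply: ler_sum => i _; rewrite -sumrB; apply: le_trans (ler_norm_sum _ _ _) _.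
  by apply: ler_sum => j _; apply: hal.
by rewrite !sumr_const card_ord -!mulrnA -(mulr_natl al) natrM mulrA.
Qed.

(** The map [u -> (1 + u) / 2] brings both functions into [[0, 1]] and divides their covariance by
    4. *)
Lemma alpha_cov f h : adapted A f -> adapted B h ->
  (forall w, `|f w| <= 1) -> (forall w, `|h w| <= 1) ->
  `|E (fun w => f w * h w) - E f * E h| <= 4 * al.
Proof.
move=> af bh f1 h1.
have mf := adapted_measurable mA af; have mh := adapted_measurable mB bh.
have bf := bdm_le mf f1; have bh' := bdm_le mh h1.
pose k (u : R) := (1 + u) / 2.
have mk : measurable_fun setT k by apply: measurable_funM => //; exact: measurable_funD.
have ad (C : set (set W)) q : adapted C q -> adapted C (k \o q).
  by move=> aq S mS; apply: (aq (k @^-1` S)); rewrite -[X in measurable X]setTI; exact: mk.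
have k01 u : `|u| <= 1 -> 0 <= k u <= 1 by rewrite ler_norml /k; lra.
have := alpha_cov01 (ad _ _ af) (ad _ _ bh) (fun w => k01 _ (f1 w)) (fun w => k01 _ (h1 w)).
have Ek q : bdm q -> E (k \o q) = (1 + E q) / 2.
  move=> bq; transitivity (E (fun w => 2^-1 * (1 + q w))).
    by apply: eq_Rintegral => w _; rewrite /k/= mulrC.
  by rewrite EZ ?ED ?E_cst ?(mulrC 2^-1)//; do ?apply: bdmD; do ?exact: bdm_cst.
rewrite (Ek f)// (Ek h)//.
have -> : E (fun w => (k \o f) w * (k \o h) w) = (1 + E f + E h + E (fun w => f w * h w)) / 4.
  transitivity (E (fun w => 4^-1 * (1 + f w + h w + f w * h w))).
    by apply: eq_Rintegral => w _; rewrite /k/=; field.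
  have b1 := bdmD (bdm_cst 1) bf; have b2 := bdmD b1 bh'; have b3 := bdmM bf bh'.
  by rewrite EZ; [rewrite !ED// ?E_cst ?(mulrC 4^-1)//; exact: bdm_cst|exact: bdmD].
set x := E f; set y := E h; set z := E (fun w => f w * h w).
rewrite (_ : _ - _ = (z - x * y) / 4); last by field.
by rewrite normrM (@ger0_norm _ (4^-1))// ler_pdivrMr// [al * 4]mulrC.
Qed.

End alpha_mixing.

Section chf_recursion.
Context {d} {W : measurableType d} {R : realType} (P : probability W R).
Notation E f := (\int[P]_w f w).
Variables (m : nat) (xi : nat -> W -> R) (B al ga x : R).
Let S i w := \sum_(j < i) xi j w.
Hypothesis mxi : forall i, measurable_fun setT (xi i).
Let mS i : measurable_fun setT (S i).
Proof. exact: measurable_sum. Qed.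

Let near_indep (p q : R -> R) := forall i, (i < m)%N ->
  `|E (fun w => p (S i w) * q (xi i w)) - E (fun w => p (S i w)) * E (fun w => q (xi i w))| <= B.

Hypothesis cc : near_indep cos cos.
Hypothesis cs : near_indep cos sin.
Hypothesis sc : near_indep sin cos.
Hypothesis ss : near_indep sin sin.
Hypothesis Ecos : forall i, (i < m)%N -> E (fun w => cos (xi i w)) = al.
Hypothesis Esin : forall i, (i < m)%N -> E (fun w => sin (xi i w)) = ga.
Hypothesis x01 : 0 <= x <= 1.

(** In complex terms each step multiplies the characteristic function by [al + i ga], here replaced
    by the real number [x]. A new error stems from two of the four covariances, from [al - x] and
    from [ga]. Old errors are not amplified since [0 <= x <= 1], so the errors just add up over [m]
    steps. *)
Lemma chf_recursion : let e := m%:R * (2 * B + `|al - x| + `|ga|) in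
  `|E (fun w => cos (S m w)) - x ^+ m| <= e /\ `|E (fun w => sin (S m w))| <= e.
Proof.
pose e i : R := i%:R * (2 * B + `|al - x| + `|ga|).
suff H i : (i <= m)%N -> `|E (fun w => cos (S i w)) - x ^+ i| <= e i /\
    `|E (fun w => sin (S i w))| <= e i by exact: H.
elim: i => [_|i IH im].
  rewrite /e mul0r; under eq_Rintegral do rewrite /S big_ord0 cos0.
  rewrite E_cst expr0 subrr normr0; split=> //.
  by under eq_Rintegral do rewrite /S big_ord0 sin0; rewrite E_cst normr0.
have [IHc IHs] := IH (ltnW im).
have bc j : bdm (fun w => cos (S j w)) by exact: bdm_cos.
have bs j : bdm (fun w => sin (S j w)) by exact: bdm_sin.
have bcx j : bdm (fun w => cos (xi j w)) by exact: bdm_cos.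
have bsx j : bdm (fun w => sin (xi j w)) by exact: bdm_sin.
have SE w : S i.+1 w = S i w + xi i w by rewrite /S big_ord_recr.
have -> : E (fun w => cos (S i.+1 w)) =
    E (fun w => cos (S i w) * cos (xi i w)) - E (fun w => sin (S i w) * sin (xi i w)).
  by rewrite -EB; [apply: eq_Rintegral => w _; rewrite SE cosD|exact: bdmM|exact: bdmM].
have -> : E (fun w => sin (S i.+1 w)) =
    E (fun w => sin (S i w) * cos (xi i w)) + E (fun w => cos (S i w) * sin (xi i w)).
  by rewrite -ED; [apply: eq_Rintegral => w _; rewrite SE sinD|exact: bdmM|exact: bdmM].
have := cc im; have := cs im; have := sc im; have := ss im.
rewrite (Ecos im) (Esin im).
have c1 : `|E (fun w => cos (S i w))| <= 1.
  by apply: norm_E_cst => // w; exact: norm_cos_le1.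
have s1 : `|E (fun w => sin (S i w))| <= 1.
  by apply: norm_E_cst => // w; exact: norm_sin_le1.
move: c1 s1 IHc IHs.
set c := E (fun w => cos (S i w)); set s := E (fun w => sin (S i w)).
set ssi := E (fun w => sin (S i w) * sin (xi i w)); set sci := E (fun w => sin (S i w) * cos (xi i w)).
set csi := E (fun w => cos (S i w) * sin (xi i w)); set cci := E (fun w => cos (S i w) * cos (xi i w)).
move=> c1 s1 IHc IHs hss hsc hcs hcc.
have eS : e i.+1 = e i + (2 * B + `|al - x| + `|ga|) by rewrite /e -natr1 mulrDl mul1r.
have /andP[x0 x1] := x01.
have small (u v : R) : `|u| <= 1 -> `|u * v| <= `|v|.
  by move=> u1; rewrite normrM ler_piMl.
have xe (u : R) : `|u| <= e i -> `|x * u| <= e i.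
  by move=> ue; rewrite normrM (ger0_norm x0); apply: le_trans ue; rewrite ler_piMl.
split; rewrite eS.
- rewrite (_ : _ - _ = x * (c - x ^+ i) + ((cci - c * al) - (ssi - s * ga)) +
    c * (al - x) - s * ga); last by rewrite exprS; ring.
  have h1 := xe _ IHc; have h2 := small _ (al - x) c1; have h3 := small _ ga s1.
  have h4 := ler_normB (cci - c * al) (ssi - s * ga).
  apply: le_trans (ler_normB _ _) _; apply: le_trans (lerD (ler_normD _ _) (lexx _)) _.
  apply: le_trans (lerD (lerD (ler_normD _ _) (lexx _)) (lexx _)) _.
  by lra.
- rewrite (_ : sci + csi = x * s + ((sci - s * al) + (csi - c * ga)) +
    s * (al - x) + c * ga); last by ring.
  have h1 := xe _ IHs; have h2 := small _ (al - x) s1; have h3 := small _ ga c1.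
  have h4 := ler_normD (sci - s * al) (csi - c * ga).
  apply: le_trans (ler_normD _ _) _; apply: le_trans (lerD (ler_normD _ _) (lexx _)) _.
  apply: le_trans (lerD (lerD (ler_normD _ _) (lexx _)) (lexx _)) _.
  by lra.
Qed.

End chf_recursion.

Section chf_limit.
Context {d} {W : measurableType d} {R : realType} (P : probability W R).
Notation E f := (\int[P]_w f w).

(** Taylor gives [1 - v / 2] for the cosine with error [K^2 v / 2], where [v] is the second moment;
    mean 0 removes the linear term of the sine. Passing to [exp (- v / 2)] costs
    [v^2 / 4 <= K^2 v / 4] and pays off because its powers are again exponentials. *)
Lemma chf_small (xi : W -> R) (K : R) : measurable_fun setT xi ->
  (forall w, `|xi w| <= K) -> E xi = 0 ->
  `|E (fun w => cos (xi w)) - expR (- (E (fun w => xi w ^+ 2) / 2))| <=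
    K ^+ 2 * E (fun w => xi w ^+ 2) /\
  `|E (fun w => sin (xi w))| <= K * E (fun w => xi w ^+ 2).
Proof.
move=> mxi hK Exi; have bxi := bdm_le mxi hK.
set v := E (fun w => xi w ^+ 2).
have bx2 := bdmX 2 bxi.
have v0 : 0 <= v by apply: E_ge0 => w; exact: sqr_ge0.
have vK : v <= K ^+ 2.
  rewrite -(E_cst P (K ^+ 2)); apply: le_E => //; first exact: bdm_cst.
  move=> w; rewrite -(real_normK (num_real (xi w))) lerXn2r ?nnegrE//.
  exact: le_trans (hK w).
have bc := bdm_cos mxi; have bs := bdm_sin mxi.
split.
- have h1 : `|E (fun w => cos (xi w)) - (1 - v / 2)| <= K ^+ 2 / 2 * v.
    have -> : E (fun w => cos (xi w)) - (1 - v / 2) =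
        E (fun w => cos (xi w) - 1 + xi w ^+ 2 / 2).
      rewrite ED; [|exact: bdmB bc (bdm_cst 1)|exact: bdmM bx2 (bdm_cst _)].
      rewrite EB//; last exact: bdm_cst.
      under [X in _ = _ + X]eq_Rintegral do rewrite mulrC.
      by rewrite EZ// E_cst -/v; ring.
    rewrite -EZ//; apply: norm_E_le; [|exact: bdmZ|].
      exact: bdmD (bdmB bc (bdm_cst 1)) (bdmM bx2 (bdm_cst _)).
    move=> w; apply: le_trans (norm_cos_sub (xi w)) _.
    have : `|xi w| ^+ 4 <= K ^+ 2 * xi w ^+ 2.
      rewrite [leLHS](exprD _ 2 2) real_normK ?num_real// ler_wpM2r ?sqr_ge0//.
      rewrite -(real_normK (num_real (xi w))) lerXn2r ?nnegrE//.
      exact: le_trans (hK w).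
    by lra.
  have /andP[h2 h3] := @expRN_bound R (v / 2) (divr_ge0 v0 (ler0n _ 2)).
  rewrite (_ : _ - _ = (E (fun w => cos (xi w)) - (1 - v / 2)) -
    (expR (- (v / 2)) - (1 - v / 2))); last by ring.
  apply: le_trans (ler_normB _ _) _; rewrite [X in _ + X]ger0_norm//.
  by move: h1 h3; rewrite expr_div_n; nra.
- have -> : E (fun w => sin (xi w)) = E (fun w => sin (xi w) - xi w).
    by rewrite EB// Exi subr0.
  rewrite -EZ//; apply: norm_E_le; [exact: bdmB|exact: bdmZ|move=> w].
  apply: le_trans (norm_sin_sub (xi w)) _.
  rewrite -(real_normK (num_real (xi w))) [leLHS]mulrC exprS mulrA.
  rewrite ler_wpM2r ?sqr_ge0//; apply: le_trans (hK w); rewrite ler_piMl//.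
  by rewrite invf_le1// ler1n.
Qed.

Variables (m : nat -> nat) (xi : nat -> nat -> W -> R) (B K v : nat -> R) (si : R).
Let S n w := \sum_(j < m n) xi n j w.
Hypothesis mxi : forall n i, measurable_fun setT (xi n i).
Hypothesis hK : forall n i w, `|xi n i w| <= K n.
Hypothesis mB0 : (m n)%:R * B n @[n --> \oo] --> (0 : R).
Hypothesis K0 : K n @[n --> \oo] --> (0 : R).
Hypothesis vsi : (m n)%:R * v n @[n --> \oo] --> si.

Let indep n (p q : R -> R) := forall i, (i < m n)%N ->
  `|E (fun w => p (\sum_(j < i) xi n j w) * q (xi n i w)) -
    E (fun w => p (\sum_(j < i) xi n j w)) * E (fun w => q (xi n i w))| <= B n.

Hypothesis near_indep : \forall n \near \oo,
  [/\ indep n cos cos, indep n cos sin, indep n sin cos & indep n sin sin].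
Hypothesis ident : \forall n \near \oo, forall i, (i < m n)%N ->
  [/\ E (xi n i) = 0, E (fun w => xi n i w ^+ 2) = v n,
      E (fun w => cos (xi n i w)) = E (fun w => cos (xi n 0%N w)) &
      E (fun w => sin (xi n i w)) = E (fun w => sin (xi n 0%N w))].

Lemma chf_limit : E (fun w => cos (S n w)) @[n --> \oo] --> expR (- (si / 2)) /\
  E (fun w => sin (S n w)) @[n --> \oo] --> (0 : R).
Proof.
(* As [m n * v n] converges and [K n] tends to 0, the accumulated one-step errors vanish: uniform
   smallness replaces a Lindeberg condition. *)
pose e n := 2 * ((m n)%:R * B n) + ((m n)%:R * v n) * (K n ^+ 2 + K n).
have e0 : e n @[n --> \oo] --> (0 : R).
  rewrite (_ : 0 = 2 * 0 + si * (0 ^+ 2 + 0)); last by rewrite expr0n/= addr0 !mulr0 addr0.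
  apply: cvgD; first exact: cvgMr.
  apply: cvgM => //; apply: cvgD => //.
  by under eq_fun do rewrite expr2; rewrite expr2; apply: cvgM.
have main : \forall n \near \oo,
    `|E (fun w => cos (S n w)) - expR (- ((m n)%:R * v n / 2))| <= e n /\
    `|E (fun w => sin (S n w))| <= e n.
  near=> n.
  have [cc cs sc ss] : [/\ indep n cos cos, indep n cos sin, indep n sin cos & indep n sin sin].
    by near: n.
  have id_n : forall i, (i < m n)%N ->
  [/\ E (xi n i) = 0, E (fun w => xi n i w ^+ 2) = v n,
      E (fun w => cos (xi n i w)) = E (fun w => cos (xi n 0%N w)) &
      E (fun w => sin (xi n i w)) = E (fun w => sin (xi n 0%N w))] by near: n.
  have [m0|m0] := posnP (m n).
    have S0 w : S n w = 0 by rewrite /S m0 big_ord0.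
    rewrite /e m0 !mul0r mulr0 addr0 oppr0 expR0.
    under eq_Rintegral do rewrite S0 cos0; rewrite E_cst subrr normr0; split=> //.
    by under eq_Rintegral do rewrite S0 sin0; rewrite E_cst normr0.
  have [Exi Exi2 _ _] := id_n _ m0.
  have [h1 h2] := chf_small (mxi n 0%N) (hK n 0%N) Exi.
  rewrite Exi2 in h1 h2.
  have v0 : 0 <= v n by rewrite -Exi2; apply: E_ge0 => w; exact: sqr_ge0.
  have x01 : 0 <= expR (- (v n / 2)) <= 1.
    by rewrite expR_ge0/= expR_le1 oppr_le0 divr_ge0.
  have [r1 r2] := chf_recursion (mxi n) cc cs sc ss (fun i im => let: And4 _ _ a _ := id_n i im in a)
    (fun i im => let: And4 _ _ _ a := id_n i im in a) x01.
  have le_e : (m n)%:R * (2 * B n + `|E (fun w => cos (xi n 0%N w)) - expR (- (v n / 2))| +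
      `|E (fun w => sin (xi n 0%N w))|) <= e n.
    rewrite /e mulrCA -mulrA -mulrDr ler_wpM2l//.
    rewrite -addrA lerD2l; apply: le_trans (lerD h1 h2) _.
    by rewrite -mulrDl mulrC.
  split; last exact: le_trans r2 le_e.
  apply: le_trans le_e; move: r1; rewrite -expRM_natl.
  by rewrite (_ : (m n)%:R * - (v n / 2) = - ((m n)%:R * v n / 2))//; ring.
split.
- have ce : expR (- ((m n)%:R * v n / 2)) @[n --> \oo] --> expR (- (si / 2)).
    apply: continuous_cvg; first exact: continuous_expR.
    by apply: cvgN; apply: cvgMl.
  rewrite -[X in _ --> X]add0r.
  rewrite (_ : (fun n => _) = (fun n => (E (fun w => cos (S n w)) - expR (- ((m n)%:R * v n / 2)))
     + expR (- ((m n)%:R * v n / 2)))); last by apply/funext => n; rewrite subrK.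
  apply: cvgD => //; apply/norm_cvg0P.
  apply: (squeeze_cvgr _ (@cvg_cst _ (0 : R) _ _ _) e0).
  by near=> n; rewrite normr_ge0/=; have [] : _ /\ _ := near main n _.
- apply/norm_cvg0P; apply: (squeeze_cvgr _ (@cvg_cst _ (0 : R) _ _ _) e0).
  by near=> n; rewrite normr_ge0/=; have [] : _ /\ _ := near main n _.
Unshelve. all: by end_near. Qed.

End chf_limit.

(** * Loeb spaces *)

Section ultralimit.
Context {R : realType}.
Variables (U : set_system nat) (UU : UltraFilter U).

Lemma ultra_absurd (S : set nat) : U S -> U (~` S) -> False.
Proof. by move=> h /(filterI h); rewrite setICr => /filter_ex[]. Qed.

Definition ulim (u : nat -> R) : R := lim (u n @[n --> U]).

Lemma fmap_ultra (T : Type) (u : nat -> T) : UltraFilter (u @ U).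
Proof.
split=> [|G PG sG]; first exact: fmap_proper_filter.
apply/seteqP; split=> // X GX.
have [//|UC] := in_ultra_setVsetC (u @^-1` X) UU.
have : G (X `&` ~` X) by apply: filterI => //; apply: sG.
by rewrite setICr => /filter_ex[].
Qed.

Lemma cvg_ulim (u : nat -> R) (M : R) : U [set n | `|u n| <= M] ->
  u n @[n --> U] --> ulim u.
Proof.
move=> uM; have := @segment_compact R (- M) M; rewrite compact_ultra => cpt.
have [] := cpt _ (fmap_ultra u).
  apply: (@filterS _ U _ _ _ _ uM) => n /= h.
  by rewrite in_itv/= -ler_norml; exact: h.
move=> l [_ ul]; rewrite /ulim; apply: (cvgP l); exact: ul.
Qed.

Lemma ulimE (u : nat -> R) (l : R) : u n @[n --> U] --> l -> ulim u = l.
Proof. by move=> ul; apply: cvg_lim. Qed.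

Lemma ulim_indic (S : set nat) : ulim (fun n => \1_S n) = \1_[set X | U X] S.
Proof.
apply: ulimE; rewrite [X in _ --> X]indicE.
have [US|US] := in_ultra_setVsetC S UU.
  rewrite mem_set//; apply: cvg_near_cst; apply: filterS US => n Sn.
  by rewrite indicE mem_set.
rewrite memNset/=; last first.
  by move=> US'; exact: ultra_absurd US' US.
by apply: cvg_near_cst; apply: filterS US => n Sn; rewrite indicE memNset.
Qed.

End ultralimit.

Section loeb_algebra.
Context {d} {W : measurableType d} (U : set_system nat) (UU : UltraFilter U).
Hypothesis hU : \oo `<=` U.

Definition internal (A : nat -> set W) : set (nat -> W) :=
  [set w | U [set n | A n (w n)]].

Lemma internalI A B : internal A `&` internal B = internal (fun n => A n `&` B n).
Proof.
apply/seteqP; split=> w.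
  by move=> [a b]; apply: filterS2 a b => n /= a b; split.
by move=> h; split; apply: filterS h => n /= [].
Qed.

Lemma internalC A : ~` internal A = internal (fun n => ~` A n).
Proof.
apply/seteqP; split=> w.
  by move=> h; have [] := in_ultra_setVsetC [set n | A n (w n)] UU.
by move=> h h'; exact: ultra_absurd h' h.
Qed.

Lemma internalU A B : internal A `|` internal B = internal (fun n => A n `|` B n).
Proof.
rewrite -[LHS]setCK setCU !internalC internalI internalC; congr internal.
by apply/funext => n; rewrite setCI !setCK.
Qed.

(** If the inclusion failed at [U]-many coordinates, choosing a violating point at each of them
    would give a sequence in the first internal set but not in the second. *)
Lemma subset_internal A B : internal A `<=` internal B -> U [set n | A n `<=` B n].
Proof.
move=> AB; have [//|h] := in_ultra_setVsetC [set n | A n `<=` B n] UU.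
have : forall n, exists w, (~ A n `<=` B n) -> A n w /\ ~ B n w.
  move=> n; have [s|s] := pselect (A n `<=` B n); first by exists point.
  by move/existsNP : s => [w /not_implyP ?]; exists w.
move=> /choice[w hw].
have wA : internal A w by apply: filterS h => n /= /hw[].
have wB : internal (fun n => ~` B n) w by apply: filterS h => n /= /hw[].
by move: wB; rewrite -internalC => /(_ (AB _ wA)).
Qed.

(* The internal sets are closed under a countable form of compactness, which
   makes every finitely additive set function on them a measure. *)
Lemma internal_saturation A (F : nat -> nat -> set W) :
  internal A `<=` \bigcup_k internal (F k) ->
  exists K, internal A `<=` \bigcup_(k in `I_K) internal (F k).
Proof.
move=> AF; apply: contrapT => /forallNP nK.
(* Without a finite subcover, every level [K] is bad at [U]-many coordinates. *)
pose bad K n := exists w, A n w /\ forall k, (k < K)%N -> ~ F k n w.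
have ubad K : U [set n | bad K n].
  have [//|h] := in_ultra_setVsetC [set n | bad K n] UU.
  exfalso; apply: (nK K) => w Aw; apply: contrapT => nF.
  have hk k : (k < K)%N -> U [set n | ~ F k n (w n)].
    move=> kK; have : (~` internal (F k)) w by move=> Fw; apply: nF; exists k.
    by rewrite internalC.
  have hK : U [set n | forall k, (k < K)%N -> ~ F k n (w n)].
    elim: K {h nK nF} hk => [|K IH] hk; first by apply: filterS (filterT) => n.
    have := IH (fun k kK => hk k (ltnW kK)).
    apply: filterS2 (hk K (ltnSn K)) => n /= h1 h2 k.
    by rewrite ltnS leq_eqVlt => /predU1P[->//|]; exact: h2.
  have : U (set0 : set nat).
    apply: filterS (filterI h (filterI Aw hK)) => n /= [nb [An Fn]].
    by apply: nb; exists (w n).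
  by move=> /filter_ex[].
(* One point serves all levels up to [N]: the witness of the highest bad level avoids the earlier
   sets as well. *)
have pick n N : exists w, forall K, (K <= N)%N -> bad K n ->
    A n w /\ forall k, (k < K)%N -> ~ F k n w.
  elim: N => [|N [w IH]].
    have [[w hw]|nb] := pselect (bad 0%N n); last by exists point => K; rewrite leqn0 => /eqP ->.
    by exists w => K; rewrite leqn0 => /eqP ->.
  have [[w' [Aw' Fw']]|nb] := pselect (bad N.+1 n).
    exists w' => K KN _; split=> // k kK; apply: Fw'; exact: leq_trans kK KN.
  by exists w => K; rewrite leq_eqVlt => /predU1P[->//|]; rewrite ltnS => KN; exact: IH.
(* The diagonal choice [N := n] defeats each fixed level, because [U] contains all sets of large
   integers. *)
have /choice[w hw] := fun n => pick n n.
have ge K : U [set n | (K <= n)%N /\ bad K n].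
  by apply: filterI (ubad K); apply: hU; exists K.
have Aw : internal A w.
  by apply: filterS (ge 0%N) => n /= [_ b]; have [] := hw n 0%N (leq0n n) b.
have [k _ Fk] := AF _ Aw.
apply: (ultra_absurd UU Fk); apply: filterS (ge k.+1) => n /= [kn b].
by have [_ /(_ k (ltnSn k))] := hw n k.+1 kn b.
Qed.

End loeb_algebra.

(** Sequences themselves, not classes modulo [U]. The ultrafilter is kept in the type so that the
    algebra structure declared on it can depend on it. *)
Definition loeb (U : set_system nat) (UU : UltraFilter U) (W : Type) : Type := nat -> W.

Section loeb_measurable.
Context {d} {W : measurableType d} (U : set_system nat) (UU : UltraFilter U).
Hypothesis hU : \oo `<=` U.
Notation L := (loeb UU W).

HB.instance Definition _ := Pointed.copy L (nat -> W).

Definition loeb_sets : set (set L) :=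
  [set internal U A | A in [set A | forall n, measurable (A n)]].

Let loeb0 : loeb_sets set0.
Proof.
exists (fun=> set0) => [n|]; first exact: measurable0.
by apply/seteqP; split=> // w /filter_ex[].
Qed.

Let loebU : setU_closed loeb_sets.
Proof.
move=> _ _ [A mA <-] [B mB <-]; rewrite internalU.
by exists (fun n => A n `|` B n) => // n; exact: measurableU.
Qed.

Let loebC : setC_closed loeb_sets.
Proof.
move=> _ [A mA <-]; rewrite internalC.
by exists (fun n => ~` A n) => // n; exact: measurableC.
Qed.

HB.instance Definition _ := isAlgebraOfSets.Build d L loeb0 loebU loebC.

Context {R : realType} (P : probability W R).

Definition loeb_rep (X : set L) : nat -> set W :=
  xget (fun=> set0) [set A | (forall n, measurable (A n)) /\ internal U A = X].

Lemma loeb_repP X : measurable X ->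
  (forall n, measurable (loeb_rep X n)) /\ internal U (loeb_rep X) = X.
Proof.
move=> [A mA AX].
have ex : exists A, [set A | (forall n, measurable (A n)) /\ internal U A = X] A by exists A.
exact: (xgetPex _ ex).
Qed.

Definition loeb_content (X : set L) : \bar R :=
  (ulim U (fun n => fine (P (loeb_rep X n))))%:E.

Let fP (A : set W) : 0 <= fine (P A) .
Proof. exact: fine_ge0. Qed.

Lemma fine_prob01 (A : set W) : measurable A -> 0 <= fine (P A) <= 1.
Proof.
by move=> mA; rewrite fP/= -lee_fin fineK ?probability_le1 ?fin_num_measure.
Qed.

Lemma cvg_internal (A : nat -> set W) : (forall n, measurable (A n)) ->
  fine (P (A n)) @[n --> U] --> ulim U (fun n => fine (P (A n))).
Proof.
move=> mA; apply: (@cvg_ulim _ _ UU _ 1); apply: filterS filterT => n _ /=.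
by have /andP[a0 a1] := fine_prob01 (mA n); rewrite ger0_norm.
Qed.

(** An internal set has many representing sequences; by [subset_internal] any two agree at [U]-many
    coordinates, so the ultralimit does not depend on the chosen one. *)
Lemma loeb_contentE (A : nat -> set W) : (forall n, measurable (A n)) ->
  loeb_content (internal U A) = (ulim U (fun n => fine (P (A n))))%:E.
Proof.
move=> mA; have [mB BA] : (forall n, measurable (loeb_rep (internal U A) n)) /\
    internal U (loeb_rep (internal U A)) = internal U A by apply: loeb_repP; exists A.
congr (_%:E); apply: ulimE; apply: cvg_trans (cvg_internal mA).
apply: near_eq_cvg.
have h1 : U [set n | A n `<=` loeb_rep (internal U A) n].
  by apply: subset_internal; rewrite BA.
have h2 : U [set n | loeb_rep (internal U A) n `<=` A n].
  by apply: subset_internal; rewrite BA.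
by apply: filterS2 h1 h2 => n /= h1 h2; congr (fine (P _)); apply/seteqP.
Qed.

Lemma loeb_contentU (X Y : set L) : measurable X -> measurable Y -> X `&` Y = set0 ->
  loeb_content (X `|` Y) = (loeb_content X + loeb_content Y)%E.
Proof.
move=> [A mA <-] [B mB <-]; rewrite internalI internalU => AB.
rewrite !loeb_contentE//; last by move=> n; exact: measurableU.
rewrite -EFinD; congr (_%:E); apply: ulimE.
apply: cvg_trans (cvgD (cvg_internal mA) (cvg_internal mB)).
apply: near_eq_cvg.
have h : U [set n | A n `&` B n `<=` set0].
  apply: subset_internal; rewrite AB; exact: sub0set.
apply: filterS h => n /= h; rewrite measureU//; last by apply/seteqP.
by rewrite fineD// fin_num_measure.
Qed.

Let content0 : loeb_content set0 = 0%E.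
Proof.
have -> : set0 = internal U (fun=> set0) :> set L.
  by apply/seteqP; split=> // w /filter_ex[].
rewrite loeb_contentE//; congr (_%:E); apply: ulimE.
by under eq_fun do rewrite measure0; exact: cvg_cst.
Qed.

Let content_ge0 X : (0 <= loeb_content X)%E.
Proof.
rewrite lee_fin /ulim; have [c|/dvgP ->//] := pselect (cvg (fine (P (loeb_rep X n)) @[n --> U])).
by apply: limr_ge => //; exact: nearW.
Qed.

(** By saturation an internal set that is a countable disjoint union of internal sets is already
    covered by finitely many of them, so the partial sums are eventually constant. *)
Let content_sigma_additive : semi_sigma_additive loeb_content.
Proof.
move=> F mF tF [A mA AF].
have /choice[B hB] : forall i, exists A, (forall n, measurable (A n)) /\ internal U A = F i.
  by move=> i; have [A' mA' A'F] := mF i; exists A'.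
have mB i n : measurable (B i n) by have [] := hB i.
have BF i : internal U (B i) = F i by have [] := hB i.
have [K hK] : exists K, internal U A `<=` \bigcup_(k in `I_K) internal U (B k).
  apply: internal_saturation => //; rewrite AF => w [k _ Fk]; exists k => //.
  by rewrite BF.
have mU n : measurable (\big[setU/set0]_(k < n) F k).
  exact: bigsetU_measurable.
have fin n : loeb_content (\big[setU/set0]_(k < n) F k) = \sum_(0 <= k < n) loeb_content (F k).
  elim: n => [|n IH]; first by rewrite big_ord0 big_nil content0.
  rewrite big_ord_recr big_nat_recr//= loeb_contentU ?IH//; first exact: (mU n).
  apply/seteqP; split=> // w []; rewrite -bigcup_mkord => -[k /= kn Fk] Fn.
  by have := tF k n I I (ex_intro _ w (conj Fk Fn)); move: kn => /[swap] ->; rewrite ltnn.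
apply: cvg_near_cst; exists K => // n /= Kn.
rewrite -fin; congr loeb_content; apply/seteqP; split=> w.
  by rewrite -bigcup_mkord => -[k _ Fk]; exists k.
rewrite -AF => /hK[k /= kK]; rewrite BF => Fk; rewrite -bigcup_mkord; exists k => //=.
exact: leq_trans kK Kn.
Qed.

HB.instance Definition _ := isMeasure.Build _ _ _ loeb_content
  content0 content_ge0 content_sigma_additive.

Definition loeb_measure := measure_extension loeb_content.

HB.instance Definition _ := Measure.on loeb_measure.

Lemma loeb_measureE (A : nat -> set W) : (forall n, measurable (A n)) ->
  loeb_measure (internal U A) = (ulim U (fun n => fine (P (A n))))%:E.
Proof.
move=> mA; rewrite -loeb_contentE// /loeb_measure /measure_extension.
by rewrite measurable_mu_extE//; exists A.
Qed.

Let loeb_measureT : loeb_measure setT = 1%E.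
Proof.
have -> : setT = internal U (fun=> setT) :> set L.
  by apply/seteqP; split=> // w _; apply: filterS filterT.
rewrite loeb_measureE//; congr (_%:E); apply: ulimE.
by under eq_fun do rewrite probability_setT; exact: cvg_cst.
Qed.

HB.instance Definition _ := Measure_isProbability.Build _ _ _ loeb_measure loeb_measureT.

End loeb_measurable.

Section loeb_integral.
Context {d} {W : measurableType d} (U : set_system nat) (UU : UltraFilter U).
Hypothesis hU : \oo `<=` U.
Context {R : realType} (P : probability W R).
Notation L := (loeb UU W).
Notation LI := (g_sigma_algebraType (@loeb_sets _ W U UU)).
Notation Q := (@loeb_measure _ W U UU hU _ P).

Lemma internal_measurable (A : nat -> set W) : (forall n, measurable (A n)) ->
  measurable (internal U A : set LI).
Proof. by move=> mA; apply: sub_sigma_algebra; exists A. Qed.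

Lemma ulim_ge (u : nat -> R) (a M : R) : U [set n | `|u n| <= M] ->
  U [set n | a <= u n] -> a <= ulim U u.
Proof.
move=> uM au; have c := cvg_ulim UU uM.
by apply: limr_ge au; apply/cvg_ex; eexists; exact: c.
Qed.

Lemma ulim_le (u : nat -> R) (a M : R) : U [set n | `|u n| <= M] ->
  U [set n | u n <= a] -> ulim U u <= a.
Proof.
move=> uM au; have c := cvg_ulim UU uM.
by apply: limr_le au; apply/cvg_ex; eexists; exact: c.
Qed.

(** Ultralimits preserve only weak inequalities, so the event that the limit exceeds [c] is written
    as the union over [j] of the internal events [phi n >= c + 1 / (j + 1)]. *)
Lemma measurable_ulim (phi : nat -> W -> R) (M : R) :
  (forall n, measurable_fun setT (phi n)) -> (forall n w, `|phi n w| <= M) ->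
  measurable_fun setT (fun w : LI => ulim U (fun n => phi n (w n))).
Proof.
move=> mphi hM; have bd w : U [set n | `|phi n (w n)| <= M].
  by apply: filterS filterT => n _; exact: hM.
move=> mD; apply: (measurability _ (RGenOInfty.measurableE R)) => //.
move=> _ [_ [c ->] <-]; rewrite setTI.
rewrite (_ : _ @^-1` _ = \bigcup_j internal U (fun n => phi n @^-1` `[c + j.+1%:R^-1, +oo[)).
  apply: bigcup_measurable => j _; apply: internal_measurable => n.
  by rewrite -[X in measurable X]setTI; exact: mphi.
apply/seteqP; split=> w /=.
  rewrite in_itv/= andbT => cw.
  have e0 : 0 < ulim U (fun n => phi n (w n)) - c by rewrite subr_gt0.
  have [j _ /(_ j (leqnn j)) hj] := near_infty_natSinv_lt (PosNum e0).
  exists j => //; rewrite /internal/=.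
  have := cvgr_gt _ (cvg_ulim UU (bd w)) (c + j.+1%:R^-1).
  rewrite -ltrBrDl => /(_ _ hj); apply: filterS => n h /=.
  by rewrite in_itv/= andbT; exact: ltW.
move=> [j _ hj]; rewrite in_itv/= andbT; apply: (@lt_le_trans _ _ (c + j.+1%:R^-1)).
  by rewrite ltrDl invr_gt0.
apply: ulim_ge (bd w) _; apply: filterS hj => n /=.
by rewrite in_itv/= andbT.
Qed.

(** For indicators of internal sets this is [loeb_measureE]. A layer sum is a finite average of such
    indicators, and its distance to [phi n], at most [1 / (N + 1)], is uniform in [n] and survives
    the ultralimit. *)
Lemma cvg_loeb01 (phi : nat -> W -> R) :
  (forall n, measurable_fun setT (phi n)) -> (forall n w, 0 <= phi n w <= 1) ->
  \int[P]_w phi n w @[n --> U] --> \int[Q]_w ulim U (fun n => phi n (w n)).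
Proof.
move=> mphi h01.
have h1 n w : `|phi n w| <= 1 by have /andP[a b] := h01 n w; rewrite ger0_norm.
have bd w : U [set n | `|phi n (w n)| <= 1] by apply: filterS filterT => n _; exact: h1.
have mlev (N j n : nat) : measurable (phi n @^-1` `[(j.+1%:R / N.+1%:R : R), +oo[).
  by rewrite -[X in measurable X]setTI; exact: mphi.
have bphi n : bdm (phi n) by exact: bdm_le (h1 n).
have bPhi : bdm (fun w : LI => ulim U (fun n => phi n (w n))).
  apply: (@bdm_le _ _ _ _ 1); first exact: measurable_ulim mphi h1.
  move=> w; rewrite ler_norml; apply/andP; split.
    by apply: ulim_ge (bd w) _; apply: filterS filterT => n _ /=; have /andP[+ _] := h01 n (w n); lra.
  by apply: ulim_le (bd w) _; apply: filterS filterT => n _ /=; have /andP[_ +] := h01 n (w n).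
pose lev N j := internal U (fun n => phi n @^-1` `[(j.+1%:R / N.+1%:R : R), +oo[).
have mL N j : measurable (lev N j : set LI) by exact: internal_measurable.
pose L N (w : LI) : R := N.+1%:R^-1 * \sum_(j < N.+1) \1_(lev N j) w.
have layE N n w : layer N (phi n w) =
    N.+1%:R^-1 * \sum_(j < N.+1) \1_(phi n @^-1` `[(j.+1%:R / N.+1%:R : R), +oo[) w.
  rewrite /layer mulrC; congr (_ * _); apply: eq_bigr => j _; rewrite indicE.
  by congr (nat_of_bool _)%:R; apply/idP/idP; rewrite inE/= in_itv/= andbT.
have cL N w : layer N (phi n (w n)) @[n --> U] --> L N w.
  under eq_fun do rewrite layE.
  apply: cvgMr; apply: cvg_sumr => j.
  have := ulim_indic (R := R) UU [set n | (phi n @^-1` `[(j.+1%:R / N.+1%:R : R), +oo[) (w n)].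
  rewrite (_ : \1_[set X | U X] _ = \1_(lev N j) w :> R); last first.
    by rewrite !indicE; congr (nat_of_bool _)%:R; apply/idP/idP; rewrite !inE.
  move=> <-; apply: cvg_trans (cvg_ulim UU (M := 1) _); last first.
    by apply: filterS filterT => n _ /=; rewrite indicE norm_natb_le1.
  apply: near_eq_cvg; apply: filterS filterT => n _ /=.
  by rewrite !indicE; congr (nat_of_bool _)%:R; apply/idP/idP; rewrite !inE.
have LPhi N w : `|ulim U (fun n => phi n (w n)) - L N w| <= N.+1%:R^-1.
  apply: cvg_ub (cvg_norm (cvgB (cvg_ulim UU (bd w)) (cL N w))) _.
  apply: filterS filterT => n _ /=; have /andP[a b] := layer_bound N (h01 n (w n)).
  by rewrite ger0_norm.
have bL N : bdm (L N).
  by apply: bdmZ; apply: bdm_sum => j _; apply: (@bdm_le _ _ _ _ 1) => [|w];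
    [exact: measurable_indic|rewrite indicE norm_natb_le1].
have bind N j n : bdm (\1_(phi n @^-1` `[(j.+1%:R / N.+1%:R : R), +oo[) : W -> R).
  by apply: (@bdm_le _ _ _ _ 1) => [|w]; [exact: measurable_indic|rewrite indicE norm_natb_le1].
have cE N : \int[P]_w layer N (phi n w) @[n --> U] --> \int[Q]_w L N w.
  rewrite EZ; last first.
    by apply: bdm_sum => j _; apply: (@bdm_le _ _ _ _ 1) => [|w];
      [exact: measurable_indic|rewrite indicE norm_natb_le1].
  rewrite E_sum; last first.
    by move=> j _; apply: (@bdm_le _ _ _ _ 1) => [|w];
      [exact: measurable_indic|rewrite indicE norm_natb_le1].
  rewrite (_ : (fun n => _) = (fun n => N.+1%:R^-1 * \sum_(j < N.+1)
      fine (P (phi n @^-1` `[(j.+1%:R / N.+1%:R : R), +oo[)))).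
    apply: cvgMr; apply: cvg_sumr => j; rewrite E_indic//.
    rewrite [X in fine X](loeb_measureE UU hU P (fun n => mlev N j n)).
    exact: cvg_internal.
  apply/funext => n; under eq_Rintegral do rewrite layE.
  rewrite EZ; last by apply: bdm_sum => j _; exact: bind.
  rewrite E_sum; last by move=> j _; exact: bind.
  by congr (_ * _); apply: eq_bigr => j _; rewrite E_indic.
apply/cvgrPdist_le => e e0.
have e3 : 0 < e / 3 by rewrite divr_gt0.
have [N _ /(_ N (leqnn N)) hN] := near_infty_natSinv_lt (PosNum e3).
have /cvgrPdist_le/(_ _ e3) := cE N; apply: filterS => n hn.
have d1 : `|\int[Q]_w ulim U (fun n => phi n (w n)) - \int[Q]_w L N w| <= e / 3.
  rewrite -EB//; apply: norm_E_cst; first exact: bdmB.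
  by move=> w; apply: le_trans (LPhi N w) (ltW hN).
have d2 : `|\int[P]_w phi n w - \int[P]_w layer N (phi n w)| <= e / 3.
  have bl : bdm (fun w => layer N (phi n w)).
    by under eq_fun do rewrite layE; apply: bdmZ; apply: bdm_sum => j _; exact: bind.
  rewrite -EB//; apply: norm_E_cst; first exact: bdmB.
  move=> w; have /andP[a b] := layer_bound N (h01 n w).
  by rewrite ger0_norm//; apply: le_trans b (ltW hN).
move: d1 d2 hn; rewrite !ler_norml; set a := \int[Q]_w _; set b := \int[P]_w _.
set x := \int[Q]_w _; set y := \int[P]_w _.
by move=> /andP[? ?] /andP[? ?] /andP[? ?]; apply/andP; split; lra.
Qed.

Lemma cvg_loeb (phi : nat -> W -> R) (M : R) :
  (forall n, measurable_fun setT (phi n)) -> (forall n w, `|phi n w| <= M) ->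
  \int[P]_w phi n w @[n --> U] --> \int[Q]_w ulim U (fun n => phi n (w n)).
Proof.
move=> mphi hM.
have M0 : 0 < `|M| + 1 by rewrite ltr_wpDl.
(* Affine reduction to values in [[0, 1]]; the added 1 keeps the divisor positive whatever [M]
   is. *)
pose k (u : R) := (u / (`|M| + 1) + 1) / 2.
have mk n : measurable_fun setT (fun w => k (phi n w)).
  apply: measurable_funM => //; apply: measurable_funD => //; exact: measurable_funM.
have k01 n w : 0 <= k (phi n w) <= 1.
  have : `|phi n w| <= `|M| + 1 by apply: le_trans (hM n w) _; have := ler_norm M; lra.
  rewrite ler_norml => /andP[a b].
  have a' : -1 <= phi n w / (`|M| + 1) by rewrite ler_pdivlMr// mulN1r.
  have b' : phi n w / (`|M| + 1) <= 1 by rewrite ler_pdivrMr// mul1r.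
  by rewrite /k; lra.
have bd w : U [set n | `|phi n (w n)| <= M] by apply: filterS filterT => n _; exact: hM.
have bphi n : bdm (phi n) by exact: bdm_le (hM n).
have bPhi : bdm (fun w : LI => ulim U (fun n => phi n (w n))).
  apply: (@bdm_le _ _ _ _ M); first exact: measurable_ulim mphi hM.
  move=> w; apply: cvg_ub (cvg_norm (cvg_ulim UU (bd w))) (bd w).
have uk w : ulim U (fun n => k (phi n (w n))) = k (ulim U (fun n => phi n (w n))).
  by apply: ulimE; apply: cvgMl; apply: cvgD; [apply: cvgMl; exact: cvg_ulim (bd w)|exact: cvg_cst].
have := cvg_loeb01 mk k01.
have kI d' (W' : measurableType d') (P' : probability W' R) (f : W' -> R) : bdm f ->
    \int[P']_w f w = (`|M| + 1) * (2 * \int[P']_w k (f w) - 1).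
  move=> bf; have -> : \int[P']_w k (f w) = (\int[P']_w f w / (`|M| + 1) + 1) / 2.
    have -> : \int[P']_w k (f w) = \int[P']_w (2^-1 * ((`|M| + 1)^-1 * f w + 1)).
      by apply: eq_Rintegral => w _; rewrite /k; field; rewrite gt_eqF.
    rewrite EZ; last by apply: bdmD (bdm_cst _); exact: bdmZ.
    rewrite ED ?EZ ?E_cst//; [|exact: bdmZ|exact: bdm_cst].
    by field; rewrite gt_eqF.
  by field; rewrite gt_eqF.
move=> h; rewrite kI//.
rewrite (_ : (fun n => _) = (fun n => (`|M| + 1) * (2 * \int[P]_w k (phi n w) - 1))); last first.
  by apply/funext => n; rewrite kI.
apply: cvgMr; apply: cvgB; last exact: cvg_cst.
apply: cvgMr; apply: cvg_trans h _.
by under eq_Rintegral do rewrite uk.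
Qed.

End loeb_integral.

Section loeb_process.
Context {R : realType}.

Definition clamp (M u : R) := Num.max (- M) (Num.min u M).

Lemma norm_clamp M u : 0 <= M -> `|clamp M u| <= M.
Proof.
move=> M0; rewrite ler_norml /clamp le_max lexx/= ge_max ge_min lexx orbT andbT.
by rewrite ge0_cp.
Qed.

Lemma clamp_id M u : `|u| <= M -> clamp M u = u.
Proof.
by rewrite ler_norml /clamp => /andP[a b]; rewrite min_l// max_r.
Qed.

Context {d} {W : measurableType d} (P : probability W R).
Variables (U : set_system nat) (UU : UltraFilter U) (hU : \oo `<=` U).
Notation LI := (g_sigma_algebraType (@loeb_sets _ W U UU)).
Notation Q := (@loeb_measure _ W U UU hU _ P).
Variables (T : Type) (z : nat -> T -> W -> R).
Hypothesis mz : forall n t, measurable_fun setT (z n t).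
Hypothesis tight : forall t (e : R), 0 < e -> exists M : R,
  \forall n \near \oo, fine (P [set w | M < `|z n t w|]) <= e.

Let bnd t (M : R) : set LI := internal U (fun n => [set w | `|z n t w| <= M]).

Let mbnd1 n t (M : R) : measurable [set w | `|z n t w| <= M].
Proof.
rewrite (_ : [set _ | _] = (fun w => `|z n t w|) @^-1` `]-oo, M]).
  rewrite -[X in measurable X]setTI.
  by apply: (measurableT_comp (@normr_measurable R setT) (mz n t)).
by apply/seteqP; split=> w /=; rewrite in_itv.
Qed.

(** The sequences at which the nonstandard value of the process is finite, so that its standard part
    exists. *)
Let fin t : set LI := \bigcup_(M : nat) bnd t M%:R.

Let mbnd t M : measurable (bnd t M).
Proof. exact: internal_measurable. Qed.

Let mfin t : measurable (fin t).
Proof. by apply: bigcup_measurable => M _; exact: mbnd. Qed.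

(** The Loeb measure of a level [bnd t N%:R] is an ultralimit of probabilities that tightness keeps
    above [1 - e]. *)
Let Qfin t : Q (fin t) = 1%E.
Proof.
apply/eqP; rewrite eq_le probability_le1//=.
apply/lee_addgt0Pr => e e0; have [M hM] := tight t e0.
pose N := (Num.trunc `|M|).+1.
have MN : M <= N%:R by rewrite (le_trans (ler_norm M))// ltW// truncnS_gt.
apply: (@le_trans _ _ (Q (bnd t N%:R) + e%:E)%E); last first.
  apply: leeD2r; apply: le_measure; rewrite ?inE; [exact: mbnd|exact: mfin|].
  by move=> w bw; exists N.
rewrite loeb_measureE// -EFinD lee_fin -lerBlDr; apply: (ulim_ge UU (M := 1)).
  apply: filterS filterT => n _ /=.
  by have /andP[a b] := fine_prob01 P (mbnd1 n t N%:R); rewrite ger0_norm.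
apply: hU; apply: filterS hM => n /= hn.
have -> : [set w | `|z n t w| <= N%:R] = ~` [set w | N%:R < `|z n t w|].
  by apply/seteqP; split=> w /=; rewrite leNgt => /negP.
have mgt (K : R) : measurable [set w | K < `|z n t w|].
  rewrite (_ : [set w | K < `|z n t w|] = ~` [set w | `|z n t w| <= K]).
    exact: measurableC.
  by apply/seteqP; split=> w /=; rewrite ltNge => /negP.
rewrite probability_setC// fineB ?fin_num_measure//= lerB//.
apply: le_trans hn; apply: fine_le; rewrite ?fin_num_measure//.
by apply: le_measure; rewrite ?inE// => w /=; exact: le_lt_trans.
Qed.

(** The standard part, set to 0 off the full-measure set where it exists, so that it is measurable
    everywhere. *)
Definition loeb_proc t (w : LI) : R := ulim U (fun n => z n t (w n)) * \1_(fin t) w.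

Lemma measurable_loeb_proc t : measurable_fun setT (loeb_proc t).
Proof.
have mc (M : nat) n : measurable_fun setT (fun w => clamp M%:R (z n t w)).
  by apply: measurable_maxr => //; exact: measurable_minr.
(* [measurable_ulim] needs a uniform bound, hence the clamping; on [fin t] the clamped limits are
   eventually constant in [M]. *)
pose h (M : nat) (w : LI) := ulim U (fun n => clamp M%:R (z n t (w n))) * \1_(fin t) w.
have mh M : measurable_fun setT (h M).
  apply: measurable_funM; last exact: measurable_indic.
  by apply: (measurable_ulim (phi := fun n w => clamp M%:R (z n t w)) (M := M%:R)) => // n w; exact: norm_clamp.
apply: (measurable_fun_cvg mh) => w _; rewrite /h /loeb_proc.
have [fw|nw] := pselect (fin t w); last first.
  rewrite indicE memNset//= mulr0; under eq_fun do rewrite mulr0; exact: cvg_cst.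
apply: cvgMl; have [K _ hK] := fw.
apply: cvg_near_cst; exists K => // M /= KM; apply: ulimE.
have := cvg_ulim UU hK; apply: cvg_trans; apply: near_eq_cvg.
apply: filterS hK => n /= hn; rewrite clamp_id//; apply: le_trans hn _.
by rewrite ler_nat.
Qed.

(** Where all [k] coordinates are finite, which is almost everywhere, continuity lets [f] commute
    with the ultralimit; [cvg_loeb] then applies to the bounded functions [f] of the rows. *)
Lemma cvg_loeb_proc k (t : 'I_k -> T) (f : 'rV[R]_k -> R) (M : R) :
  continuous f -> (forall v, `|f v| <= M) ->
  \int[P]_w f (\row_i z n (t i) w) @[n --> U] -->
  \int[Q]_w f (\row_i loeb_proc (t i) w).
Proof.
move=> cf fM.
have bz n : bdm (fun w => f (\row_i z n (t i) w)) by exact: bdm_row.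
have bd w : U [set n | `|f (\row_i z n (t i) (w n))| <= M].
  by apply: filterS filterT => n _; exact: fM.
have bG : bdm (fun w => f (\row_i loeb_proc (t i) w)).
  by apply: bdm_row fM => // i; exact: measurable_loeb_proc.
have bPhi : bdm (fun w : LI => ulim U (fun n => f (\row_i z n (t i) (w n)))).
  apply: (@bdm_le _ _ _ _ M).
    by apply: (measurable_ulim (phi := fun n w => f (\row_i z n (t i) w)) (M := M)) => // n; have [] := bz n.
  by move=> w; exact: cvg_ub (cvg_norm (cvg_ulim UU (bd w))) (bd w).
have -> : \int[Q]_w f (\row_i loeb_proc (t i) w) =
    \int[Q]_w ulim U (fun n => f (\row_i z n (t i) (w n))).
  congr fine; apply: ae_eq_integral => //.
  - by apply/measurable_EFinP; exact: bG.1.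
  - by apply/measurable_EFinP; exact: bPhi.1.
  have aefin : {ae Q, forall w, forall i, fin (t i) w}.
    apply: filter_forall => i; exists (~` fin (t i)); split => //.
      exact: measurableC.
    by rewrite probability_setC// [X in (1 - X)%E]Qfin subee.
  apply: filterS aefin => w hw _; congr (_%:E); apply/esym; apply: ulimE.
  apply: (cvg_comp _ f); last exact: cf.
  apply: cvg_row => i; have [K _ hK] := hw i.
  by rewrite /loeb_proc indicE mem_set// mulr1; exact: cvg_ulim hK.
apply: cvg_loeb => [n|n w]; [exact: (bz n).1|exact: fM].
Qed.

End loeb_process.

(** * The characteristic function of the normal law *)

Lemma cvg_Rintegral d (W : measurableType d) (R : realType)
    (mu : {measure set W -> \bar R}) (f_ : nat -> W -> R) f (h : W -> R) :
  (forall n, measurable_fun setT (f_ n)) -> mu.-integrable setT (EFin \o h) ->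
  (forall n w, `|f_ n w| <= h w) ->
  (forall w, f_ n w @[n --> \oo] --> f w) ->
  \int[mu]_w f_ n w @[n --> \oo] --> \int[mu]_w f w.
Proof.
move=> mf_ ih hM cf.
have mf : measurable_fun setT f.
  by apply: measurable_fun_cvg mf_ _ => w _; exact: cf.
have i_f : mu.-integrable setT (EFin \o f).
  apply: le_integrable ih => //; first exact/measurable_EFinP.
  move=> w _; change ((`|f w|)%:E <= `|h w|%:E)%E; rewrite lee_fin.
  apply: (cvgr_to_le (cvg_norm (cf w))); apply: nearW => n.
  by rewrite (le_trans (hM n w))// ler_norm.
apply: fine_cvg; rewrite -[X in _ --> X]/(_%:E) fineK; last exact: integrable_fin_num.
apply: (@dominated_cvg _ _ _ mu _ _ (fun n w => (f_ n w)%:E) (EFin \o f) (EFin \o h)) => //.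
- by move=> n; exact/measurable_EFinP.
- by move=> w _; apply: cvg_EFin; [exact: nearW|exact: cf].
- by move=> n w _; rewrite lee_fin.
Qed.

Lemma is_derive_continuous (R : realType) (f df : R -> R) :
  (forall x : R, is_derive x 1 f (df x)) -> continuous f.
Proof. by move=> h x; apply/differentiable_continuous/derivable1_diffP; exact: (@ex_derive _ _ _ _ _ _ _ (h x)). Qed.

Section normal_chf.
Context {R : realType}.
Notation mu := (@lebesgue_measure R).

Definition gauss (c x : R) : R := expR (- (c * x ^+ 2)).

Lemma gauss_ge0 c x : 0 <= gauss c x. Proof. exact: expR_ge0. Qed.

Lemma normal_pdf_gauss (s x : R) : s != 0 ->
  normal_pdf 0 s x = normal_peak s * gauss (2 * s ^+ 2)^-1 x.
Proof.
move=> s0; rewrite normal_pdfE// /normal_fun /gauss; congr (_ * expR _).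
by rewrite subr0 mulNr; congr (- _); rewrite mulrC mulr_natl.
Qed.

(** Up to a factor this is the normal density with variance [1 / (2 c)]. *)
Lemma gauss_integrable c : 0 < c -> mu.-integrable setT (EFin \o gauss c).
Proof.
move=> c0; pose s := Num.sqrt (2 * c)^-1.
have s0 : s != 0 by rewrite gt_eqF// sqrtr_gt0 invr_gt0 mulr_gt0.
have sc : (2 * s ^+ 2)^-1 = c.
  by rewrite sqr_sqrtr ?invr_ge0 ?mulr_ge0 ?(ltW c0)//; field; rewrite gt_eqF.
have := integrableZl measurableT (normal_peak s)^-1 (integrable_normal_pdf 0 s).
apply: eq_integrable => // x _ /=.
by rewrite -EFinM normal_pdf_gauss// sc mulKf// gt_eqF// normal_peak_gt0.
Qed.

Lemma measurable_gauss c : measurable_fun setT (gauss c).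
Proof.
apply: (measurableT_comp (@measurable_expR R)) => //.
apply: measurableT_comp => //; apply: measurable_funM => //; exact: measurable_funX.
Qed.

(** Half of the exponent absorbs [|x|]: [exp (c x^2 / 2)] is at least [1 + c x^2 / 2], and
    [(1 + 1 / c)] times the latter exceeds [(1 + x^2) / 2 >= |x|]. *)
Lemma norm_mul_gauss c x : 0 < c -> `|x| * gauss c x <= (1 + c^-1) * gauss (c / 2) x.
Proof.
move=> c0; have -> : gauss c x = gauss (c / 2) x * gauss (c / 2) x.
  by rewrite /gauss -expRD; congr expR; field.
rewrite mulrA ler_wpM2r ?gauss_ge0// /gauss expRN ler_pdivrMr ?expR_gt0//.
apply: (@le_trans _ _ ((1 + c^-1) * (1 + c / 2 * x ^+ 2))); last first.
  by rewrite ler_wpM2l ?expR_ge1Dx// addr_ge0// invr_ge0 ltW.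
have i0 : 0 < c^-1 by rewrite invr_gt0.
have : (1 + c^-1) * (1 + c / 2 * x ^+ 2) = 1 + c / 2 * x ^+ 2 + c^-1 + x ^+ 2 / 2.
  by field; rewrite gt_eqF.
move=> ->; rewrite -(real_normK (num_real x)).
have : 0 <= (`|x| - 1) ^+ 2 by exact: sqr_ge0.
have : 0 <= c / 2 * `|x| ^+ 2 by rewrite mulr_ge0 ?sqr_ge0// divr_ge0// ltW.
by rewrite sqrrB; lra.
Qed.

Lemma mul_gauss_integrable c (h : R -> R) : 0 < c -> measurable_fun setT h ->
  (forall x, `|h x| <= `|x|) -> mu.-integrable setT (EFin \o (fun x => h x * gauss c x)).
Proof.
move=> c0 mh hx; have c2 : 0 < c / 2 by rewrite divr_gt0.
apply: le_integrable (integrableZl measurableT (1 + c^-1) (gauss_integrable c2)) => //.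
  by apply/measurable_EFinP; apply: measurable_funM => //; exact: measurable_gauss.
move=> x _; change ((`|h x * gauss c x|)%:E <= `|(1 + c^-1) * gauss (c / 2) x|%:E)%E.
rewrite lee_fin normrM (ger0_norm (gauss_ge0 _ _)).
rewrite [leRHS]ger0_norm; last first.
  by rewrite mulr_ge0 ?gauss_ge0// addr_ge0// invr_ge0 ltW.
apply: le_trans (norm_mul_gauss _ c0).
by rewrite ler_wpM2r ?gauss_ge0.
Qed.

Lemma bdd_gauss_integrable c (h : R -> R) : 0 < c -> bdm h ->
  mu.-integrable setT (EFin \o (fun x => h x * gauss c x)).
Proof.
move=> c0 [mh [M hM]].
apply: le_integrable (integrableZl measurableT M (gauss_integrable c0)) => //.
  by apply/measurable_EFinP; apply: measurable_funM => //; exact: measurable_gauss.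
move=> x _; change ((`|h x * gauss c x|)%:E <= `|M * gauss c x|%:E)%E.
rewrite lee_fin normrM (ger0_norm (gauss_ge0 _ _)).
rewrite [leRHS]ger0_norm ?ler_wpM2r ?gauss_ge0// mulr_ge0 ?gauss_ge0//.
exact: le_trans (hM x).
Qed.

Lemma is_derive_gauss (c x : R) : is_derive x 1 (gauss c) (- (2 * c * x) * gauss c x).
Proof.
have h : is_derive x 1 (fun y : R => - (c * y ^+ 2)) (- (2 * c * x)).
  by apply: is_derive_eq; rewrite /GRing.scale/=; ring.
rewrite mulrC.
exact: (@is_derive1_comp _ expR (fun y : R => - (c * y ^+ 2)) _ _ _ (is_derive_expR _) h).
Qed.

Let af (t b x : R) := t * x + b.

Let is_derive_af (t b x : R) : is_derive x 1 (af t b) t.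
Proof. by rewrite /af; apply: is_derive_eq; rewrite /GRing.scale/=; ring. Qed.

Let maf t b : measurable_fun setT (af t b).
Proof. by apply: measurable_funD => //; exact: measurable_funM. Qed.

Let bcos t b : bdm (fun x => cos (af t b x)). Proof. exact: bdm_cos. Qed.

Lemma cvg_gauss c : 0 < c -> gauss c N.+1%:R @[N --> \oo] --> (0 : R).
Proof.
move=> c0; apply: (@squeeze_cvgr _ _ _ _ (fun=> 0) (fun N => c^-1 * N.+1%:R^-1)).
- apply: nearW => N; rewrite gauss_ge0/= /gauss expRN -invfM lef_pV2 ?posrE ?expR_gt0 ?mulr_gt0 ?ltr0n//.
  apply: le_trans (expR_ge1Dx _); rewrite ler_wpDl// ler_pM2l// expr2 ler_peMr ?ler0n// ler1n//.
- exact: cvg_cst.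
- rewrite -[X in _ --> X](mulr0 c^-1); apply: cvgM; [exact: cvg_cst|exact: cvg_harmonic].
Qed.

(* Integration by parts against the derivative of the density. *)
Lemma gauss_by_parts c t b : 0 < c ->
  \int[mu]_x (x * sin (af t b x) * gauss c x) =
  t / (2 * c) * \int[mu]_x (cos (af t b x) * gauss c x).
Proof.
move=> c0.
pose F x := sin (af t b x) * gauss c x.
pose f1 x := cos (af t b x) * gauss c x.
pose f2 x := x * sin (af t b x) * gauss c x.
pose f x := t * f1 x - 2 * c * f2 x.
have dF (x : R) : is_derive x 1 F (f x).
  have h := @is_derive1_comp _ sin (af t b) _ _ _ (is_derive_sin (af t b x)) (is_derive_af t b x).
  have -> : f x = ((sin \o af t b) x *: (- (2 * c * x) * gauss c x) + gauss c x *: (cos (af t b x) * t)).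
    by rewrite /f /f1 /f2 /GRing.scale/=; ring.
  exact: (is_deriveM h (is_derive_gauss c x)).
have i1 : mu.-integrable setT (EFin \o f1) by exact: bdd_gauss_integrable.
have i2 : mu.-integrable setT (EFin \o f2).
  apply: mul_gauss_integrable => //; first by apply: measurable_funM => //; exact: measurable_sinf.
  by move=> x; rewrite normrM ler_piMr// norm_sin_le1.
have i3 : mu.-integrable setT (EFin \o f).
  have j1 := integrableZl measurableT t i1; have j2 := integrableZl measurableT (2 * c) i2.
  exact: (integrableB measurableT j1 j2).
have mf : measurable_fun setT f by apply/measurable_EFinP; case/integrableP: i3.
have cF : continuous F := is_derive_continuous dF.
have cf : continuous f.
  have c1 : continuous (cos \o af t b).
    by move=> x; apply: continuous_comp; [exact: is_derive_continuous (is_derive_af t b) x|exact: continuous_cos].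
  have c2 : continuous (sin \o af t b).
    by move=> x; apply: continuous_comp; [exact: is_derive_continuous (is_derive_af t b) x|exact: continuous_sin].
  have c3 : continuous (gauss c) := is_derive_continuous (is_derive_gauss c).
  move=> x; apply: cvgB; apply: cvgM; try exact: cvg_cst; apply: cvgM; [exact: c1|exact: c3| |exact: c3].
  by apply: cvgM; [exact: cvg_id|exact: c2].
suff : \int[mu]_x f x = 0.
  rewrite /f RintegralB//; [|exact: (integrableZl measurableT t i1)|exact: (integrableZl measurableT (2 * c) i2)].
  rewrite !RintegralZl// => /eqP; rewrite subr_eq0 => /eqP e.
  rewrite -[LHS](mulKf (x := 2 * c)); last by rewrite gt_eqF// mulr_gt0.
  by rewrite -e; field; rewrite gt_eqF.
have Fint (N : nat) : \int[mu]_(x in `[- N.+1%:R, N.+1%:R]) f x = F N.+1%:R - F (- N.+1%:R).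
  rewrite /Rintegral (@continuous_FTC2 _ f F)//.
  - by rewrite -subr_gt0 opprK addr_gt0 ?ltr0n.
  - exact: continuous_subspaceT.
  - split; [by move=> x _; exact: (@ex_derive _ _ _ _ _ _ _ (dF x))|apply: cvg_at_right_filter; exact: cF|].
    by apply: cvg_at_left_filter; exact: cF.
  - by move=> x _; rewrite derive1E; exact: derive_val.
have c1 : \int[mu]_(x in `[- N.+1%:R, N.+1%:R]) f x @[N --> \oo] --> \int[mu]_x f x.
  have -> : (fun N : nat => \int[mu]_(x in `[- N.+1%:R, N.+1%:R]) f x) =
      (fun N : nat => \int[mu]_x ((f \_ `[- N.+1%:R, N.+1%:R]) x)).
    by apply/funext => N; rewrite Rintegral_mkcond.
  apply: (@cvg_Rintegral _ _ _ mu (fun N : nat => f \_ `[- N.+1%:R, N.+1%:R]) f (fun x => `|f x|)).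
  - by move=> N; apply/(measurable_restrictT f) => //; exact: measurable_funTS.
  - exact: integrable_norm i3.
  - by move=> N x; rewrite patchE; case: ifP => // _; rewrite normr0.
  - move=> x; apply: cvg_near_cst; near=> N; rewrite patchE ifT// inE/= in_itv/= -ler_norml.
    near: N; exists (Num.bound `|x|) => // N /= hN.
    apply: le_trans (ltW (archi_boundP (normr_ge0 x))) _.
    by rewrite ler_nat (leq_trans hN).
have c2 : F N.+1%:R - F (- N.+1%:R) @[N --> \oo] --> (0 : R).
  have b1 (x : R) : `|F x| <= gauss c x.
    by rewrite normrM (ger0_norm (gauss_ge0 _ _)) ler_piMl ?gauss_ge0 ?norm_sin_le1.
  apply/norm_cvg0P; apply: (@squeeze_cvgr _ _ _ _ (fun=> 0) (fun N => 2 * gauss c N.+1%:R)).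
  - apply: nearW => N; rewrite normr_ge0/= (le_trans (ler_normB _ _))// mulr2n mulrDl mul1r lerD//.
    by apply: le_trans (b1 _) _; rewrite /gauss sqrrN.
  - exact: cvg_cst.
  - rewrite -[X in _ --> X](mulr0 (2:R)); apply: cvgM; [exact: cvg_cst|exact: cvg_gauss].
rewrite -(funext Fint) in c2.
exact: (cvg_unique _ c1 c2).
Unshelve. all: by end_near.
Qed.

(** Differentiation under the integral and [gauss_by_parts] show that, as a function of [t], the
    integral satisfies [K' = - t / (2 c) K]. Multiplied by [exp (t^2 / (4 c))] it is constant. *)
Lemma gauss_cos c t b : 0 < c ->
  \int[mu]_x (cos (af t b x) * gauss c x) =
  cos b * expR (- (t ^+ 2 / (4 * c))) * \int[mu]_x gauss c x.
Proof.
move=> c0.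
pose f u x := cos (af u b x) * gauss c x.
pose K t := \int[mu]_x f t x.
have dfu (u x : R) : is_derive u 1 (f ^~ x) (- (x * sin (af u b x) * gauss c x)).
  have h1 : is_derive u 1 (fun u => af u b x) x.
    by rewrite /af; apply: is_derive_eq; rewrite /GRing.scale/=; ring.
  have h := @is_derive1_comp _ cos (fun u => af u b x) _ _ _ (is_derive_cos (af u b x)) h1.
  have -> : - (x * sin (af u b x) * gauss c x) = (cos (af u b x)) *: 0 + gauss c x *: (- sin (af u b x) * x).
    by rewrite /GRing.scale/=; ring.
  exact: (is_deriveM h (is_derive_cst (gauss c x) u 1)).
have igauss : mu.-integrable setT (EFin \o (fun x => `|x| * gauss c x)).
  by apply: mul_gauss_integrable => // x; rewrite normr_id.
have dK (u : R) : is_derive u 1 K (- (u / (2 * c)) * K u).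
  have ui : `]u - 1, u + 1[%classic u by rewrite /= in_itv/= ltrBlDr ltrDl ltr01.
  have i1 x : `]u - 1, u + 1[%classic x -> mu.-integrable setT (EFin \o f x).
    by move=> _; exact: bdd_gauss_integrable.
  have d1 x y : `]u - 1, u + 1[%classic x -> [set: R] y -> derivable (f ^~ y) x 1.
    by move=> _ _; exact: (@ex_derive _ _ _ _ _ _ _ (dfu x y)).
  have b1 x y : `]u - 1, u + 1[%classic x -> [set: R] y -> `|partial1of2 f x y| <= `|y| * gauss c y.
    move=> _ _; rewrite partial1of2E derive_val normrN !normrM (ger0_norm (gauss_ge0 _ _)).
    by rewrite ler_wpM2r ?gauss_ge0// ler_piMr// norm_sin_le1.
  have G0 y : 0 <= `|y| * gauss c y by rewrite mulr_ge0// gauss_ge0.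
  have der := derivable_under_integral measurableT ui i1 d1 G0 igauss b1.
  have val := differentiation_under_integral measurableT ui i1 d1 G0 igauss b1.
  apply: DeriveDef; first exact: der.
  rewrite -derive1E val.
  rewrite mulNr -(gauss_by_parts u b c0) -mulN1r -RintegralZl//; last first.
    apply: mul_gauss_integrable => //; first by apply: measurable_funM => //; exact: measurable_sinf.
    by move=> x; rewrite normrM ler_piMr// norm_sin_le1.
  by apply: eq_Rintegral => x _; rewrite mulN1r partial1of2E derive_val.
pose e (u : R) := expR (u ^+ 2 / (4 * c)).
have de (u : R) : is_derive u 1 e (u / (2 * c) * e u).
  have h1 : is_derive u 1 (fun u : R => u ^+ 2 / (4 * c)) (u / (2 * c)).
    by apply: is_derive_eq; rewrite /GRing.scale/=; field; rewrite gt_eqF.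
  rewrite mulrC.
  exact: (@is_derive1_comp _ expR (fun u : R => u ^+ 2 / (4 * c)) _ _ _ (is_derive_expR _) h1).
pose H u := K u * e u.
have dH (u : R) : is_derive u 1 H 0.
  have -> : 0 = K u *: (u / (2 * c) * e u) + e u *: (- (u / (2 * c)) * K u).
    by rewrite /GRing.scale/=; ring.
  exact: (is_deriveM (dK u) (de u)).
have := is_derive_0_is_cst t 0 dH.
rewrite /H /e expr0n/= mul0r expR0 mulr1 => h.
have -> : \int[mu]_x (cos (af t b x) * gauss c x) = K 0 * expR (- (t ^+ 2 / (4 * c))).
  by rewrite -h expRN mulfK// gt_eqF// expR_gt0.
rewrite /K /f /af; under eq_Rintegral do rewrite mul0r add0r.
rewrite RintegralZl//; first by rewrite -!mulrA; congr (_ * _); rewrite mulrC.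
exact: gauss_integrable.
Qed.

(** The change of variables yields the Radon-Nikodym derivative, which equals [normal_pdf] almost
    everywhere because both have the same integrals over measurable sets. *)
Lemma integral_normal_prob (s : R) (h : R -> R) : s != 0 -> bdm h ->
  \int[normal_prob 0 s]_x h x = \int[mu]_x (h x * normal_pdf 0 s x).
Proof.
move=> s0 bh; have bi := bdm_integrable (normal_prob 0 s) bh.
rewrite /Rintegral; congr fine.
rewrite -(Radon_Nikodym_change_of_variables (normal_prob_dominates 0 s))//=.
apply: ae_eq_integral => //.
- apply: emeasurable_funM => //; first by apply/measurable_EFinP; case: bh.
  apply: (measurable_int mu).
  by apply: Radon_Nikodym_integrable; exact: normal_prob_dominates.
- by apply/measurable_EFinP; apply: measurable_funM; [case: bh|exact: measurable_normal_pdf].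
- have h0 : ae_eq mu setT (Radon_Nikodym (charge_of_finite_measure (normal_prob 0 s)) mu) (EFin \o normal_pdf 0 s).
    rewrite Radon_NikodymE//=; first exact: normal_prob_dominates.
    move=> abmu; case: cid => /= k [k1 k2 k3].
    apply: integral_ae_eq => //=.
    + by apply/measurable_EFinP; exact: measurable_normal_pdf.
    + by move=> A _ mA; rewrite -k3.
  by apply: filterS h0 => x hx _; rewrite hx// EFinM.
Qed.

Lemma normal_cos (s t b : R) : s != 0 ->
  \int[normal_prob 0 s]_x cos (t * x + b) = cos b * expR (- (t ^+ 2 * s ^+ 2 / 2)).
Proof.
move=> s0; have c0 : 0 < (2 * s ^+ 2)^-1 by rewrite invr_gt0 mulr_gt0// exprn_even_gt0.
rewrite integral_normal_prob//; last exact: bcos.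
have e x : cos (t * x + b) * normal_pdf 0 s x = normal_peak s * (cos (af t b x) * gauss (2 * s ^+ 2)^-1 x).
  by rewrite normal_pdf_gauss//; ring.
under eq_Rintegral do rewrite e.
rewrite RintegralZl//; last exact: bdd_gauss_integrable.
rewrite gauss_cos// mulrCA -RintegralZl//; last exact: gauss_integrable.
under [X in _ * X]eq_Rintegral do rewrite -normal_pdf_gauss//.
have -> : \int[mu]_x normal_pdf 0 s x = 1.
  by rewrite /Rintegral integral_normal_pdf.
rewrite mulr1; congr (_ * expR (- _)); field.
by rewrite s0.
Qed.

End normal_chf.

(** * Tightness and moments from characteristic functions *)

Section normal_average.
Context {R : realType} {d} {W : measurableType d} (P : probability W R).

Lemma expRN_bdm d' (V : measurableType d') (f : V -> R) : measurable_fun setT f ->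
  (forall w, 0 <= f w) -> bdm (fun w => expR (- f w)).
Proof.
move=> mf f0; apply: (@bdm_le _ _ _ _ 1).
  by apply: measurableT_comp => //; exact: measurableT_comp.
by move=> w; rewrite ger0_norm ?expR_ge0// -expR0 ler_expR oppr_le0.
Qed.

Lemma bdm_gauss d' (V : measurableType d') (f : V -> R) (c : R) : measurable_fun setT f ->
  0 <= c -> bdm (fun w => expR (- (f w ^+ 2 * c / 2))).
Proof.
move=> mf c0; apply: expRN_bdm => [|w]; last by rewrite divr_ge0// mulr_ge0 ?sqr_ge0.
by apply: measurable_funM => //; apply: measurable_funM => //; exact: measurable_funX.
Qed.

Lemma E_cosD (f : W -> R) (b : R) : measurable_fun setT f ->
  \int[P]_w cos (f w + b) = cos b * \int[P]_w cos (f w) - sin b * \int[P]_w sin (f w).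
Proof.
move=> mf; have b1 := bdm_cos mf; have b2 := bdm_sin mf.
rewrite -!EZ// -EB; [|exact: bdmZ..].
by apply: eq_Rintegral => w _; rewrite cosD; congr (_ - _); exact: mulrC.
Qed.

(** With [th] integrated first, the inner integral is the normal characteristic function at [y w].
    Tonelli is applied to [1 - cos], which is nonnegative. *)
Lemma integral_cos_normal (s : R) (y : W -> R) : s != 0 -> measurable_fun setT y ->
  bdm (fun th : R => \int[P]_w cos (th * y w)) /\
  \int[normal_prob 0 s]_th (\int[P]_w cos (th * y w)) =
  \int[P]_w expR (- (y w ^+ 2 * s ^+ 2 / 2)).
Proof.
move=> s0 my.
have b1 w : bdm (fun th : R => cos (th * y w)) by apply: bdm_cos; exact: measurable_funM.
have b2 (th : R) : bdm (fun w => cos (th * y w)) by apply: bdm_cos; exact: measurable_funM.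
have b3 : bdm (fun w => expR (- (y w ^+ 2 * s ^+ 2 / 2))).
  by apply: bdm_gauss; rewrite ?sqr_ge0.
pose F (p : W * R) : \bar R := (1 - cos (p.2 * y p.1))%:E.
have mF : measurable_fun setT F.
  apply/measurable_EFinP; apply: measurable_funB => //; apply: measurable_cosf.
  by apply: measurable_funM => //; apply: measurableT_comp => //; exact: measurable_fst.
have F0 p : (0 <= F p)%E by rewrite lee_fin subr_ge0 cos_le1.
have eG th : (\int[P]_w F (w, th) = (1 - \int[P]_w cos (th * y w))%:E)%E.
  by rewrite /F/= E_fin ?EB ?E_cst//; [exact: bdm_cst|apply: bdmB => //; exact: bdm_cst].
have eF w : (\int[normal_prob 0 s]_th F (w, th) = (1 - expR (- (y w ^+ 2 * s ^+ 2 / 2)))%:E)%E.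
  rewrite /F/= E_fin; last exact: (bdmB (bdm_cst 1) (b1 w)).
  rewrite EB; [|exact: bdm_cst|exact: b1].
  rewrite E_cst; congr (1 - _)%:E.
  under eq_Rintegral do rewrite mulrC -[_ * _]addr0.
  by rewrite normal_cos// cos0 mul1r.
have b4 : bdm (fun th : R => \int[P]_w cos (th * y w)).
  apply: (@bdm_le _ _ _ _ 1); last by move=> th; apply: norm_E_cst => // w; exact: norm_cos_le1.
  have -> : (fun th : R => \int[P]_w cos (th * y w)) = (fun th => 1 - (1 - \int[P]_w cos (th * y w))).
    by apply/funext => th; rewrite subKr.
  apply: measurable_funB => //; apply/measurable_EFinP.
  have -> : EFin \o (fun th => 1 - \int[P]_w cos (th * y w)) = fubini_G P F.
    by apply/funext => th; rewrite /fubini_G eG.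
  exact: measurable_fun_fubini_tonelli_G.
split=> //.
have := @fubini_tonelli _ _ _ _ _ P (normal_prob 0 s) F mF F0.
under eq_integral do rewrite eF; under [in RHS]eq_integral do rewrite eG.
rewrite !E_fin; [|by apply: bdmB => //; exact: bdm_cst..].
rewrite !EB//; [|exact: bdm_cst..]; rewrite !E_cst => -[] /eqP.
by rewrite (inj_eq (addrI _)) (inj_eq oppr_inj) => /eqP ->.
Qed.

End normal_average.

Section tightness.
Context {R : realType} {d} {W : measurableType d} (P : probability W R).

Lemma cvg_natSinv : (n.+1%:R^-1 : R) @[n --> \oo] --> (0 : R).
Proof. exact: cvg_harmonic. Qed.

(* The average of [1 - E cos (th y_n)] over a normal law for [th] with small
   variance controls the tails of [y_n]. *)
Lemma chf_tight (y : nat -> W -> R) (v e : R) : (forall n, measurable_fun setT (y n)) ->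
  (forall th, \int[P]_w cos (th * y n w) @[n --> \oo] --> expR (- (th ^+ 2 * v / 2))) ->
  0 <= v -> 0 < e ->
  exists M : R, \forall n \near \oo, fine (P [set w | M < `|y n w|]) <= e.
Proof.
move=> my hy v0 e0.
(* A lower bound of [1 - exp (- y^2 s^2 / 2)] on the event [|y| > 1 / s]. *)
pose ka : R := 1 - expR (- (1 / 2)).
have ka0 : 0 < ka by rewrite subr_gt0 -[ltRHS]expR0 ltr_expR oppr_lt0; lra.
(* Using [v + 1] keeps the standard deviation nonzero, as [normal_cos] requires, and only weakens
   the lower bound [J s] for the limit. *)
pose et := Num.sqrt (v + 1).
have et0 : et != 0 by rewrite gt_eqF// sqrtr_gt0 ltr_wpDl.
have et2 : et ^+ 2 = v + 1 by rewrite sqr_sqrtr// addr_ge0.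
pose J (s : R) := \int[normal_prob 0 et]_x expR (- (x ^+ 2 * s ^+ 2 / 2)).
have bJ (s : R) : bdm (fun x : R => expR (- (x ^+ 2 * s ^+ 2 / 2))).
  by apply: bdm_gauss; rewrite ?sqr_ge0.
have J1 : J k.+1%:R^-1 @[k --> \oo] --> (1 : R).
  rewrite -[X in _ --> X](E_cst (normal_prob 0 et)); apply: (@cvg_E _ _ _ _ _ _ 1).
  - by move=> k; exact: (bJ _).1.
  - move=> k x; rewrite ger0_norm ?expR_ge0// -expR0 ler_expR oppr_le0.
    by rewrite divr_ge0// mulr_ge0 ?sqr_ge0.
  - move=> x; have : - (x ^+ 2 * k.+1%:R^-1 ^+ 2 / 2) @[k --> \oo] --> - (x ^+ 2 * (0 * 0) / 2 : R).
      apply: cvgN; apply: cvgM; last exact: cvg_cst.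
      by apply: cvgM; [exact: cvg_cst|apply: cvgM; exact: cvg_natSinv].
    by rewrite !mulr0 mul0r oppr0 => /(continuous_cvg _ (@continuous_expR R 0)); rewrite expR0.
have [k hk] : exists k : nat, 1 - ka * e / 2 < J k.+1%:R^-1.
  have : 1 - ka * e / 2 < 1 by rewrite ltrBlDr ltrDl divr_gt0// mulr_gt0.
  by move=> /(cvgr_gt _ J1)[k _ /(_ k (leqnn k))]; exists k.
pose s : R := k.+1%:R^-1; have s0 : s != 0 by rewrite invr_eq0 pnatr_eq0.
exists s^-1.
have lim1 : \int[P]_w expR (- (y n w ^+ 2 * s ^+ 2 / 2)) @[n --> \oo] -->
    \int[normal_prob 0 s]_th expR (- (th ^+ 2 * v / 2)).
  under eq_fun do rewrite -(integral_cos_normal P s0 (my _)).2.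
  apply: (@cvg_E _ _ _ _ _ _ 1) => [n|n th|th]; last exact: hy.
    exact: (integral_cos_normal P s0 (my n)).1.1.
  by apply: norm_E_cst => [|w]; [apply: bdm_cos; exact: measurable_funM|exact: norm_cos_le1].
(* Applied to a second normal law, the exchange of integrals turns [J s] into a mean of
   [exp (- th^2 (v + 1) / 2)] over the frequency [th]. *)
have ge1 : J s <= \int[normal_prob 0 s]_th expR (- (th ^+ 2 * v / 2)).
  have [b1] := integral_cos_normal (normal_prob 0 et) s0 (@measurable_id _ _ setT).
  have e1 (th : R) : \int[normal_prob 0 et]_x cos (th * x) = expR (- (th ^+ 2 * et ^+ 2 / 2)).
    under eq_Rintegral do rewrite -[_ * _]addr0.
    by rewrite normal_cos// cos0 mul1r.
  rewrite /J => <-; apply: le_E => //.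
    exact: bdm_gauss.
  move=> th; rewrite e1 et2 ler_expR lerN2 ler_pM2r ?invr_gt0//.
  by rewrite ler_wpM2l ?sqr_ge0// lerDl.
have near1 : \forall n \near \oo, 1 - ka * e < \int[P]_w expR (- (y n w ^+ 2 * s ^+ 2 / 2)).
  apply: (cvgr_gt _ lim1); apply: lt_le_trans ge1; apply: lt_trans hk.
  by rewrite ltrD2l ltrN2 ltr_pdivrMr// ltr_pMr ?mulr_gt0// ltr1n.
near=> n.
have mA : measurable [set w | s^-1 < `|y n w|].
  rewrite (_ : [set _ | _] = (fun w => `|y n w|) @^-1` `]s^-1, +oo[).
    rewrite -[X in measurable X]setTI.
    by apply: (measurableT_comp (@normr_measurable R setT) (my n)).
  by apply/seteqP; split=> w /=; rewrite in_itv/= andbT.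
have b1 : bdm (fun w => expR (- (y n w ^+ 2 * s ^+ 2 / 2))).
  by apply: bdm_gauss; rewrite ?sqr_ge0.
have b2 : bdm (\1_[set w | s^-1 < `|y n w|] : W -> R).
  by apply: (@bdm_le _ _ _ _ 1) => // w; rewrite indicE norm_natb_le1.
rewrite -(ler_pM2l ka0) -(E_indic _ mA) -EZ//.
apply: (@le_trans _ _ (1 - \int[P]_w expR (- (y n w ^+ 2 * s ^+ 2 / 2)))); last first.
  have : 1 - ka * e < \int[P]_w expR (- (y n w ^+ 2 * s ^+ 2 / 2)) by near: n.
  by move=> /ltW; rewrite lerBlDr addrC -lerBlDr.
rewrite -[X in _ <= X - _](E_cst P) -EB//; last exact: bdm_cst.
apply: le_E => [||w]; [exact: bdmZ|by apply: bdmB => //; exact: bdm_cst|].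
rewrite indicE; have [|_] := boolP (w \in _); last first.
  by rewrite mulr0 subr_ge0 -expR0 ler_expR oppr_le0 divr_ge0// mulr_ge0 ?sqr_ge0.
rewrite inE/= mulr1 lerD2l lerN2 ler_expR lerN2 ler_pM2r ?invr_gt0// => hw.
have sp : 0 < s by rewrite invr_gt0.
have : 1 <= `|y n w| * s by rewrite -ler_pdivrMr// div1r ltW.
by move=> h; rewrite -exprMn -(real_normK (num_real (_ * s))) normrM (gtr0_norm sp) exprn_ege1.
Unshelve. all: by end_near.
Qed.

End tightness.

Section chf_moments.
Context {R : realType} {d} {W : measurableType d} (P : probability W R).
Variables (y : W -> R) (v : R).
Hypothesis my : measurable_fun setT y.
Hypothesis v0 : 0 <= v.
Hypothesis hc : forall th, \int[P]_w cos (th * y w) = expR (- (th ^+ 2 * v / 2)).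
Hypothesis hs : forall th, \int[P]_w sin (th * y w) = 0.

(** Its mean is minus the second difference quotient at 0 of the real part of the characteristic
    function. It stays below the square of [y] and tends to it. *)
Let q (k : nat) w := 2 * k.+1%:R ^+ 2 * (1 - cos (k.+1%:R^-1 * y w)).

Let cvg_q w : q k w @[k --> \oo] --> y w ^+ 2.
Proof.
suff h : q k w - y w ^+ 2 @[k --> \oo] --> (0 : R) by apply/subr_cvg0.
apply/norm_cvg0P.
apply: (@squeeze_cvgr _ _ _ _ (fun=> 0) (fun k : nat => `|y w| ^+ 4 * k.+1%:R^-1)).
- apply: nearW => k; rewrite normr_ge0/= /q; set K : R := k.+1%:R; set u := K^-1 * y w.
  have K1 : 1 <= K by rewrite ler1n.
  have K0 : K != 0 by rewrite pnatr_eq0.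
  have := norm_cos_sub u.
  have -> : 2 * K ^+ 2 * (1 - cos u) - y w ^+ 2 = - (2 * K ^+ 2) * (cos u - 1 + u ^+ 2 / 2).
    by rewrite /u; field.
  have K20 : 0 <= 2 * K ^+ 2 by rewrite mulr_ge0 ?sqr_ge0.
  move=> h; rewrite mulNr normrN normrM (ger0_norm K20).
  apply: le_trans (ler_wpM2l K20 h) _; rewrite [leRHS]mulrC.
  have -> : 2 * K ^+ 2 * (`|u| ^+ 4 / 2) = K^-1 * (K^-1 * `|y w| ^+ 4).
    rewrite /u normrM (@ger0_norm _ K^-1) ?invr_ge0 ?(le_trans ler01)//; field => //.
  rewrite ler_wpM2l ?invr_ge0 ?(le_trans ler01)// ler_piMl ?exprn_ge0//.
  by rewrite invf_le1// (lt_le_trans ltr01).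
- exact: cvg_cst.
- rewrite -[X in _ --> X](mulr0 (`|y w| ^+ 4)).
  by apply: cvgM; [exact: cvg_cst|exact: cvg_natSinv].
Qed.

Let bq k : bdm (q k).
Proof.
apply: bdmZ; apply: bdmB; first exact: bdm_cst.
by apply: bdm_cos; exact: measurable_funM.
Qed.

Let q_bound k w : 0 <= q k w <= y w ^+ 2.
Proof.
have /andP[a b] := one_sub_cos_bound (k.+1%:R^-1 * y w).
rewrite mulr_ge0 ?mulr_ge0 ?sqr_ge0//=.
apply: le_trans (ler_wpM2l _ b) _; first by rewrite mulr_ge0// sqr_ge0.
have K0 : k.+1%:R != 0 :> R by rewrite pnatr_eq0.
by move: (k.+1%:R : R) K0 => K K0; rewrite le_eqVlt; apply/orP; left; apply/eqP; field.
Qed.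

Let Eq_cvg : \int[P]_w q k w @[k --> \oo] --> v.
Proof.
have e k : \int[P]_w q k w = 2 * k.+1%:R ^+ 2 * (1 - expR (- (k.+1%:R^-1 ^+ 2 * v / 2))).
  have bc : bdm (fun w => cos (k.+1%:R^-1 * y w)) by apply: bdm_cos; exact: measurable_funM.
  by rewrite EZ ?EB ?E_cst ?hc//; [exact: bdm_cst|apply: bdmB => //; exact: bdm_cst].
under eq_fun do rewrite e.
apply: (@squeeze_cvgr _ _ _ _ (fun k : nat => v - v ^+ 2 / 2 * k.+1%:R^-1) (fun=> v)).
- apply: nearW => k; set K : R := k.+1%:R; set u := K^-1 ^+ 2 * v / 2.
  have K1 : 1 <= K by rewrite ler1n.
  have K0 : K != 0 by rewrite pnatr_eq0.
  have u0 : 0 <= u by rewrite divr_ge0// mulr_ge0 ?sqr_ge0.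
  have /andP[a b] := expRN_bound u0.
  have Ku : 2 * K ^+ 2 * u = v by rewrite /u; field.
  have K20 : 0 <= 2 * K ^+ 2 by rewrite mulr_ge0 ?sqr_ge0.
  apply/andP; split; last by rewrite -[leRHS]Ku ler_wpM2l//; lra.
  apply: (@le_trans _ _ (2 * K ^+ 2 * (u - u ^+ 2))); last by rewrite ler_wpM2l//; lra.
  rewrite mulrBr Ku lerD2l lerN2.
  have -> : 2 * K ^+ 2 * u ^+ 2 = v ^+ 2 / 2 * (K^-1 * K^-1) by rewrite /u; field.
  rewrite ler_wpM2l ?divr_ge0 ?sqr_ge0// ler_piMl ?invr_ge0 ?(le_trans ler01)//.
  by rewrite invf_le1// (lt_le_trans ltr01).
- rewrite -[X in _ --> X]subr0 -[X in _ --> _ - X](mulr0 (v ^+ 2 / 2)).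
  by apply: cvgB; [exact: cvg_cst|apply: cvgM; [exact: cvg_cst|exact: cvg_natSinv]].
- exact: cvg_cst.
Qed.

(** Fatou along [q], as nothing is known yet about integrability of the square; once established,
    the square serves as dominating function in [chf_sqr]. *)
Lemma chf_sqr_integrable : P.-integrable setT (EFin \o (fun w => y w ^+ 2)).
Proof.
have m2 : measurable_fun setT (fun w => y w ^+ 2) by exact: measurable_funX.
apply/integrableP; split; first exact/measurable_EFinP.
apply: le_lt_trans (ltry v).
rewrite -[X in (X <= _)%E]/(\int[P]_w `|(y w ^+ 2)%R%:E|)%E.
have -> : (\int[P]_w `|(y w ^+ 2)%R%:E|)%E = (\int[P]_w limn_einf (fun k => (q k w)%:E))%E.
  apply: eq_integral => w _.
  have c : (q k w)%:E @[k --> \oo] --> (y w ^+ 2)%:E by apply: cvg_EFin; [exact: nearW|exact: cvg_q].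
  rewrite is_cvg_limn_einfE; last by apply/cvg_ex; exists (y w ^+ 2)%:E.
  by rewrite (cvg_lim _ c)//= ger0_norm// sqr_ge0.
have c : (\int[P]_w (q k w)%:E)%E @[k --> \oo] --> v%:E.
  under eq_fun do rewrite E_fin//.
  by apply: cvg_EFin; [exact: nearW|exact: Eq_cvg].
rewrite -(cvg_lim _ c)// -is_cvg_limn_einfE; last by apply/cvg_ex; exists v%:E.
apply: fatou => //.
- by move=> k; apply/measurable_EFinP; exact: (bq k).1.
- by move=> k w _; rewrite lee_fin; case/andP: (q_bound k w).
Qed.

Lemma chf_sqr : \int[P]_w y w ^+ 2 = v.
Proof.
have c : \int[P]_w q k w @[k --> \oo] --> \int[P]_w y w ^+ 2.
  apply: (cvg_Rintegral _ chf_sqr_integrable) => // [k|k w]; first exact: (bq k).1.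
  by have /andP[a b] := q_bound k w; rewrite ger0_norm.
exact: (cvg_unique _ c Eq_cvg).
Qed.

Lemma chf_integrable : P.-integrable setT (EFin \o y).
Proof.
have i1 := integrableD measurableT (finite_measure_integrable_cst P 1 measurableT) chf_sqr_integrable.
apply: le_integrable i1 => //; first exact/measurable_EFinP.
move=> w _; change (`|y w|%:E <= `|1 + y w ^+ 2|%:E)%E; rewrite lee_fin.
rewrite [leRHS]ger0_norm ?addr_ge0 ?sqr_ge0//.
have : 0 <= (`|y w| - 1) ^+ 2 by exact: sqr_ge0.
have := normr_ge0 (y w).
by rewrite -(real_normK (num_real (y w))) sqrrB; lra.
Qed.

(** The first-order analogue: [K sin (y / K)] has mean 0, tends to [y] and is dominated by [|y|]. *)
Lemma chf_mean : \int[P]_w y w = 0.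
Proof.
pose p (k : nat) w := k.+1%:R * sin (k.+1%:R^-1 * y w).
have bs k : bdm (fun w => sin (k.+1%:R^-1 * y w)) by apply: bdm_sin; exact: measurable_funM.
have c : \int[P]_w p k w @[k --> \oo] --> \int[P]_w y w.
  apply: (cvg_Rintegral _ (integrable_norm chf_integrable)) => [k|k w|w].
  - exact: (bdmZ _ (bs k)).1.
  - rewrite normrM ger0_norm//; apply: le_trans (ler_wpM2l _ (norm_sin_le _)) _ => //.
    by rewrite normrM ger0_norm ?invr_ge0// mulVKf// pnatr_eq0.
  - suff h : p k w - y w @[k --> \oo] --> (0 : R) by apply/subr_cvg0.
    apply/norm_cvg0P.
    apply: (@squeeze_cvgr _ _ _ _ (fun=> 0) (fun k : nat => `|y w| ^+ 3 * k.+1%:R^-1)).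
    + apply: nearW => k; rewrite normr_ge0/= /p; set K : R := k.+1%:R; set u := K^-1 * y w.
      have K1 : 1 <= K by rewrite ler1n.
      have K0 : K != 0 by rewrite pnatr_eq0.
      have h := norm_sin_sub u.
      have -> : K * sin u - y w = K * (sin u - u) by rewrite /u; field.
      rewrite normrM (ger0_norm (le_trans ler01 K1)).
      apply: le_trans (ler_wpM2l (le_trans ler01 K1) h) _; rewrite [leRHS]mulrC.
      have -> : K * (`|u| ^+ 3 / 2) = K^-1 * (K^-1 / 2 * `|y w| ^+ 3).
        by rewrite /u normrM (@ger0_norm _ K^-1) ?invr_ge0 ?(le_trans ler01)//; field.
      rewrite ler_wpM2l ?invr_ge0 ?(le_trans ler01)// ler_piMl ?exprn_ge0//.
      have : K^-1 <= 1 by rewrite invf_le1// (lt_le_trans ltr01).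
      by rewrite ler_pdivrMr// mul1r => /le_trans; apply; rewrite ler1n.
    + exact: cvg_cst.
    + rewrite -[X in _ --> X](mulr0 (`|y w| ^+ 3)).
      by apply: cvgM; [exact: cvg_cst|exact: cvg_natSinv].
have c2 : \int[P]_w p k w @[k --> \oo] --> (0 : R).
  by under eq_fun do rewrite EZ// hs mulr0; exact: cvg_cst.
exact: (cvg_unique _ c c2).
Qed.

(** Uniqueness for one coordinate gives equality on the half-lines [[c, +oo[], which are closed
    under intersection and generate the Borel sets. *)
Lemma chf_law (N : probability (measurableTypeR R) R) :
  (forall th b, \int[N]_x cos (th * x + b) = cos b * expR (- (th ^+ 2 * v / 2))) ->
  forall A : set R, measurable A -> P (y @^-1` A) = N A.
Proof.
move=> hN A mA.
have chf_eq (a : 'I_1 -> R) b :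
    \int[P]_w cos (dotp a (fun=> y w) + b) = \int[N]_x cos (dotp a (fun=> x) + b).
  have e x : dotp a (fun=> x) = a ord0 * x by rewrite /dotp big_ord1.
  under eq_Rintegral do rewrite e; under [RHS]eq_Rintegral do rewrite e; rewrite hN E_cosD ?hc ?hs ?mulr0 ?subr0//.
  exact: measurable_funM.
pose Y := @mfun_Sub _ _ W (measurableTypeR R) y (mem_set my).
have half c : P (y @^-1` `[c, +oo[%classic) = N `[c, +oo[%classic.
  have mid : measurable_fun [set: measurableTypeR R] (id : measurableTypeR R -> R) by [].
  have := chf_mult_E (fun=> my) (fun=> mid) chf_eq
    (chf_mult_ge P N (fun=> my) (fun=> mid) ord0 c).
  have e d' (V : measurableType d') (z : V -> R) : (fun w => (c <= z w)%R%:R) = \1_(z @^-1` `[c, +oo[) :> (V -> R).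
    by apply/funext => w; rewrite indicE; congr (nat_of_bool _)%:R;
      apply/idP/idP; rewrite inE/= in_itv/= andbT.
  have mc : measurable (`[c, +oo[%classic : set (measurableTypeR R)) by exact: measurable_itv.
  have my' : measurable (y @^-1` `[c, +oo[) by rewrite -[X in measurable X]setTI; exact: my.
  rewrite (e _ _ y) (e _ _ id) !E_indic// => h; move: (congr1 EFin h).
  by rewrite !fineK ?fin_num_measure.
rewrite -[LHS]/(distribution P Y A).
have u1 : (R.-ocitv.-measurable).-sigma.-measurable = <<s @RGenCInfty.G R >> by exact: RGenCInfty.measurableE.
have u2 : setI_closed (@RGenCInfty.G R).
  move=> _ _ [a ->] [b ->]; exists (Num.max a b).
  by apply/seteqP; split => x /=; rewrite !in_itv/= !andbT ge_max => /andP.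
have u3 (k : nat) : @RGenCInfty.G R `[- k%:R, +oo[%classic by exists (- k%:R).
have u4 : \bigcup_k (`[- k%:R, +oo[%classic : set R) = setT.
  apply/seteqP; split => // x _; exists (Num.bound `|x|) => //=.
  rewrite in_itv/= andbT lerNl ltW//; apply: le_lt_trans (archi_boundP (normr_ge0 x)).
  by rewrite -normrN ler_norm.
have u5 (B : set R) : RGenCInfty.G B -> distribution P Y B = N B by move=> [c ->]; exact: half.
have u6 (k : nat) : (distribution P Y `[(- k%:R)%R, +oo[%classic < +oo)%E.
  by rewrite (le_lt_trans (probability_le1 _ _))// ltry.
have h := @measure_unique _ R (measurableTypeR R) _ _ u1 u2 u3 u4 (distribution P Y) N.
refine (h u5 u6 A mA).
Qed.

Lemma chf_is_normal : is_normal P y.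
Proof.
exists 0, (Num.sqrt v) => A mA.
(* Zero variance has to be a Dirac mass at 0, in line with the case distinction in [is_normal]. *)
case: ifPn => [|s0].
  rewrite sqrtr_eq0 => vle0; have v_eq0 : v = 0 by apply: le_anti; rewrite vle0.
  apply: (chf_law (N := \d_(0 : measurableTypeR R))) => // th b.
  rewrite /Rintegral integral_dirac//=; last first.
    by apply/measurable_EFinP; apply: measurable_cosf; apply: measurable_funD => //; exact: measurable_funM.
  by rewrite indicT mul1r mulr0 add0r v_eq0 mulr0 mul0r oppr0 expR0 mulr1.
apply: (chf_law (N := normal_prob 0 (Num.sqrt v))) => // th b.
by rewrite normal_cos// sqr_sqrtr.
Qed.

End chf_moments.

(** * Gaussian limit processes *)

Section gaussian_limit.
Context {R : realType} (T : Type) (c : T -> T -> R).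

Definition quad k (t : 'I_k -> T) (a : 'I_k -> R) := \sum_i \sum_j a i * a j * c (t i) (t j).

Definition chf_cvg d (W : measurableType d) (P : probability W R) (z : nat -> T -> W -> R) :=
  forall k (t : 'I_k -> T) (a : 'I_k -> R),
    \int[P]_w cos (\sum_i a i * z n (t i) w) @[n --> \oo] --> expR (- (quad t a / 2)) /\
    \int[P]_w sin (\sum_i a i * z n (t i) w) @[n --> \oo] --> (0 : R).

Definition chf_gaussian d (W : measurableType d) (Q : probability W R) (G : T -> W -> R) :=
  forall k (t : 'I_k -> T) (a : 'I_k -> R),
    \int[Q]_w cos (\sum_i a i * G (t i) w) = expR (- (quad t a / 2)) /\
    \int[Q]_w sin (\sum_i a i * G (t i) w) = 0.

Lemma quadZ k (t : 'I_k -> T) (a : 'I_k -> R) th :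
  quad t (fun i => th * a i) = th ^+ 2 * quad t a.
Proof.
rewrite /quad mulr_sumr; apply: eq_bigr => i _; rewrite mulr_sumr.
by apply: eq_bigr => j _; ring.
Qed.

Lemma measurable_lin d (W : measurableType d) k (z : 'I_k -> W -> R) (a : 'I_k -> R) :
  (forall i, measurable_fun setT (z i)) -> measurable_fun setT (fun w => \sum_i a i * z i w).
Proof. by move=> mz; apply: measurable_sum => i; exact: measurable_funM. Qed.

Section process.
Context {d} {W : measurableType d} (Q : probability W R) (G : T -> W -> R).
Hypothesis mG : forall t, measurable_fun setT (G t).
Hypothesis hG : chf_gaussian Q G.

Let lin k (t : 'I_k -> T) (a : 'I_k -> R) w := \sum_i a i * G (t i) w.

Let mlin k (t : 'I_k -> T) (a : 'I_k -> R) : measurable_fun setT (lin t a).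
Proof. exact: measurable_lin. Qed.

Let linZ k (t : 'I_k -> T) (a : 'I_k -> R) th w : th * lin t a w = lin t (fun i => th * a i) w.
Proof. by rewrite /lin mulr_sumr; apply: eq_bigr => i _; rewrite mulrA. Qed.

(** Positive semidefiniteness of [c] on the index set comes for free: [exp (- quad / 2)] is a mean
    of cosines, hence at most 1. *)
Let quad_ge0 k (t : 'I_k -> T) (a : 'I_k -> R) : 0 <= quad t a.
Proof.
have [h _] := hG t a.
have : expR (- (quad t a / 2)) <= expR 0.
  rewrite -h expR0 -(E_cst Q 1); apply: le_E => [||w]; last exact: cos_le1.
    exact/bdm_cos/mlin.
  exact: bdm_cst.
by rewrite ler_expR oppr_le0; lra.
Qed.

Let lin_cos k (t : 'I_k -> T) (a : 'I_k -> R) th :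
  \int[Q]_w cos (th * lin t a w) = expR (- (th ^+ 2 * quad t a / 2)).
Proof. by under eq_Rintegral do rewrite linZ; rewrite (hG _ _).1 quadZ. Qed.

Let lin_sin k (t : 'I_k -> T) (a : 'I_k -> R) th : \int[Q]_w sin (th * lin t a w) = 0.
Proof. by under eq_Rintegral do rewrite linZ; exact: (hG _ _).2. Qed.

Let lin1 t w : G t w = lin (fun _ : 'I_1 => t) (fun=> 1) w.
Proof. by rewrite /lin big_ord1 mul1r. Qed.

Let lin2 t u : (fun w => G t w + G u w) =
  lin (fun i : 'I_2 => if i == ord0 then t else u) (fun=> 1).
Proof. by apply/funext => w; rewrite /lin !big_ord_recl big_ord0/= !mul1r addr0. Qed.

(** Covariances come by polarization from the second moment of [G t + G u]. This only yields
    [c t u + c u t], whence the symmetry assumption. *)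
Lemma chf_gaussian_process : (forall t u, c t u = c u t) ->
  centered_gaussian_process Q G c.
Proof.
move=> csym.
have int1 k (t : 'I_k -> T) a := chf_integrable (mlin t a) (quad_ge0 t a) (lin_cos t a).
have int2 k (t : 'I_k -> T) a := chf_sqr_integrable (mlin t a) (quad_ge0 t a) (lin_cos t a).
have sqr k (t : 'I_k -> T) a := chf_sqr (mlin t a) (quad_ge0 t a) (lin_cos t a).
have mean k (t : 'I_k -> T) a := chf_mean (mlin t a) (quad_ge0 t a) (lin_cos t a) (lin_sin t a).
have e1 t : G t = lin (fun _ : 'I_1 => t) (fun=> 1) by apply/funext => w; exact: lin1.
have i1 t : Q.-integrable setT (EFin \o G t) by rewrite e1; exact: int1.
have i2 t : Q.-integrable setT (EFin \o (fun w => G t w ^+ 2)).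
  by have := int2 _ (fun _ : 'I_1 => t) (fun=> 1); rewrite -e1.
have m0 t : 'E_Q[G t]%E = 0%E.
  rewrite unlock -[LHS]fineK ?integrable_fin_num//; last exact: i1.
  by have := mean _ (fun _ : 'I_1 => t) (fun=> 1); rewrite -e1 /Rintegral => ->.
split=> //.
  move=> k t a; apply: (chf_is_normal (mlin t a) (quad_ge0 t a)); [exact: lin_cos|exact: lin_sin].
move=> t u.
have s1 t' : \int[Q]_w (G t' w ^+ 2) = c t' t'.
  have := sqr _ (fun _ : 'I_1 => t') (fun=> 1); rewrite -e1 => ->.
  by rewrite /quad !big_ord1 !mul1r.
have s2 : \int[Q]_w ((G t w + G u w) ^+ 2) = c t t + c t u + (c u t + c u u).
  have := sqr _ (fun i : 'I_2 => if i == ord0 then t else u) (fun=> 1).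
  rewrite -lin2 => ->.
  by rewrite /quad !big_ord_recl !big_ord0/= !mul1r !addr0.
have i3 : Q.-integrable setT (EFin \o (fun w => (G t w + G u w) ^+ 2)).
  by have := int2 _ (fun i : 'I_2 => if i == ord0 then t else u) (fun=> 1); rewrite -lin2.
have i5 : Q.-integrable setT (EFin \o (fun w => G t w ^+ 2 + G u w ^+ 2)).
  exact: (integrableD measurableT (i2 t) (i2 u)).
have i4 : Q.-integrable setT (EFin \o (fun w => G t w * G u w)).
  apply: le_integrable i5 => //; first by apply/measurable_EFinP; exact: measurable_funM.
  move=> w _; change (`|G t w * G u w|%:E <= `|G t w ^+ 2 + G u w ^+ 2|%:E)%E; rewrite lee_fin.
  rewrite [leRHS]ger0_norm ?addr_ge0 ?sqr_ge0// normrM.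
  rewrite -(real_normK (num_real (G t w))) -(real_normK (num_real (G u w))).
  have : 0 <= (`|G t w| - `|G u w|) ^+ 2 by exact: sqr_ge0.
  have : 0 <= `|G t w| * `|G u w| by rewrite mulr_ge0.
  by rewrite sqrrB; lra.
rewrite covariance.unlock !m0 /=.
have -> : ((G t \- cst 0) * (G u \- cst 0))%R = (fun w => G t w * G u w).
  by apply/funext => w; rewrite /GRing.mul/= !subr0.
rewrite unlock -[LHS]fineK ?integrable_fin_num//; congr EFin.
rewrite -[LHS]/(\int[Q]_w (G t w * G u w)).
have : \int[Q]_w ((G t w + G u w) ^+ 2) =
    2 * \int[Q]_w (G t w * G u w) + (\int[Q]_w (G t w ^+ 2) + \int[Q]_w (G u w ^+ 2)).
  rewrite -RintegralD// -RintegralZl// -RintegralD//.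
    by apply: eq_Rintegral => w _; ring.
  exact: (integrableZl measurableT 2 i4).
rewrite s2 !s1 (csym u t); lra.
Qed.

End process.

Section limit.
Context {d} {W : measurableType d} (P : probability W R) (z : nat -> T -> W -> R).
Hypothesis mz : forall n t, measurable_fun setT (z n t).
Hypothesis hz : chf_cvg P z.

Lemma chf_cvg_tight t (e : R) : 0 < e -> exists M : R,
  \forall n \near \oo, fine (P [set w | M < `|z n t w|]) <= e.
Proof.
have e1 n w th : \sum_(i < 1) th * z n t w = th * z n t w by rewrite big_ord1.
have q1 th : quad (fun _ : 'I_1 => t) (fun=> th) = th ^+ 2 * c t t by rewrite /quad !big_ord1.
have hc th : \int[P]_w cos (th * z n t w) @[n --> \oo] --> expR (- (th ^+ 2 * c t t / 2)).
  have [h _] := hz (fun _ : 'I_1 => t) (fun=> th); rewrite q1 in h.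
  apply: cvg_trans h; apply: near_eq_cvg; apply: nearW => n.
  by apply: eq_Rintegral => w _; rewrite e1.
apply: (chf_tight (mz ^~ t) hc).
(* [chf_tight] needs [0 <= c t t]; it holds because means of cosines, hence their limit, are at most
   1. *)
have : expR (- (1 ^+ 2 * c t t / 2)) <= expR 0.
  apply: (cvg_ub (F := \oo) _ (hc 1)); apply: nearW => n; rewrite expR0.
  rewrite -(E_cst P 1); apply: le_E => [||w]; last exact: cos_le1.
    by apply: bdm_cos; exact: measurable_funM.
  exact: bdm_cst.
by rewrite ler_expR oppr_le0 expr1n; lra.
Qed.

Lemma loeb_chf_gaussian (U : set_system nat) (UU : UltraFilter U) (hU : \oo `<=` U) :
  chf_gaussian (loeb_measure (UU := UU) hU P) (@loeb_proc _ _ _ _ UU _ z).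
Proof.
move=> k t a; have cD : continuous (fun v : 'rV[R]_k => \sum_i a i * v ord0 i).
  move=> v; apply: (@cvg_sumr _ _ (nbhs v) (nbhs_filter v)) => i; apply: cvgM; first exact: cvg_cst.
  exact: coord_continuous.
have cvgU (f : R -> R) (M l : R) : continuous f -> (forall x, `|f x| <= M) ->
    \int[P]_w f (\sum_i a i * z n (t i) w) @[n --> \oo] --> l ->
    \int[loeb_measure hU P]_w f (\sum_i a i * @loeb_proc _ _ _ _ UU _ z (t i) w) = l.
  move=> cf fM hl.
  have cF : continuous (fun v : 'rV[R]_k => f (\sum_i a i * v ord0 i)).
    by move=> v; apply: (cvg_comp _ f (cD v)); exact: cf.
  have := cvg_loeb_proc (UU := UU) (hU := hU) mz chf_cvg_tight (t := t) cF (fun v => fM _).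
  have e V (y : T -> V -> R) : (fun w => f (\sum_i a i * (\row_i y (t i) w) ord0 i)) = (fun w => f (\sum_i a i * y (t i) w)).
    by apply/funext => w; congr f; apply: eq_bigr => i _; rewrite mxE.
  rewrite e; under eq_fun do rewrite e.
  by move=> h; apply: (cvg_unique _ h) => // A /hl; exact: hU.
have [h1 h2] := hz t a.
split; first exact: (cvgU cos 1 _ (@continuous_cos R) (@norm_cos_le1 R) h1).
exact: (cvgU sin 1 _ (@continuous_sin R) (@norm_sin_le1 R) h2).
Qed.

(** If convergence failed for some [f], the indices at distance at least [e] would form an infinite
    set [S]. For an ultrafilter containing [S] the Loeb process has the characteristic functions of
    [G], so the means converge along it to the right value, against the choice of [S]. *)
Lemma chf_gaussian_fidi_cvg d' (W' : measurableType d') (Q : probability W' R) (G : T -> W' -> R) :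
  (forall t, measurable_fun setT (G t)) -> chf_gaussian Q G -> fidi_cvg P z Q G.
Proof.
move=> mG hG k t f cf [M fM].
have bG : bdm (fun w => f (\row_i G (t i) w)) by apply: bdm_row fM => // i.
have bz n : bdm (fun w => f (\row_i z n (t i) w)) by apply: bdm_row fM => // i.
rewrite expectation_E//; under eq_fun do rewrite expectation_E//.
apply: cvg_EFin; first exact: nearW.
apply: contrapT => ncvg.
have [e e0 hS] : exists2 e : R, 0 < e & forall N : nat, exists2 n, (N <= n)%N &
    e <= `|\int[P]_w f (\row_i z n (t i) w) - \int[Q]_w f (\row_i G (t i) w)|.
  apply: contrapT => nex; apply: ncvg; apply/cvgrPdist_lt => e e0.
  apply: contrapT => hn; apply: nex; exists e => // N.
  apply: contrapT => h; apply: hn; exists N => // n /= Nn.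
  rewrite ltNge; apply/negP => le_e; apply: h; exists n => //.
  by rewrite distrC.
pose S := [set n | e <= `|\int[P]_w f (\row_i z n (t i) w) - \int[Q]_w f (\row_i G (t i) w)|].
have PF : ProperFilter (within S \oo).
  apply: Build_ProperFilter => -[N _ hN]; have [n Nn hn] := hS N.
  exact: (hN n).
have [U [UU SU]] := ultraFilterLemma PF.
have hU : \oo `<=` U.
  by move=> A hA; apply: SU; apply: filterS hA.
have US : U S by apply: SU; exists 0%N.
have hL := loeb_chf_gaussian UU hU.
have mL s : measurable_fun setT (@loeb_proc _ _ _ _ UU _ z s) by exact: measurable_loeb_proc.
have := cvg_loeb_proc (UU := UU) (hU := hU) mz chf_cvg_tight (t := t) cf fM.
have -> : \int[loeb_measure hU P]_w f (\row_i @loeb_proc _ _ _ _ UU _ z (t i) w) = \int[Q]_w f (\row_i G (t i) w).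
  have mL' i := mL (t i); have mG' i := mG (t i).
  apply: (chf_mult_E mL' mG' _ (chf_mult_continuous _ _ mL' mG' cf fM)) => a b.
  have e1 d1 (V : measurableType d1) (N : probability V R) (y : T -> V -> R) :
      (forall t, measurable_fun setT (y t)) -> chf_gaussian N y ->
      \int[N]_w cos (dotp a (fun i => y (t i) w) + b) = cos b * expR (- (quad t a / 2)).
    move=> my hy; have [h1 h2] := hy _ t a; rewrite /dotp E_cosD ?h1 ?h2 ?mulr0 ?subr0//.
    exact: measurable_lin.
  by rewrite !e1.
move=> /cvgr_dist_lt /(_ _ e0) hd.
apply: (ultra_absurd UU US); apply: filterS hd => n /= hn.
by rewrite /S/= distrC => /(lt_le_trans hn); rewrite ltxx.
Qed.

End limit.

(** One ultrafilter refining [\oo] is enough, since [chf_cvg] already fixes the characteristic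
    functions of the resulting process. *)
Theorem gaussian_limit_exists d (W : measurableType d) (P : probability W R) (z : nat -> T -> W -> R) :
  (forall t u, c t u = c u t) ->
  (forall n t, measurable_fun setT (z n t)) -> chf_cvg P z ->
  exists d' (W' : measurableType d') (Q : probability W' R) (G : T -> {RV Q >-> R}),
    centered_gaussian_process Q (fun t => G t) c /\ chf_gaussian Q (fun t => G t).
Proof.
move=> csym mz hz.
have [U [UU hU]] := ultraFilterLemma (F := \oo) _.
have hL := loeb_chf_gaussian mz hz UU hU.
have mL s : measurable_fun setT (@loeb_proc _ _ _ _ UU _ z s) by exact: measurable_loeb_proc.
exists _, _, (loeb_measure hU P), (fun s => mfun_Sub (mem_set (mL s))).
by split=> //; exact: chf_gaussian_process.
Qed.

End gaussian_limit.

(** * Sums over sliding windows *)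

Section windows.
Context {R : realType} {E : completeNormedModType R}.

(** Observations are numbered from 1, hence the successor; [o] counts the windows skipped. The
    domain [U] is arbitrary so that the same sum can be read on [Omega], on a coarser sigma-field or
    on tuples. *)
Definition window_sum {U : Type} (h : seq E -> R) (x : nat -> U -> E) s o len (w : U) :=
  \sum_(j < len) h [seq x i w | i <- iota (o + j).+1 s].

Lemma measurable_window d (U : measurableType d) (x : nat -> U -> borel E)
    (h : seq E -> R) j s : measurable_functional h ->
  (forall i, (j <= i < j + s)%N -> measurable_fun setT (x i)) ->
  measurable_fun setT (fun w => h [seq (x i w : E) | i <- iota j s]).
Proof.
move=> mh mx.
have -> : (fun w => h [seq (x i w : E) | i <- iota j s]) =
    (fun z : s.-tuple (borel E) => h z) \o (fun w => [tuple x (j + i)%N w | i < s]).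
  apply/funext => w /=; congr h.
  have -> : iota j s = map (addn j) (iota 0 s) by rewrite -iotaDl addn0.
  by rewrite -val_enum_ord -!map_comp.
apply: measurableT_comp; first exact: mh.
apply/measurable_fun_tnthP => i.
rewrite (_ : _ \o _ = x (j + i)%N); last by apply/funext => w /=; rewrite tnth_mktuple.
by apply: mx; rewrite leq_addr ltn_add2l/=.
Qed.

Lemma measurable_window_sum d (U : measurableType d) (x : nat -> U -> borel E)
    (h : seq E -> R) s o len : measurable_functional h ->
  (forall i, (o < i < o + len + s)%N -> measurable_fun setT (x i)) ->
  measurable_fun setT (window_sum h x s o len).
Proof.
move=> mh mx; apply: measurable_sum => j; apply: measurable_window => // i /andP[a b].
apply: mx; rewrite (leq_trans _ a) ?ltnS ?leq_addr//=; apply: leq_trans b _.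
by rewrite -addnS leq_add2r leq_add2l.
Qed.

End windows.

(** * Stationarity and mixing within one row *)

Section row.
Context {R : realType} {E : completeNormedModType R}
  {d} {Omega : measurableType d} (P : probability Omega R)
  (X : nat -> nat -> {RV P >-> borel E}) (n : nat).

Let gens i j := \bigcup_(l in [set l | (i <= l <= j)%N])
  preimage_set_system setT (X n l) measurable.

Lemma row_sigma_measurable i j : row_sigma X n i j `<=` measurable.
Proof.
apply: sub_sigma_measurable => _ [l _ [B mB <-]].
exact: (@measurable_funPT _ _ _ _ (X n l)).
Qed.

Lemma adapted_row_sigma i j (f : Omega -> R) :
  measurable_fun (setT : set (g_sigma_algebraType (gens i j))) f ->
  adapted (row_sigma X n i j) f.
Proof. by move=> mf S mS; have := mf measurableT S mS; rewrite setTI. Qed.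

Lemma measurable_row_gens i j l : (i <= l <= j)%N ->
  measurable_fun (setT : set (g_sigma_algebraType (gens i j))) (X n l : Omega -> borel E).
Proof.
move=> ilj _ B mB; apply: sub_sigma_algebra; exists l => //.
by exists B.
Qed.

(** A real [sup] is an upper bound only when the set is bounded above; here [abs_regularity_le1]
    provides the bound 1. *)
Lemma beta_mixing_alpha l k A B : (1 <= l)%N -> (l + k + 1 <= n)%N ->
  row_sigma X n 1 l A -> row_sigma X n (l + k + 1) n B ->
  `|fine (P (A `&` B)) - fine (P A) * fine (P B)| <= beta_mixing X n k.
Proof.
move=> l1 lkn hA hB.
have hG i j : gens i j `<=` measurable.
  by move=> C hC; apply: (row_sigma_measurable (i := i) (j := j)); exact: sub_sigma_algebra.
have mH i j := @row_sigma_measurable i j.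
have h1 := alpha_le_abs_regularity P (hG 1%N l) (@mH (l + k + 1)%N n) hA hB.
apply: le_trans h1 _; apply: sup_upper_bound; last by exists l => //=; rewrite l1.
split; first by exists (abs_regularity P (row_sigma X n 1 l) (row_sigma X n (l + k + 1) n)), l => //=; rewrite l1.
exists 1 => _ [l' /= _ <-].
have ne : row_sigma X n (l' + k + 1) n !=set0 by exists set0; exact: sigma_algebra0.
by have /andP[] := abs_regularity_le1 P (hG 1%N l') (@mH (l' + k + 1)%N n) ne.
Qed.

Lemma beta_mixing_ge0 k : 0 <= beta_mixing X n k.
Proof.
have [[l /andP[l1 lkn]]|h] := pselect (exists l, (1 <= l)%N && (l + k + 1 <= n)%N).
  have s0 i j : row_sigma X n i j set0 by exact: sigma_algebra0.
  exact: le_trans (normr_ge0 _) (beta_mixing_alpha l1 lkn (s0 _ _) (s0 _ _)).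
rewrite /beta_mixing (_ : [set _ | _ in _] = set0) ?sup0//.
by apply/seteqP; split => // v [l hl _]; apply: h; exists l.
Qed.

Hypothesis X_stat : row_stationary X n.

(** [F] reads only the coordinates [1] to [k], so both integrals are integrals of one function
    against the law of a [k]-tuple; [i.-1] translates to tuple positions counted from 0. *)
Lemma stationary_E (F : (nat -> E) -> R) (k h : nat) :
  measurable_fun setT (fun z : k.-tuple (borel E) => F (fun i => nth (0 : E) z i.-1)) ->
  (exists M, forall x, `|F x| <= M) ->
  (forall x y, (forall i, (0 < i <= k)%N -> x i = y i) -> F x = F y) ->
  (h + k <= n)%N ->
  \int[P]_w F (fun i => X n (h + i)%N w) = \int[P]_w F (X n ^~ w).
Proof.
move=> mF [M FM] loc hk.
pose tu h0 (w : Omega) : k.-tuple (borel E) := [tuple X n (h0 + i.+1)%N w | i < k].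
have mtu h0 : measurable_fun setT (tu h0).
  apply/measurable_fun_tnthP => i.
  by rewrite (_ : _ \o _ = X n (h0 + i.+1)%N)//; apply/funext => w /=; rewrite tnth_mktuple.
pose G (z : k.-tuple (borel E)) := F (fun i => nth (0 : E) z i.-1).
have FG h0 w : F (fun i => X n (h0 + i)%N w) = G (tu h0 w).
  apply: loc => -[//|i] /= ik.
  by rewrite (nth_map (Ordinal ik)) ?size_enum_ord// nth_enum_ord.
have GE h0 : \int[P]_w F (fun i => X n (h0 + i)%N w) =
    \int[distribution P (mfun_Sub (mem_set (mtu h0)))]_z G z.
  have mG' : measurable_fun setT (EFin \o G) by exact/measurable_EFinP.
  have bG : bdm (fun w => G (tu h0 w)).
    split; last by exists M => w; exact: FM.
    by have := measurableT_comp mF (mtu h0).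
  rewrite /Rintegral (integral_distribution (X := mfun_Sub (mem_set (mtu h0))) mG'); last first.
    exact: bdm_integrable bG.
  by congr fine; apply: eq_integral => w _; rewrite FG.
rewrite GE (_ : \int[P]_w F (X n ^~ w) = \int[P]_w F (fun i => X n (0 + i)%N w))// GE.
rewrite /Rintegral; congr fine.
apply: eq_measure_integral => A mA _.
have hA := X_stat hk mA.
by rewrite /distribution/pushforward/=; exact: hA.
Qed.

Section functional.
Variables (h : seq E -> R) (ka : R) (s : nat).
Hypothesis mh : measurable_functional h.
Hypothesis h_ka : forall x, `|h x| <= ka.
Hypothesis s_gt0 : (0 < s)%N.
Notation ws := (window_sum h (X n : nat -> Omega -> E) s).

Lemma norm_window_sum U (x : nat -> U -> E) o len w : `|window_sum h x s o len w| <= len%:R * ka.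
Proof.
apply: le_trans (ler_norm_sum _ _ _) _.
rewrite -[in leRHS](card_ord len) mulr_natl -sumr_const.
by apply: ler_sum => j _.
Qed.

Lemma measurable_ws o len : measurable_fun setT (ws o len).
Proof. exact: (measurable_window_sum (x := X n : nat -> Omega -> borel E)). Qed.

Lemma bdm_ws o len : bdm (ws o len).
Proof. by apply: bdm_le (measurable_ws o len) _ => w; exact: norm_window_sum. Qed.

(** [len] windows of length [s] read [len + s - 1] observations. A bound on [phi] is demanded only
    on the range of the sum, so that squares are allowed. *)
Lemma window_sum_stationary (phi : R -> R) o len : measurable_fun setT phi ->
  (exists M, forall u, `|u| <= len%:R * ka -> `|phi u| <= M) ->
  (o + len + s <= n.+1)%N ->
  \int[P]_w phi (ws o len w) = \int[P]_w phi (ws 0 len w).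
Proof.
move=> mphi [M hM] hn.
pose F (x : nat -> E) := phi (window_sum h (fun i (_ : unit) => x i) s 0 len tt).
have eF o' w : phi (ws o' len w) = F (fun i => X n (o' + i)%N w).
  rewrite /F; congr phi; apply: eq_bigr => j _; congr h.
  by rewrite -addnS add0n (iotaDl o' j.+1 s) -map_comp.
transitivity (\int[P]_w F (fun i => X n (o + i)%N w)).
  by apply: eq_Rintegral => w _; exact: eF.
transitivity (\int[P]_w F (fun i => X n i w)); last first.
  by apply: eq_Rintegral => w _; rewrite (eF 0%N).
apply: (@stationary_E F (len + s).-1).
- apply: (measurableT_comp mphi).
  pose x i (z : (len + s).-1.-tuple (borel E)) : borel E := nth (0 : E) z i.-1.
  rewrite (_ : (fun _ => _) = window_sum h x s 0 len)//.
  apply: measurable_window_sum => // i /andP[i0 ils].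
  have il : (i.-1 < (len + s).-1)%N by lia.
  rewrite (_ : x i = (fun z => tnth z (Ordinal il))); first exact: measurable_tnth.
  by apply/funext => z; rewrite (tnth_nth (0 : E)).
- by exists M => x; apply: hM; exact: norm_window_sum.
- move=> x y xy; congr phi; apply: eq_bigr => j _; congr h.
  apply/eq_in_map => i; rewrite mem_iota => /andP[a b]; apply: xy.
  by have := ltn_ord j; lia.
- by lia.
Qed.

Definition wmean := \int[P]_w h [seq (X n i w : E) | i <- iota 1 s].

Lemma E_ws o len : (o + len + s <= n.+1)%N -> \int[P]_w ws o len w = len%:R * wmean.
Proof.
move=> hn; rewrite /window_sum.
have b j : bdm (fun w => h [seq (X n i w : E) | i <- iota j s]).
  by apply: (@bdm_le _ _ _ _ ka) => //; exact: (measurable_window (x := X n : nat -> Omega -> borel E)).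
rewrite E_sum// (eq_bigr (fun=> wmean)) ?sumr_const ?card_ord ?mulr_natl// => j _.
have e o' : (fun w => ws o' 1 w) = (fun w => h [seq (X n i w : E) | i <- iota o'.+1 s]).
  by apply/funext => w; rewrite /window_sum big_ord1 addn0.
have := @window_sum_stationary id (o + j) 1 (@measurable_id _ _ setT) _ _.
rewrite e e => ->//; last by have := ltn_ord j; lia.
by exists (1%:R * ka).
Qed.

(** Three choices of [(o, len)] matter: the whole block [(0, r)], its kept part [(0, r - l)] and its
    dropped part [(r - l, l)]. *)
Definition cblock r o len i (w : Omega) := ws (i * r + o) len w - len%:R * wmean.

Variables (r l m : nat).
Hypotheses (s_le_l : (s <= l)%N) (l_le_r : (l + l <= r)%N) (mrn : (m * r + s <= n.+1)%N).

Section block.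
Variables (o len : nat).
Hypotheses (ol : (o + len <= r)%N) (len_gt0 : (0 < len)%N) (len_l : (len + l <= r)%N).

Let iol i : (i < m)%N -> (i * r + o + len + s <= n.+1)%N.
Proof.
move=> im; apply: leq_trans mrn; rewrite leq_add2r -addnA.
by apply: leq_trans (leq_add (leqnn _) ol) _; rewrite addnC -mulSn leq_mul2r im orbT.
Qed.

Lemma measurable_cblock i : measurable_fun setT (cblock r o len i).
Proof. by apply: measurable_funB => //; exact: measurable_ws. Qed.

Lemma cblock_stationary (phi : R -> R) i : (i < m)%N -> measurable_fun setT phi ->
  (exists M, forall u, `|u| <= len%:R * ka + `|len%:R * wmean| -> `|phi u| <= M) ->
  \int[P]_w phi (cblock r o len i w) = \int[P]_w phi (cblock r o len 0 w).
Proof.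
move=> im mphi [M hM].
have mphi' : measurable_fun setT (fun u : R => phi (u - len%:R * wmean)).
  by apply: (measurableT_comp mphi); exact: measurable_funB.
have bd : exists M, forall u, `|u| <= len%:R * ka -> `|phi (u - len%:R * wmean)| <= M.
  by exists M => u hu; apply: hM; rewrite (le_trans (ler_normB _ _))// lerD2r.
have st i' := window_sum_stationary (o := (i' * r + o)%N) mphi' bd.
have m0 : (0 < m)%N by exact: leq_ltn_trans im.
by rewrite (st i (iol im)) (st 0%N (iol m0)).
Qed.

Lemma cblock_E0 i : (i < m)%N -> \int[P]_w cblock r o len i w = 0.
Proof.
move=> im; rewrite EB ?E_cst ?E_ws ?subrr//; [exact: iol|exact: bdm_ws|exact: bdm_cst].
Qed.

Lemma cblock_near_indep (p q : R -> R) i : (i < m)%N ->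
  measurable_fun setT p -> measurable_fun setT q ->
  (forall u, `|p u| <= 1) -> (forall u, `|q u| <= 1) ->
  `|\int[P]_w (p (\sum_(j < i) cblock r o len j w) * q (cblock r o len i w)) -
    (\int[P]_w p (\sum_(j < i) cblock r o len j w)) * \int[P]_w q (cblock r o len i w)|
  <= 4 * beta_mixing X n (l - s).
Proof.
move=> im mp mq p1 q1; case: i im => [|i] im.
  under eq_Rintegral do rewrite big_ord0.
  under [X in _ - X * _]eq_Rintegral do rewrite big_ord0.
  rewrite EZ ?E_cst ?subrr ?normr0 ?mulr_ge0 ?beta_mixing_ge0//.
  by split; [exact: measurableT_comp (measurable_cblock 0)|exists 1].
(* The present part begins at observation [i.+1 * r + o + 1], so exactly [l - s] observations
   separate it from [L]. By [len + l <= r] all earlier parts end at [L] or before. *)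
pose L := (i.+1 * r + o - (l - s))%N.
have L1 : (1 <= L)%N by rewrite /L mulSn; lia.
have Ln : (L + (l - s) + 1 <= n)%N by have := iol im; rewrite /L mulSn; lia.
apply: (@alpha_cov _ _ _ P (row_sigma X n 1 L) (row_sigma X n (L + (l - s) + 1) n)) => //.
- exact: row_sigma_measurable.
- exact: row_sigma_measurable.
- by move=> a b; exact: beta_mixing_alpha.
- apply: adapted_row_sigma; apply: (measurableT_comp mp).
  apply: measurable_sum => j; apply: measurable_funB => //.
  apply: (@measurable_window_sum R E _ (g_sigma_algebraType (gens 1%N L)) (X n : nat -> Omega -> borel E) h) => // k /andP[k1 k2].
  apply: measurable_row_gens; have := ltn_ord j; have : (j * r <= i * r)%N by rewrite leq_mul2r -ltnS ltn_ord orbT.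
  by rewrite /L mulSn; lia.
- apply: adapted_row_sigma; apply: (measurableT_comp mq).
  apply: measurable_funB => //.
  apply: (@measurable_window_sum R E _ (g_sigma_algebraType (gens (L + (l - s) + 1)%N n)) (X n : nat -> Omega -> borel E) h) => // k /andP[k1 k2].
  by apply: measurable_row_gens; have := iol im; rewrite /L mulSn; lia.
Qed.

End block.

End functional.

End row.

(** * Perturbations *)

Section sums.
Context {R : realType}.

Lemma sqr_sum_le k (u : 'I_k -> R) : (\sum_i u i) ^+ 2 <= k%:R * \sum_i u i ^+ 2.
Proof.
rewrite expr2 big_distrl/=.
apply: (@le_trans _ _ (\sum_(i < k) \sum_(j < k) (u i ^+ 2 / 2 + u j ^+ 2 / 2))).
  apply: ler_sum => i _; rewrite big_distrr/=; apply: ler_sum => j _.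
  have : 0 <= (u i - u j) ^+ 2 by exact: sqr_ge0.
  by rewrite sqrrB; lra.
rewrite le_eqVlt; apply/orP; left; apply/eqP.
transitivity (\sum_(i < k) (k%:R * (u i ^+ 2 / 2) + (\sum_j u j ^+ 2) / 2)).
  by apply: eq_bigr => i _; rewrite big_split/= sumr_const card_ord mulr_natl -mulr_suml.
rewrite big_split/= sumr_const card_ord -mulr_sumr -mulr_suml -[X in _ + X]mulr_natl; field => //.
Qed.

Lemma sum_sqr_le (I : Type) (q : seq I) (u : I -> R) : (forall i, 0 <= u i) ->
  \sum_(i <- q) u i ^+ 2 <= (\sum_(i <- q) u i) ^+ 2.
Proof.
move=> u0; elim: q => [|i q IH]; first by rewrite !big_nil expr0n.
rewrite !big_cons sqrrD.
have : 0 <= u i * \sum_(j <- q) u j by rewrite mulr_ge0// sumr_ge0.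
by move: IH; lra.
Qed.

Lemma norm_cosB (x y : R) : `|cos x - cos y| <= `|x - y|.
Proof.
have := @mvt0 R (fun u => cos (y + u) - cos y) (fun u => - sin (y + u)) (x - y) 1.
rewrite subrKC mul1r; apply.
- by move=> u; apply: is_derive_eq; rewrite /GRing.scale/=; ring.
- by rewrite addr0 subrr.
- by move=> u _; rewrite normrN norm_sin_le1.
Qed.

Lemma norm_sinB (x y : R) : `|sin x - sin y| <= `|x - y|.
Proof.
have := @mvt0 R (fun u => sin (y + u) - sin y) (fun u => cos (y + u)) (x - y) 1.
rewrite subrKC mul1r; apply.
- by move=> u; apply: is_derive_eq; rewrite /GRing.scale/=; ring.
- by rewrite addr0 subrr.
- by move=> u _; rewrite norm_cos_le1.
Qed.

(* AM-GM with weight [Num.sqrt (B n) + n.+1%:R^-1]. *)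
Lemma cvg_perturb (A B C : nat -> R) (si : R) :
  A n @[n --> \oo] --> si -> B n @[n --> \oo] --> (0 : R) -> (forall n, 0 <= B n) ->
  (\forall n \near \oo, forall la : R, 0 < la ->
    `|C n - A n| <= la * A n + (1 + la^-1) * B n) ->
  C n @[n --> \oo] --> si.
Proof.
move=> hA hB B0 hC.
pose la n := Num.sqrt (B n) + n.+1%:R^-1.
have la0 n : 0 < la n by rewrite ltr_wpDl ?sqrtr_ge0 ?invr_gt0.
have cs : Num.sqrt (B n) @[n --> \oo] --> (0 : R).
  by rewrite -[X in _ --> X]sqrtr0; apply: (cvg_comp _ _ hB); exact: sqrt_continuous.
have cla : la n @[n --> \oo] --> (0 : R).
  by rewrite -[X in _ --> X]addr0; apply: cvgD => //; exact: cvg_natSinv.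
suff h : C n - A n @[n --> \oo] --> (0 : R).
  rewrite -[si]add0r (_ : C = (fun n => (C n - A n) + A n)); first exact: cvgD.
  by apply/funext => n; rewrite subrK.
apply/norm_cvg0P.
apply: (@squeeze_cvgr _ _ _ _ (fun=> 0) (fun n => la n * A n + (B n + Num.sqrt (B n)))).
- apply: filterS hC => n hn; rewrite normr_ge0/=; apply: le_trans (hn _ (la0 n)) _.
  rewrite lerD2l mulrDl mul1r lerD2l mulrC ler_pdivrMr//.
  rewrite -{1}(sqr_sqrtr (B0 n)) expr2 ler_wpM2l ?sqrtr_ge0//.
  by rewrite lerDl invr_ge0.
- exact: cvg_cst.
- rewrite -[X in _ --> X]addr0; apply: cvgD; last by rewrite -[X in _ --> X]addr0; exact: cvgD.
  by rewrite -[X in _ --> X](mul0r si); exact: cvgM.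
Qed.

End sums.

Section moments.
Context {R : realType} {d} {W : measurableType d} (P : probability W R).
Notation E f := (\int[P]_w f w).

Lemma sqr_E_le (f : W -> R) : bdm f -> (E f) ^+ 2 <= E (fun w => f w ^+ 2).
Proof.
move=> bf; have b1 := bdmX 2 bf.
have : 0 <= E (fun w => (f w - E f) ^+ 2) by apply: E_ge0 => w; exact: sqr_ge0.
have -> : (fun w => (f w - E f) ^+ 2) = (fun w => (f w ^+ 2 - (2 * E f) * f w) + (E f) ^+ 2).
  by apply/funext => w; ring.
have b2 : bdm (fun w => (2 * E f) * f w) by exact: bdmZ.
rewrite ED; [|exact: bdmB|exact: bdm_cst].
by rewrite EB// EZ// E_cst; lra.
Qed.

Lemma variance_le (f : W -> R) : bdm f ->
  E (fun w => (f w - E f) ^+ 2) <= E (fun w => f w ^+ 2).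
Proof.
move=> bf; have b1 := bdmX 2 bf.
have -> : (fun w => (f w - E f) ^+ 2) = (fun w => (f w ^+ 2 - (2 * E f) * f w) + (E f) ^+ 2).
  by apply/funext => w; ring.
have b2 : bdm (fun w => (2 * E f) * f w) by exact: bdmZ.
rewrite ED; [|exact: bdmB|exact: bdm_cst].
rewrite EB// EZ// E_cst.
by have := sqr_ge0 (E f); lra.
Qed.

(* A negligible summand may be dropped inside a characteristic function. *)
Lemma chf_perturb (x y : W -> R) : measurable_fun setT x -> measurable_fun setT y ->
  let de := 1 - E (fun w => cos (y w)) in
  `|E (fun w => cos (x w + y w)) - E (fun w => cos (x w))| <= de + Num.sqrt (2 * de) /\
  `|E (fun w => sin (x w + y w)) - E (fun w => sin (x w))| <= de + Num.sqrt (2 * de).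
Proof.
move=> mx my de.
have bc := bdm_cos my; have bs := bdm_sin my.
have bcx := bdm_cos mx; have bsx := bdm_sin mx.
have mxy : measurable_fun setT (fun w => x w + y w) by exact: measurable_funD.
have b1 : bdm (fun w => 1 - cos (y w)) by apply: bdmB => //; exact: bdm_cst.
have e1 : E (fun w => 1 - cos (y w)) = de by rewrite EB ?E_cst//; exact: bdm_cst.
(* Cauchy-Schwarz together with [sin^2 = 1 - cos^2 <= 2 (1 - cos)]. *)
have e2 : E (fun w => `|sin (y w)|) <= Num.sqrt (2 * de).
  rewrite -(ger0_norm (E_ge0 P _)) => [|w]; last exact: normr_ge0.
  rewrite -sqrtr_sqr ler_wsqrtr//; apply: le_trans (sqr_E_le (bdm_norm bs)) _.
  rewrite -e1 -EZ//; apply: le_E; [exact/bdmX/bdm_norm|exact: bdmZ|move=> w].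
  rewrite real_normK ?num_real// sin2cos2.
  have := cos_geN1 (y w); have := cos_le1 (y w) => c1 c2.
  have : 0 <= (1 - cos (y w)) ^+ 2 by exact: sqr_ge0.
  by rewrite sqrrB; lra.
have key (f : W -> R) : bdm f -> (forall w, `|f w| <= (1 - cos (y w)) + `|sin (y w)|) ->
    `|E f| <= de + Num.sqrt (2 * de).
  move=> bf hf; apply: le_trans (norm_E_le P bf _ hf) _.
    by apply: bdmD => //; exact: bdm_norm.
  by rewrite ED ?e1 ?lerD2l//; exact: bdm_norm.
have c1 w : 0 <= 1 - cos (y w) by rewrite subr_ge0 cos_le1.
have n1 (u v : R) : `|u| <= 1 -> `|u * v| <= `|v| by move=> hu; rewrite normrM ler_piMl.
split.
- rewrite -EB//; last exact: bdm_cos.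
  apply: key => [|w]; first by apply: bdmB => //; exact: bdm_cos.
  rewrite cosD (_ : _ - _ = cos (x w) * (cos (y w) - 1) - sin (x w) * sin (y w)); last by ring.
  apply: le_trans (ler_normB _ _) (lerD _ _); last exact/n1/norm_sin_le1.
  by apply: le_trans (n1 _ _ (norm_cos_le1 _)) _; rewrite distrC ger0_norm.
- rewrite -EB//; last exact: bdm_sin.
  apply: key => [|w]; first by apply: bdmB => //; exact: bdm_sin.
  rewrite sinD (_ : _ - _ = sin (x w) * (cos (y w) - 1) + cos (x w) * sin (y w)); last by ring.
  apply: le_trans (ler_normD _ _) (lerD _ _); last exact/n1/norm_cos_le1.
  by apply: le_trans (n1 _ _ (norm_sin_le1 _)) _; rewrite distrC ger0_norm.
Qed.

(** The cross term [2 x y] is split by AM-GM with a weight [la] left free, so that [cvg_perturb] can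
    let it tend to 0. *)
Lemma sqr_perturb (x y : W -> R) (la : R) : bdm x -> bdm y -> 0 < la ->
  `|E (fun w => (x w - y w) ^+ 2) - E (fun w => x w ^+ 2)| <=
  la * E (fun w => x w ^+ 2) + (1 + la^-1) * E (fun w => y w ^+ 2).
Proof.
move=> bx by_ la0; have bx2 := bdmX 2 bx; have by2 := bdmX 2 by_.
have bxy := bdmX 2 (bdmB bx by_).
rewrite -EB// -!EZ// -ED; [|exact: bdmZ..].
apply: norm_E_le; [exact: bdmB|by apply: bdmD; exact: bdmZ|move=> w].
have -> : (x w - y w) ^+ 2 - x w ^+ 2 = y w ^+ 2 - 2 * x w * y w by ring.
apply: le_trans (ler_normB _ _) _.
rewrite (ger0_norm (sqr_ge0 _)).
have : 0 <= (la * `|x w| - `|y w|) ^+ 2 / la by rewrite divr_ge0 ?sqr_ge0 ?ltW.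
have -> : (la * `|x w| - `|y w|) ^+ 2 / la =
    la * `|x w| ^+ 2 + la^-1 * `|y w| ^+ 2 - 2 * `|x w| * `|y w| by field; rewrite gt_eqF.
by rewrite !real_normK ?num_real// !normrM (ger0_norm (ler0n _ 2)); lra.
Qed.

End moments.

(** * The empirical process of sliding blocks *)

Section array.
Context {R : realType} {E : completeNormedModType R}
  {d : measure_display} {Omega : measurableType d} (P : probability Omega R)
  (X : nat -> nat -> {RV P >-> borel E})
  (T : topologicalType) (g : T -> seq E -> R)
  (s r l : nat -> nat) (b : nat -> T -> R).
Hypotheses (g_meas : forall t, measurable_functional (g t))
  (s_gt0 : forall n, (0 < s n)%N)
  (b_gt0 : forall n t, 0 < b n t)
  (X_stationary : forall n, row_stationary X n)
  (s_le_l : forall n, (s n <= l n)%N)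
  (l_o_r : (fun n => (l n)%:R : R^o) =o_\oo (fun n => (r n)%:R : R^o))
  (r_o_n : (fun n => (r n)%:R : R^o) =o_\oo (fun n => n%:R : R^o))
  (r_o_b : (fun n => (r n)%:R : R^o) =o_\oo
     (fun n => Num.sqrt (pn X g s r b n) * inf (range (b n)) : R^o))
  (mixing : (mn s r n)%:R * beta_mixing X n (l n - s n) @[n --> \oo] -->
     (0 : R))
  (gmax_bounded : exists M : R, forall x, (gmax g x <= M%:E)%E)
  (second_moment : forall t,
     (fun n => fine 'E_P[fun w => (block_count X g s r n t w ^+ 2)%R]%E : R^o) =O_\oo
     (fun n => pn X g s r b n * b n t ^+ 2 / (mn s r n)%:R : R^o)).

Notation wsum f n := (window_sum f (X n : nat -> Omega -> E) (s n)).
Let p n := pn X g s r b n.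
Let m n := mn s r n.
Let sc n := Num.sqrt (p n) * inf (range (b n)).

Lemma littleo_near (u v : nat -> R) (e : R) : (u : nat -> R^o) =o_\oo (v : nat -> R^o) ->
  0 < e -> \forall n \near \oo, `|u n| <= e * `|v n|.
Proof. by move=> /eqoP h e0; exact: h. Qed.

Lemma near_2l_le_r : \forall n \near \oo, (l n + l n <= r n)%N.
Proof.
apply: filterS (littleo_near l_o_r (e := 2^-1) _) => // n.
rewrite !ger0_norm// mulrC ler_pdivlMr// -natrM ler_nat; lia.
Qed.

Lemma l_gt0 n : (0 < l n)%N. Proof. exact: leq_trans (s_gt0 n) (s_le_l n). Qed.

Lemma near_rs_le : \forall n \near \oo, (r n + s n <= n.+1)%N.
Proof.
near=> n; have h1 : (l n + l n <= r n)%N by near: n; exact: near_2l_le_r.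
have : `|(r n)%:R : R| <= 2^-1 * `|n%:R| by near: n; exact: littleo_near r_o_n _.
rewrite !ger0_norm// mulrC ler_pdivlMr// -natrM ler_nat => h2.
by have := s_le_l n; lia.
Unshelve. all: by end_near. Qed.

Lemma mn_r_le n : (s n <= n.+1)%N -> (m n * r n + s n <= n.+1)%N.
Proof.
move=> sn; rewrite /m /mn /nslide.
have := leq_trunc_div (n.+1 - s n) (r n); lia.
Qed.

Lemma inf_b_ge0 n : 0 <= inf (range (b n)).
Proof.
have [[_ [t _ _]]|h] := pselect (range (b n) !=set0).
  by apply: lb_le_inf; [exists (b n t), t|move=> _ [u _ <-]; exact: ltW].
by rewrite (_ : range _ = set0) ?inf0//; apply/seteqP; split => // y hy; apply: h; exists y.
Qed.

(** Eventually [1 <= r n <= |sc n|], so [sc n] cannot be 0. Positivity of [pn] and of the infimum of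
    [b n] is drawn from here. *)
Lemma near_sc_gt0 : \forall n \near \oo, 0 < sc n.
Proof.
near=> n.
have h1 : (l n + l n <= r n)%N by near: n; exact: near_2l_le_r.
have r0 : (0 < r n)%N by have := l_gt0 n; lia.
have : `|(r n)%:R : R| <= 1 * `|sc n| by near: n; exact: littleo_near r_o_b _.
have r1 : 0 < (r n)%:R :> R by rewrite ltr0n.
rewrite mul1r (gtr0_norm r1) => /(lt_le_trans r1); rewrite normr_gt0 => s0.
by rewrite lt_neqAle eq_sym s0 mulr_ge0 ?sqrtr_ge0 ?inf_b_ge0.
Unshelve. all: by end_near. Qed.

Lemma pn_ge0 n : 0 <= p n.
Proof. by apply: fine_ge0; exact: mu_ext_ge0. Qed.

Lemma sc_gt0_factors n : 0 < sc n -> 0 < Num.sqrt (p n) /\ 0 < inf (range (b n)).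
Proof.
move=> s0; have p0 : 0 < Num.sqrt (p n).
  by rewrite lt_neqAle sqrtr_ge0 andbT; apply: contraTneq s0 => e; rewrite /sc -e mul0r ltxx.
by split=> //; move: s0; rewrite /sc pmulr_rgt0.
Qed.

Lemma inf_b_le n t : inf (range (b n)) <= b n t.
Proof.
apply: inf_lbound; last by exists t.
by exists 0 => _ [u _ <-]; exact: ltW.
Qed.

Lemma cvg_r_sc : (r n)%:R / sc n @[n --> \oo] --> (0 : R).
Proof.
apply/cvgrPdist_le => e e0; near=> n; rewrite sub0r normrN.
have s0 : 0 < sc n by near: n; exact: near_sc_gt0.
have : `|(r n)%:R : R| <= e * `|sc n| by near: n; exact: littleo_near r_o_b _.
by rewrite (gtr0_norm s0) normrM normfV (gtr0_norm s0) ler_pdivrMr.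
Unshelve. all: by end_near. Qed.

Lemma cvg_l_r : (l n)%:R / (r n)%:R @[n --> \oo] --> (0 : R).
Proof.
apply/cvgrPdist_le => e e0.
apply: filterS2 near_2l_le_r (littleo_near l_o_r e0) => n h1; rewrite sub0r normrN.
have r0 : 0 < (r n)%:R :> R by rewrite ltr0n; have := l_gt0 n; lia.
by rewrite (gtr0_norm r0) normrM normfV (gtr0_norm r0) ler_pdivrMr.
Qed.

Lemma functional_bound : exists2 M : R, 0 <= M & forall t x, `|g t x| <= M.
Proof.
have [M hM] := gmax_bounded; exists `|M| => // t x.
rewrite (le_trans _ (ler_norm M))// -lee_fin; apply: le_trans (hM x).
by apply: ereal_sup_ubound; exists t.
Qed.

(* Fewer than [r n] summands lie beyond the last complete block. *)
Lemma norm_Zn_sub_le (M : R) n t w : (forall t x, `|g t x| <= M) -> (s n <= n.+1)%N -> (0 < r n)%N -> 0 < sc n ->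
  `|Zn X g s r b n t w - Zbarn X g s r b n t w| <= 2 * M * ((r n)%:R / sc n).
Proof.
move=> gM sn r0 s0.
have [p0 i0] := sc_gt0_factors s0.
have M0 : 0 <= M by apply: le_trans (normr_ge0 _) (gM t [::]).
have mrle : (m n * r n <= nslide s n)%N by rewrite /nslide; have := mn_r_le sn; lia.
have lt_r : (nslide s n - m n * r n < r n)%N.
  by rewrite /m /mn {1}(divn_eq (nslide s n) (r n)) addKn ltn_pmod.
rewrite distrC /Zn /Zbarn /centered_sum -mulrBr.
rewrite (@big_cat_nat _ _ _ (m n * r n).+1 1 (nslide s n).+1)//= [X in _ * X]addrAC subrr add0r.
have Eg j : `|fine 'E_P[fun w' => g t (Yn X s n j w')]%E| <= M.
  have bg : bdm (fun w' => g t (Yn X s n j w')).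
    by apply: (@bdm_le _ _ _ _ M) => //; exact: (measurable_window (x := X n : nat -> Omega -> borel E)).
  by rewrite expectation_E//=; apply: norm_E_cst => // w'.
rewrite normrM normfV (gtr0_norm (mulr_gt0 p0 (b_gt0 n t))).
apply: (@le_trans _ _ ((Num.sqrt (p n) * b n t)^-1 * ((r n)%:R * (2 * M)))).
  rewrite ler_wpM2l ?invr_ge0 ?mulr_ge0 ?sqrtr_ge0 ?(ltW (b_gt0 _ _))//.
  apply: le_trans (ler_norm_sum _ _ _) _.
  apply: (@le_trans _ _ (\sum_((m n * r n).+1 <= j < (nslide s n).+1) 2 * M)).
    apply: ler_sum => j _; apply: le_trans (ler_normB _ _) _.
    by rewrite mulr2n mulrDl mul1r lerD.
  rewrite sumr_const_nat -[leLHS]mulr_natl ler_wpM2r ?mulr_ge0// ler_nat; lia.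
have -> : 2 * M * ((r n)%:R / sc n) = (sc n)^-1 * ((r n)%:R * (2 * M)) by ring.
rewrite ler_wpM2r ?mulr_ge0// lef_pV2 ?posrE ?mulr_gt0//.
by rewrite ler_wpM2l ?sqrtr_ge0// inf_b_le.
Qed.

(** The bound is deterministic and uniform in [t]: the event is eventually empty, and no
    measurability question arises. *)
Lemma sup_norm_Zn_sub_outer (eta : R) : 0 < eta ->
    outer_prob P [set w | (eta%:E < ereal_sup (range (fun t : T =>
        `|Zn X g s r b n t w - Zbarn X g s r b n t w|%:E)))%E]
       @[n --> \oo] --> 0%E.
Proof.
move=> eta0; have [M M0 gM] := functional_bound.
apply: cvg_near_cst; near=> n.
have h1 : (l n + l n <= r n)%N by near: n; exact: near_2l_le_r.
have h2 : (r n + s n <= n.+1)%N by near: n; exact: near_rs_le.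
have s0 : 0 < sc n by near: n; exact: near_sc_gt0.
have rho : 2 * M * ((r n)%:R / sc n) <= eta.
  rewrite mulrC; near: n.
  have h : (r n)%:R / sc n * (2 * M) @[n --> \oo] --> (0 : R).
    rewrite -[X in _ --> X](mul0r (2 * M)); apply: cvgM; [exact: cvg_r_sc|exact: cvg_cst].
  exact: (cvgr_le _ h).
rewrite (_ : [set _ | _] = set0); first exact: mu_ext0.
apply/seteqP; split => // w /=.
apply/negP; rewrite -leNgt; apply: ge_ereal_sup => _ [t _ <-]; rewrite lee_fin.
apply: le_trans rho; apply: norm_Zn_sub_le => //; have := l_gt0 n; lia.
Unshelve. all: by end_near. Qed.

(** * Central limit theorem for the blocks of one bounded functional *)

Section blocks.
Variables (h : nat -> seq E -> R) (ka : nat -> R).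
Hypotheses (mh : forall n, measurable_functional (h n)) (h_ka : forall n x, `|h n x| <= ka n).
Hypothesis r_ka : (r n)%:R * ka n @[n --> \oo] --> (0 : R).

Let ka0 n : 0 <= ka n. Proof. exact: le_trans (normr_ge0 _) (h_ka n [::]). Qed.

Section limit.
Variables (o len : nat -> nat) (si : R).
Let xi n i := cblock X n (h n) (s n) (r n) (o n) (len n) i.
Hypothesis len_near : \forall n \near \oo,
  [/\ (o n + len n <= r n)%N, (0 < len n)%N & (len n + l n <= r n)%N].
Hypothesis var_cvg : (m n)%:R * \int[P]_w xi n 0%N w ^+ 2 @[n --> \oo] --> si.

Let norm_mean n : `|wmean X n (h n) (s n)| <= ka n.
Proof.
apply: norm_E_cst => //; apply: (@bdm_le _ _ _ _ (ka n)) => //.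
exact: (measurable_window (x := X n : nat -> Omega -> borel E)).
Qed.

Let norm_xi n i w : `|xi n i w| <= 2 * (len n)%:R * ka n.
Proof.
apply: le_trans (ler_normB _ _) _.
rewrite mulr2n !mulrDl !mul1r lerD//; first exact: norm_window_sum.
by rewrite normrM ger0_norm// ler_wpM2l.
Qed.

(** Stated for an arbitrary part of each block, since it serves the kept and the dropped parts
    alike. A centered part is at most [2 (r n) (ka n)], which tends to 0. *)
Lemma block_chf_limit :
  \int[P]_w cos (\sum_(i < m n) xi n i w) @[n --> \oo] --> expR (- (si / 2)) /\
  \int[P]_w sin (\sum_(i < m n) xi n i w) @[n --> \oo] --> (0 : R).
Proof.
apply: (chf_limit (m := m) (xi := xi) (B := fun n => 4 * beta_mixing X n (l n - s n))
  (K := fun n => 2 * (len n)%:R * ka n) (v := fun n => \int[P]_w xi n 0%N w ^+ 2)) => //.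
- by move=> n i; exact: measurable_cblock.
- rewrite -(mulr0 (4 : R)); under eq_fun do rewrite mulrCA.
  by apply: cvgM; [exact: cvg_cst|exact: mixing].
- apply: (@squeeze_cvgr _ _ _ _ (fun=> 0) (fun n => 2 * ((r n)%:R * ka n))).
  + apply: filterS len_near => n [h1 h2 h3]; rewrite !mulr_ge0//= -mulrA ler_wpM2l// ler_wpM2r//.
    by rewrite ler_nat; lia.
  + exact: cvg_cst.
  + by rewrite -[X in _ --> X](mulr0 (2 : R)); apply: cvgM => //; exact: cvg_cst.
- apply: filterS3 len_near near_2l_le_r near_rs_le => n [h1 h2 h3] h4 h5.
  have sn : (s n <= n.+1)%N by lia.
  have key (p0 q0 : R -> R) : measurable_fun setT p0 -> measurable_fun setT q0 ->
    (forall u, `|p0 u| <= 1) -> (forall u, `|q0 u| <= 1) -> forall i, (i < m n)%N -> _ :=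
    fun hp hq hp1 hq1 i im => cblock_near_indep X (mh n) (s_gt0 n) (s_le_l n) h4 (mn_r_le sn) h1 h2 h3 im hp hq hp1 hq1.
  have mc : measurable_fun setT (cos : R -> R) by exact: measurable_cosf.
  have ms : measurable_fun setT (sin : R -> R) by exact: measurable_sinf.
  by split; apply: key => //; [exact: norm_cos_le1|exact: norm_cos_le1|exact: norm_cos_le1|
    exact: norm_sin_le1|exact: norm_sin_le1|exact: norm_cos_le1|exact: norm_sin_le1|exact: norm_sin_le1].
- apply: filterS3 len_near near_2l_le_r near_rs_le => n [h1 h2 h3] h4 h5 i im.
  have sn : (s n <= n.+1)%N by lia.
  have st (phi : R -> R) := cblock_stationary (@X_stationary n) (mh n) (h_ka n) (s_gt0 n) (mn_r_le sn) h1 (phi := phi) im.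
  split.
  + exact: (cblock_E0 (@X_stationary n) (mh n) (h_ka n) (s_gt0 n) (mn_r_le sn) h1 im).
  + apply: (st (fun u => u ^+ 2)); first exact: measurable_funX.
    exists (((len n)%:R * ka n + `|(len n)%:R * wmean X n (h n) (s n)|) ^+ 2) => u hu.
    by rewrite normrX lerXn2r ?nnegrE// (le_trans (normr_ge0 u) hu).
  + by apply: (st cos); [exact: measurable_cosf|exists 1 => u _; exact: norm_cos_le1].
  + by apply: (st sin); [exact: measurable_sinf|exists 1 => u _; exact: norm_sin_le1].
Qed.

End limit.

Lemma window_sum_cat (f : seq E -> R) U (x : nat -> U -> E) s0 o0 k1 k2 w :
  window_sum f x s0 o0 (k1 + k2) w = window_sum f x s0 o0 k1 w + window_sum f x s0 (o0 + k1) k2 w.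
Proof.
rewrite /window_sum big_split_ord/=; congr (_ + _).
by apply: eq_bigr => j _; rewrite addnA.
Qed.

Lemma cblock_cat (f : seq E -> R) n s0 r0 o0 k1 k2 i w :
  cblock X n f s0 r0 o0 (k1 + k2) i w =
  cblock X n f s0 r0 o0 k1 i w + cblock X n f s0 r0 (o0 + k1) k2 i w.
Proof. by rewrite /cblock window_sum_cat addnA natrD mulrDl; ring. Qed.

(** The kept parts inherit the variance limit from the full blocks by [cvg_perturb]. The dropped
    parts have limit variance 0, so the mean cosine of their sum tends to 1 and [chf_perturb]
    discards them. *)
Lemma full_block_chf_limit (si : R) :
  (m n)%:R * \int[P]_w cblock X n (h n) (s n) (r n) 0 (r n) 0 w ^+ 2 @[n --> \oo] --> si ->
  (m n)%:R * \int[P]_w cblock X n (h n) (s n) (r n) (r n - l n) (l n) 0 w ^+ 2 @[n --> \oo] --> (0 : R) ->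
  \int[P]_w cos (\sum_(i < m n) cblock X n (h n) (s n) (r n) 0 (r n) i w) @[n --> \oo] --> expR (- (si / 2)) /\
  \int[P]_w sin (\sum_(i < m n) cblock X n (h n) (s n) (r n) 0 (r n) i w) @[n --> \oo] --> (0 : R).
Proof.
move=> hW hD.
pose W n := cblock X n (h n) (s n) (r n) 0 (r n).
pose W1 n := cblock X n (h n) (s n) (r n) 0 (r n - l n).
pose D n := cblock X n (h n) (s n) (r n) (r n - l n) (l n).
have WD n i w : (l n <= r n)%N -> W n i w = W1 n i w + D n i w.
  by move=> lr; rewrite /W1 /D -[X in _ + cblock _ _ _ _ _ X _ _ _]add0n -cblock_cat subnK.
have bc n o len i : bdm (cblock X n (h n) (s n) (r n) o len i).
  by apply: bdmB; [apply: bdm_ws => //; exact: h_ka|exact: bdm_cst].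
have hW1 : (m n)%:R * \int[P]_w W1 n 0%N w ^+ 2 @[n --> \oo] --> si.
  apply: (cvg_perturb hW hD).
    by move=> n; rewrite mulr_ge0// E_ge0// => w; exact: sqr_ge0.
  apply: filterS near_2l_le_r => n lr la la0.
  have e : (fun w => W1 n 0%N w ^+ 2) = (fun w => (W n 0%N w - D n 0%N w) ^+ 2).
    by apply/funext => w; rewrite WD ?addrK//; lia.
  rewrite -mulrBr normrM ger0_norm// e.
  apply: le_trans (ler_wpM2l _ (sqr_perturb P (bc _ _ _ _) (bc _ _ _ _) la0)) _ => //.
  by rewrite mulrDr mulrCA lerD2l mulrCA.
have [cW1 sW1] : \int[P]_w cos (\sum_(i < m n) W1 n i w) @[n --> \oo] --> expR (- (si / 2)) /\
    \int[P]_w sin (\sum_(i < m n) W1 n i w) @[n --> \oo] --> (0 : R).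
  apply: block_chf_limit => //.
  by apply: filterS near_2l_le_r => n lr; have := l_gt0 n; split; lia.
(* Consecutive dropped parts are [r n - l n >= l n] windows apart, which is the gap that
   [block_chf_limit] requires. *)
have [cD _] : \int[P]_w cos (\sum_(i < m n) D n i w) @[n --> \oo] --> expR (- (0 / 2)) /\
    \int[P]_w sin (\sum_(i < m n) D n i w) @[n --> \oo] --> (0 : R).
  apply: block_chf_limit => //.
  by apply: filterS near_2l_le_r => n lr; have := l_gt0 n; split; lia.
pose de n := 1 - \int[P]_w cos (\sum_(i < m n) D n i w).
have cde : de n + Num.sqrt (2 * de n) @[n --> \oo] --> (0 : R).
  have h1 : de n @[n --> \oo] --> (0 : R).
    rewrite -[X in _ --> X](subrr (1 : R)); apply: cvgB; first exact: cvg_cst.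
    by move: cD; rewrite mul0r oppr0 expR0.
  have h2 : 2 * de n @[n --> \oo] --> (0 : R).
    by rewrite -[X in _ --> X](mulr0 (2 : R)); apply: cvgM => //; exact: cvg_cst.
  rewrite -[X in _ --> X]addr0; apply: cvgD => //.
  rewrite -[X in _ --> X]sqrtr0; apply: (cvg_comp _ _ h2); exact: sqrt_continuous.
have ms n o len : measurable_fun setT (fun w => \sum_(i < m n) cblock X n (h n) (s n) (r n) o len i w).
  by apply: measurable_sum => i; exact: (bc _ _ _ _).1.
have key n := chf_perturb P (ms n 0%N (r n - l n)%N) (ms n (r n - l n)%N (l n)).
have eW n w : (l n + l n <= r n)%N -> \sum_(i < m n) W n i w = \sum_(i < m n) W1 n i w + \sum_(i < m n) D n i w.
  by move=> lr; rewrite -big_split/=; apply: eq_bigr => i _; apply: WD; lia.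
have fin (f : R -> R) (L : R) : \int[P]_w f (\sum_(i < m n) W1 n i w) @[n --> \oo] --> L ->
    (forall n, `|\int[P]_w f (\sum_(i < m n) W1 n i w + \sum_(i < m n) D n i w) -
      \int[P]_w f (\sum_(i < m n) W1 n i w)| <= de n + Num.sqrt (2 * de n)) ->
    \int[P]_w f (\sum_(i < m n) W n i w) @[n --> \oo] --> L.
  move=> hf hle.
  have c0 : \int[P]_w f (\sum_(i < m n) W1 n i w + \sum_(i < m n) D n i w) -
      \int[P]_w f (\sum_(i < m n) W1 n i w) @[n --> \oo] --> (0 : R).
    apply/norm_cvg0P; apply: (@squeeze_cvgr _ _ _ _ (fun=> 0) (fun n => de n + Num.sqrt (2 * de n))) => //.
      by apply: nearW => n; rewrite normr_ge0 hle.
    exact: cvg_cst.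
  have c1 : \int[P]_w f (\sum_(i < m n) W1 n i w + \sum_(i < m n) D n i w) -
      \int[P]_w f (\sum_(i < m n) W1 n i w) +
      \int[P]_w f (\sum_(i < m n) W1 n i w) @[n --> \oo] --> L.
    by rewrite -[L]add0r; exact: cvgD.
  apply: cvg_trans c1; apply: near_eq_cvg.
  apply: filterS near_2l_le_r => n lr; rewrite /= subrK.
  by apply: eq_Rintegral => w _; rewrite eW.
split; [apply: fin cW1 _ => n|apply: fin sW1 _ => n]; [exact: (key n).1|exact: (key n).2].
Qed.

End blocks.

(** * Linear combinations of finitely many coordinates *)

Section weights.
Variables (M : R) (gM : forall t x, `|g t x| <= M) (k : nat) (t : 'I_k -> T) (a : 'I_k -> R).

Notation V n i := (Vn X g s r b n 1 (t i)).
Notation aZ n w := (\sum_i a i * Zn X g s r b n (t i) w).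
Notation aZbar n w := (\sum_i a i * Zbarn X g s r b n (t i) w).
(** Once the normalizing constants are absorbed into the weights, a linear combination of
    coordinates of [Zn] is the centered window sum of the single functional [hh n], to which the
    block results apply. *)
Let al n i := a i / (Num.sqrt (p n) * b n (t i)).
Let hh n x := \sum_i al n i * g (t i) x.
Let ka n := (\sum_i `|al n i|) * M.

Lemma weighted_measurable n : measurable_functional (hh n).
Proof.
move=> j; apply: measurable_sum => i; apply: measurable_funM => //.
exact: g_meas.
Qed.

Lemma weighted_bound n x : `|hh n x| <= ka n.
Proof.
apply: le_trans (ler_norm_sum _ _ _) _; rewrite /ka mulr_suml; apply: ler_sum => i _.
by rewrite normrM ler_wpM2l.
Qed.

Let bg n j u : bdm (fun w => g u (Yn X s n j w)).
Proof.
by apply: (@bdm_le _ _ _ _ M) => //; exact: (measurable_window (x := X n : nat -> Omega -> borel E)).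
Qed.

Let bV n i : bdm (V n i).
Proof. by apply: bdmZ; apply: bdm_sum => j _; exact: bg. Qed.

Let window_sumE (f : seq E -> R) n o len w :
  wsum f n o len w = \sum_(1 <= j < len.+1) f (Yn X s n (o + j) w).
Proof. by rewrite big_add1 big_mkord; apply: eq_bigr => j _; rewrite addnS. Qed.

Lemma weighted_window_sum n o len w :
  wsum (hh n) n o len w =
  \sum_i al n i * wsum (g (t i)) n o len w.
Proof.
rewrite /window_sum /hh exchange_big/=; apply: eq_bigr => i _; by rewrite mulr_sumr.
Qed.

Lemma weighted_block_Vn n : (r n + s n <= n.+1)%N -> forall w,
  cblock X n (hh n) (s n) (r n) 0 (r n) 0 w =
  \sum_i (a i / Num.sqrt (p n)) * (V n i w - \int[P]_w V n i w).
Proof.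
move=> rs w.
have e w' : wsum (hh n) n 0 (r n) w' =
    \sum_i (a i / Num.sqrt (p n)) * V n i w'.
  rewrite weighted_window_sum; apply: eq_bigr => i _.
  rewrite window_sumE /al /Vn invfM -!mulrA; do 3 congr (_ * _).
rewrite /cblock mul0n add0n e -(E_ws (@X_stationary n) (weighted_measurable n) (weighted_bound n) (s_gt0 n) (o := 0%N))//.
have -> : \int[P]_w wsum (hh n) n 0 (r n) w =
    \sum_i (a i / Num.sqrt (p n)) * \int[P]_w V n i w.
  under eq_Rintegral do rewrite e.
  by rewrite E_sum => [|i _]; [apply: eq_bigr => i _; rewrite EZ|exact: bdmZ].
by rewrite -sumrB; apply: eq_bigr => i _; rewrite mulrBr.
Qed.

Lemma cvg_block_variance (c : T -> T -> R) :
  (forall t u, (mn s r n)%:R / pn X g s r b n *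
     fine (covariance P (Vn X g s r b n 1 t) (Vn X g s r b n 1 u)) @[n --> \oo] --> c t u) ->
  (m n)%:R * \int[P]_w cblock X n (hh n) (s n) (r n) 0 (r n) 0 w ^+ 2 @[n --> \oo] --> quad c t a.
Proof.
move=> hc.
pose A n := \sum_i \sum_j a i * a j *
  ((m n)%:R / p n * fine (covariance P (V n i) (V n j))).
have : A n @[n --> \oo] --> quad c t a.
  by apply: cvg_sumr => i; apply: cvg_sumr => j; apply: cvgM; [exact: cvg_cst|exact: hc].
apply: cvg_trans; apply: near_eq_cvg; apply: filterS near_rs_le => n rs.
have bv i : bdm (fun w => V n i w - \int[P]_w V n i w).
  by apply: bdmB => //; exact: bdm_cst.
have covE i j : fine (covariance P (V n i) (V n j)) =
    \int[P]_w ((V n i w - \int[P]_w V n i w) *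
      (V n j w - \int[P]_w V n j w)).
  rewrite covariance.unlock !expectation_E//=.
  exact: bdmM (bv i) (bv j).
rewrite /A; transitivity ((m n)%:R * \int[P]_w (\sum_i \sum_j
    (a i / Num.sqrt (p n) * (a j / Num.sqrt (p n))) * ((V n i w - \int[P]_w V n i w) *
      (V n j w - \int[P]_w V n j w)))).
  rewrite E_sum => [|i _]; last by apply: bdm_sum => j _; apply/bdmZ/bdmM.
  rewrite mulr_sumr; apply: eq_bigr => i _.
  rewrite E_sum => [|j _]; last exact/bdmZ/bdmM.
  rewrite mulr_sumr; apply: eq_bigr => j _.
  rewrite EZ ?covE; last exact: bdmM.
  have -> : (p n)^-1 = (Num.sqrt (p n))^-1 * (Num.sqrt (p n))^-1.
    by rewrite -invfM -expr2 sqr_sqrtr ?pn_ge0.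
  ring.
congr (_ * _); apply: eq_Rintegral => w _; rewrite weighted_block_Vn// expr2 big_distrl/=.
apply: eq_bigr => i _; rewrite big_distrr/=; apply: eq_bigr => j _; ring.
Qed.

(** Each weight is at most [|a i| / sc n], so the claim reduces to [cvg_r_sc]. *)
Lemma cvg_weighted_bound : (r n)%:R * ka n @[n --> \oo] --> (0 : R).
Proof.
pose K := (\sum_i `|a i|) * M.
apply: (@squeeze_cvgr _ _ _ _ (fun=> 0) (fun n => K * ((r n)%:R / sc n))).
- apply: filterS near_sc_gt0 => n s0.
  have ka0 : 0 <= ka n by exact: le_trans (normr_ge0 _) (weighted_bound n [::]).
  rewrite mulr_ge0//=.
  have [p0 i0] := sc_gt0_factors s0.
  have -> : (r n)%:R * ka n = \sum_i (`|a i| * M * ((r n)%:R / (Num.sqrt (p n) * b n (t i)))).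
    rewrite /ka mulr_suml mulr_sumr; apply: eq_bigr => i _.
    rewrite /al normrM normfV (gtr0_norm (mulr_gt0 p0 (b_gt0 n (t i)))); ring.
  rewrite /K !mulr_suml; apply: ler_sum => i _.
  rewrite ler_wpM2l ?mulr_ge0 ?(le_trans (normr_ge0 _) (gM (t i) [::]))//.
  rewrite ler_wpM2l// lef_pV2 ?posrE ?mulr_gt0//.
  by rewrite ler_wpM2l ?sqrtr_ge0// inf_b_le.
- exact: cvg_cst.
- by rewrite -[X in _ --> X](mulr0 K); apply: cvgM; [exact: cvg_cst|exact: cvg_r_sc].
Qed.

Let ind u (x : seq E) : R := (g u x != 0)%:R.

Let ind_bound u x : `|ind u x| <= 1. Proof. exact: norm_natb_le1. Qed.

Let ind_meas u : measurable_functional (ind u).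
Proof.
move=> j; pose A := (fun x : j.-tuple (borel E) => g u x) @^-1` [set 0].
have mA : measurable A by rewrite -[A]setTI; exact: g_meas.
rewrite (_ : (fun _ => _) = (fun x : j.-tuple (borel E) => 1 - \1_A x)).
  by apply: measurable_funB => //; exact: measurable_indic.
apply/funext => x; rewrite /ind indicE; case: eqVneq => [e|h].
  by rewrite mem_set//= subrr.
by rewrite memNset ?subr0//= => /eqP; exact/negP.
Qed.

Let window_sum_mul f n q len w :
  wsum f n 0 (q * len) w =
  \sum_(j < q) wsum f n (j * len) len w.
Proof.
elim: q => [|q IH]; first by rewrite mul0n /window_sum !big_ord0.
by rewrite mulSn addnC window_sum_cat IH big_ord_recr/= add0n.
Qed.

(** Squares of nonnegative counts are superadditive, and the windows left over after the last full
    piece of length [l n] can only increase the count. *)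
Lemma sub_count_le n u : (l n + l n <= r n)%N -> (r n + s n <= n.+1)%N ->
  (r n %/ l n)%:R * \int[P]_w (wsum (ind u) n 0 (l n) w ^+ 2) <=
  fine 'E_P[fun w => (block_count X g s r n u w ^+ 2)%R]%E.
Proof.
move=> lr rs.
have bws o len := bdm_ws X n (s n) (@ind_meas u) (ind_bound u) o len.
have bE w : block_count X g s r n u w = wsum (ind u) n 0 (r n) w.
  by rewrite window_sumE.
have bb : bdm (fun w => block_count X g s r n u w ^+ 2).
  by under eq_fun do rewrite bE; apply: bdmX; exact: bws.
rewrite expectation_E//=.
apply: (@le_trans _ _ (\int[P]_w \sum_(j < r n %/ l n)
    wsum (ind u) n (j * l n) (l n) w ^+ 2)).
  rewrite E_sum => [|j _]; last by apply: bdmX; exact: bws.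
  rewrite mulr_natl -[in leLHS](card_ord (r n %/ l n)) -sumr_const; apply: ler_sum => j _.
  rewrite (window_sum_stationary (@X_stationary n) (@ind_meas u) (ind_bound u) (s_gt0 n) (phi := fun y => y ^+ 2) (o := (j * l n)%N))//.
  - exists (((l n)%:R * 1) ^+ 2) => y hy; rewrite normrX lerXn2r ?nnegrE//.
  - apply: leq_trans rs; rewrite leq_add2r addnC -mulSn.
    by apply: leq_trans (leq_trunc_div (r n) (l n)); rewrite leq_mul2r ltn_ord orbT.
apply: le_E => // [|w].
  by apply: bdm_sum => j _; apply: bdmX; exact: bws.
have ws0 o len : 0 <= wsum (ind u) n o len w.
  by apply: sumr_ge0 => j _; rewrite ler0n.
apply: le_trans (sum_sqr_le _ _) _ => //.
rewrite -window_sum_mul bE lerXn2r ?nnegrE//.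
have le := leq_trunc_div (r n) (l n).
by rewrite -[in leRHS](subnKC le) window_sum_cat lerDl.
Qed.

(** The variance is at most the second moment, which stationarity moves to offset 0. There
    [|g| <= M] times the indicator of [g] being nonzero, and Cauchy-Schwarz over the [k] coordinates
    costs the factor [k]. *)
Lemma small_block_le n : (l n + l n <= r n)%N -> (r n + s n <= n.+1)%N ->
  \int[P]_w cblock X n (hh n) (s n) (r n) (r n - l n) (l n) 0 w ^+ 2 <=
  k%:R * \sum_i al n i ^+ 2 * M ^+ 2 *
    \int[P]_w (wsum (ind (t i)) n 0 (l n) w ^+ 2).
Proof.
move=> lr rs.
have M0 (u : T) : 0 <= M by exact: le_trans (normr_ge0 _) (gM u [::]).
have bws o len := bdm_ws X n (s n) (@weighted_measurable n) (weighted_bound n) o len.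
have bwi u := bdm_ws X n (s n) (@ind_meas u) (ind_bound u) 0 (l n).
have o_le : (0 * r n + (r n - l n) + l n + s n <= n.+1)%N by lia.
rewrite /cblock -(E_ws (@X_stationary n) (weighted_measurable n) (weighted_bound n) (s_gt0 n) o_le).
apply: le_trans (variance_le P (bws _ _)) _.
have mq : measurable_fun setT (fun y : R => y ^+ 2) by exact: measurable_funX.
have bd : exists B, forall y, `|y| <= (l n)%:R * ka n -> `|y ^+ 2| <= B.
  exists (((l n)%:R * ka n) ^+ 2) => y hy.
  by rewrite normrX lerXn2r ?nnegrE// (le_trans (normr_ge0 y) hy).
rewrite (window_sum_stationary (@X_stationary n) (weighted_measurable n) (weighted_bound n) (s_gt0 n) mq bd o_le).
apply: (@le_trans _ _ (\int[P]_w (k%:R * \sum_i al n i ^+ 2 * M ^+ 2 *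
    (wsum (ind (t i)) n 0 (l n) w ^+ 2)))); last first.
  rewrite EZ; last by apply: bdm_sum => i _; apply/bdmZ/bdmX; exact: bwi.
  rewrite E_sum => [|i _]; last by apply/bdmZ/bdmX; exact: bwi.
  rewrite ler_wpM2l//; apply: ler_sum => i _; rewrite EZ//; exact/bdmX/bwi.
apply: le_E => [||w].
- exact/bdmX/bws.
- by apply/bdmZ/bdm_sum => i _; apply/bdmZ/bdmX; exact: bwi.
rewrite weighted_window_sum; apply: le_trans (sqr_sum_le _) _.
rewrite ler_wpM2l//; apply: ler_sum => i _.
rewrite exprMn -mulrA ler_wpM2l ?sqr_ge0// -exprMn.
rewrite -[leLHS]real_normK ?num_real// lerXn2r ?nnegrE ?mulr_ge0 ?(M0 (t i))//.
  by apply: sumr_ge0 => j _; rewrite ler0n.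
apply: le_trans (ler_norm_sum _ _ _) _; rewrite mulr_sumr; apply: ler_sum => j _.
by rewrite /ind; case: eqVneq => [->|_]; rewrite ?normr0 ?mulr0 ?mulr1.
Qed.

(** The squared weights contribute [1 / (p b^2)], and [second_moment] contributes [p b^2 / m]; these
    cancel against the factor [m]. Only the ratio of [l n] to [r n] remains. *)
Lemma cvg_small_block_variance :
  (m n)%:R * \int[P]_w cblock X n (hh n) (s n) (r n) (r n - l n) (l n) 0 w ^+ 2 @[n --> \oo] --> (0 : R).
Proof.
have /choice[K hK] : forall i, exists K : R, 0 < K /\ \forall n \near \oo,
    `|fine 'E_P[fun w => (block_count X g s r n (t i) w ^+ 2)%R]%E| <=
    K * `|pn X g s r b n * b n (t i) ^+ 2 / (mn s r n)%:R|.
  by move=> i; have /eqO_exP[K K0 h] := second_moment (t i); exists K.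
pose L := k%:R * \sum_i (a i ^+ 2 * M ^+ 2 * K i) * 2.
have hKn : \forall n \near \oo, forall i, `|fine 'E_P[fun w => (block_count X g s r n (t i) w ^+ 2)%R]%E| <=
    K i * `|pn X g s r b n * b n (t i) ^+ 2 / (mn s r n)%:R|.
  by apply: filter_forall => i; exact: (hK i).2.
apply: (@squeeze_cvgr _ _ _ _ (fun=> 0) (fun n => L * ((l n)%:R / (r n)%:R))).
- near=> n.
  have h1 : (l n + l n <= r n)%N by near: n; exact: near_2l_le_r.
  have h2 : (r n + s n <= n.+1)%N by near: n; exact: near_rs_le.
  have s0 : 0 < sc n by near: n; exact: near_sc_gt0.
  have h3 i : `|fine 'E_P[fun w => (block_count X g s r n (t i) w ^+ 2)%R]%E| <=
    K i * `|pn X g s r b n * b n (t i) ^+ 2 / (mn s r n)%:R|.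
    by move: i; near: n.
  rewrite mulr_ge0 ?E_ge0//=; last by move=> w; exact: sqr_ge0.
  apply: le_trans (ler_wpM2l _ (small_block_le h1 h2)) _ => //.
  rewrite /L mulrCA -mulrA ler_wpM2l// mulr_sumr mulr_suml; apply: ler_sum => i _.
  have [p0 _] := sc_gt0_factors s0.
  have pp : 0 < p n by rewrite -sqrtr_gt0.
  have bi := b_gt0 n (t i).
  have mp : 0 < (m n)%:R :> R.
    by rewrite ltr0n /m /mn divn_gt0 ?/nslide; have := l_gt0 n; lia.
  have l0 : 0 < (l n)%:R :> R by rewrite ltr0n l_gt0.
  have r0 : 0 < (r n)%:R :> R by rewrite ltr0n; have := l_gt0 n; lia.
  set C := \int[P]_w _.
  have hC : (r n %/ l n)%:R * C <= K i * (p n * b n (t i) ^+ 2 / (m n)%:R).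
    apply: le_trans (sub_count_le (t i) h1 h2) _; apply: le_trans (ler_norm _) _.
    have e0 : 0 <= p n * b n (t i) ^+ 2 / (m n)%:R by rewrite divr_ge0// mulr_ge0 ?sqr_ge0 ?(ltW pp).
    by rewrite -[X in K i * X](ger0_norm e0); exact: h3.
  have C0 : 0 <= C by apply: E_ge0 => w; exact: sqr_ge0.
  (* With [q >= 1] the integer quotient, [r < (q + 1) l <= 2 q l]; this is the factor 2 in [L]. *)
  have hq : (r n)%:R <= 2 * (r n %/ l n)%:R * (l n)%:R :> R.
    have q1 : (0 < r n %/ l n)%N by rewrite divn_gt0 ?l_gt0// (leq_trans (leq_addr _ _) h1).
    rewrite -!natrM ler_nat; apply: leq_trans (ltnW (ltn_ceil (r n) (l_gt0 n))) _.
    by rewrite leq_mul2r mul2n -addnn -addn1 leq_add2l q1 orbT.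
  have hC2 : (r n)%:R * C <= 2 * (l n)%:R * (K i * (p n * b n (t i) ^+ 2 / (m n)%:R)).
    apply: le_trans (ler_wpM2r C0 hq) _.
    rewrite (_ : 2 * _ * _ * C = 2 * (l n)%:R * ((r n %/ l n)%:R * C)); last by ring.
    by rewrite ler_wpM2l// mulr_ge0.
  have pn0 : p n != 0 by rewrite gt_eqF.
  have bn0 : b n (t i) != 0 by rewrite gt_eqF.
  have mn0 : (m n)%:R != 0 :> R by rewrite gt_eqF.
  have rn0 : (r n)%:R != 0 :> R by rewrite gt_eqF.
  pose co := (m n)%:R * (a i ^+ 2 * M ^+ 2) / (p n * b n (t i) ^+ 2 * (r n)%:R).
  have co0 : 0 <= co.
    apply: divr_ge0; apply: mulr_ge0 => //; first by rewrite mulr_ge0 ?sqr_ge0.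
    by rewrite mulr_ge0 ?sqr_ge0 ?(ltW pp).
  have -> : al n i ^+ 2 = a i ^+ 2 / (p n * b n (t i) ^+ 2).
    by rewrite /al expr_div_n exprMn sqr_sqrtr ?pn_ge0.
  have -> : (m n)%:R * (a i ^+ 2 / (p n * b n (t i) ^+ 2) * M ^+ 2 * C) = co * ((r n)%:R * C).
    by rewrite /co; field; rewrite pn0 bn0 rn0.
  apply: le_trans (ler_wpM2l co0 hC2) _.
  by rewrite le_eqVlt; apply/orP; left; apply/eqP; rewrite /co; field; rewrite pn0 bn0 rn0 mn0.
- exact: cvg_cst.
- by rewrite -[X in _ --> X](mulr0 L); apply: cvgM; [exact: cvg_cst|exact: cvg_l_r].
Unshelve. all: by end_near.
Qed.

Let centered_sumE n N u w : centered_sum X g s r b n N u w =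
  (Num.sqrt (p n) * b n u)^-1 * (wsum (g u) n 0 N w -
    \int[P]_w wsum (g u) n 0 N w).
Proof.
rewrite /centered_sum; congr (_ * _); rewrite sumrB window_sumE; congr (_ - _).
under [RHS]eq_Rintegral do rewrite window_sumE.
by rewrite E_sum => [|j _]; [apply: eq_bigr => j _; rewrite expectation_E|exact: bg].
Qed.

Lemma bdm_centered_sum n N u : bdm (centered_sum X g s r b n N u).
Proof.
have -> : centered_sum X g s r b n N u = (fun w => (Num.sqrt (p n) * b n u)^-1 *
    (wsum (g u) n 0 N w -
      \int[P]_w wsum (g u) n 0 N w)).
  by apply/funext => w; exact: centered_sumE.
apply: bdmZ; apply: bdmB; last exact: bdm_cst.
exact: (bdm_ws X n (s n) (g_meas u) (gM u) 0 N).
Qed.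

Lemma weighted_Zn n : (s n <= n.+1)%N -> forall w,
  aZ n w =
  \sum_(i < m n) cblock X n (hh n) (s n) (r n) 0 (r n) i w.
Proof.
move=> sn w; pose N := (m n * r n)%N.
pose G i w := wsum (g (t i)) n 0 N w.
have bG i : bdm (G i) := bdm_ws X n (s n) (g_meas (t i)) (gM (t i)) 0 N.
transitivity (wsum (hh n) n 0 N w -
  \int[P]_w wsum (hh n) n 0 N w).
  under [X in _ - X]eq_Rintegral do rewrite weighted_window_sum.
  rewrite weighted_window_sum E_sum => [|i _]; last exact: bdmZ (bG i).
  rewrite -sumrB; apply: eq_bigr => i _; rewrite EZ; last exact: bG.
  rewrite /Zn centered_sumE /al -/(m n) -/N; ring.
rewrite (E_ws (@X_stationary n) (@weighted_measurable n) (weighted_bound n) (s_gt0 n)) ?add0n ?mn_r_le//.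
rewrite window_sum_mul /cblock sumrB; congr (_ - _).
  by apply: eq_bigr => i _; rewrite addn0.
by rewrite sumr_const card_ord -[RHS]mulr_natl mulrA -natrM.
Qed.

Variable c : T -> T -> R.
Hypothesis hc : forall t u, (mn s r n)%:R / pn X g s r b n *
     fine (covariance P (Vn X g s r b n 1 t) (Vn X g s r b n 1 u)) @[n --> \oo] --> c t u.

Lemma Zn_chf_limit :
  \int[P]_w cos (aZ n w) @[n --> \oo] --> expR (- (quad c t a / 2)) /\
  \int[P]_w sin (aZ n w) @[n --> \oo] --> (0 : R).
Proof.
have [h1 h2] := full_block_chf_limit weighted_measurable weighted_bound cvg_weighted_bound
  (cvg_block_variance hc) cvg_small_block_variance.
split; [apply: cvg_trans h1|apply: cvg_trans h2]; apply: near_eq_cvg;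
  apply: filterS near_rs_le => n rs; apply: eq_Rintegral => w _; rewrite weighted_Zn//; lia.
Qed.

(** [cos] and [sin] are 1-Lipschitz, and the two linear combinations differ by a deterministic bound
    that tends to 0. *)
Lemma Zbarn_chf_limit :
  \int[P]_w cos (aZbar n w) @[n --> \oo] --> expR (- (quad c t a / 2)) /\
  \int[P]_w sin (aZbar n w) @[n --> \oo] --> (0 : R).
Proof.
pose K := (\sum_i `|a i|) * (2 * M).
have mZ n : measurable_fun setT (fun w => aZ n w).
  by apply: measurable_sum => i; apply: measurable_funM => //; exact: (bdm_centered_sum _ _ _).1.
have mZb n : measurable_fun setT (fun w => aZbar n w).
  by apply: measurable_sum => i; apply: measurable_funM => //; exact: (bdm_centered_sum _ _ _).1.
have close : \forall n \near \oo, forall w,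
    `|aZbar n w - aZ n w| <= K * ((r n)%:R / sc n).
  apply: filterS3 near_2l_le_r near_rs_le near_sc_gt0 => n h1 h2 s0 w.
  rewrite -sumrB; apply: le_trans (ler_norm_sum _ _ _) _.
  rewrite /K -mulrA mulr_suml; apply: ler_sum => i _; rewrite -mulrBr normrM ler_wpM2l// distrC.
  by apply: norm_Zn_sub_le => //; have := l_gt0 n; lia.
have cK : K * ((r n)%:R / sc n) @[n --> \oo] --> (0 : R).
  by rewrite -[X in _ --> X](mulr0 K); apply: cvgM; [exact: cvg_cst|exact: cvg_r_sc].
have key (f : R -> R) (L : R) : (forall x y, `|f x - f y| <= `|x - y|) ->
    (forall z : Omega -> R, measurable_fun setT z -> bdm (fun w => f (z w))) ->
    \int[P]_w f (aZ n w) @[n --> \oo] --> L ->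
    \int[P]_w f (aZbar n w) @[n --> \oo] --> L.
  move=> lf bf hL.
  have c0 : \int[P]_w f (aZbar n w) -
      \int[P]_w f (aZ n w) @[n --> \oo] --> (0 : R).
    apply/norm_cvg0P; apply: (@squeeze_cvgr _ _ _ _ (fun=> 0) (fun n => K * ((r n)%:R / sc n))) => //.
      apply: filterS close => n hn; rewrite normr_ge0/= -EB; [|exact: bf..].
      apply: norm_E_cst => [|w]; first by apply: bdmB; exact: bf.
      exact: le_trans (lf _ _) (hn w).
    exact: cvg_cst.
  rewrite -[L]add0r (_ : (fun n => _) = (fun n => (\int[P]_w f (aZbar n w) -
      \int[P]_w f (aZ n w)) + \int[P]_w f (aZ n w))).
    exact: cvgD.
  by apply/funext => n; rewrite subrK.
have [h1 h2] := Zn_chf_limit.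
split; apply: key => //; [exact: norm_cosB|exact: bdm_cos|exact: norm_sinB|exact: bdm_sin].
Qed.

End weights.

End array.

Theorem theorem2p1
  (R : realType) (E : completeNormedModType R)
  (d : measure_display) (Omega : measurableType d) (P : probability Omega R)
  (X : nat -> nat -> {RV P >-> borel E})
  (T : topologicalType) (g : T -> seq E -> R)
  (s r l : nat -> nat) (b : nat -> T -> R)
  (g_meas : forall t, measurable_functional (g t))
  (g_null : forall t, vanishes_on_null (g t))
  (s_gt0 : forall n, (0 < s n)%N)
  (b_gt0 : forall n t, 0 < b n t)
  (X_stationary : forall n, row_stationary X n)
  (s_le_l : forall n, (s n <= l n)%N)
  (l_o_r : (fun n => (l n)%:R : R^o) =o_\oo (fun n => (r n)%:R : R^o))
  (r_o_n : (fun n => (r n)%:R : R^o) =o_\oo (fun n => n%:R : R^o))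
  (p_cvg0 : pn X g s r b n @[n --> \oo] --> (0 : R))
  (r_o_b : (fun n => (r n)%:R : R^o) =o_\oo
     (fun n => Num.sqrt (pn X g s r b n) * inf (range (b n)) : R^o))
  (mixing : (mn s r n)%:R * beta_mixing X n (l n - s n) @[n --> \oo] -->
     (0 : R))
  (V_separable : forall n, (0 < mn s r n)%N ->
     separable_process P (Vn X g s r b n 1))
  (gmax_bounded : exists M : R, forall x, (gmax g x <= M%:E)%E)
  (gmax_meas : measurable_functional (gmax g))
  (second_moment : forall t,
     (fun n => fine 'E_P[fun w => (block_count X g s r n t w ^+ 2)%R]%E : R^o) =O_\oo
     (fun n => pn X g s r b n * b n t ^+ 2 / (mn s r n)%:R : R^o)) :
  (forall eta : R, 0 < eta ->
     outer_prob P [set w | (eta%:E < ereal_sup (range (fun t : T =>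
        `|Zn X g s r b n t w - Zbarn X g s r b n t w|%:E)))%E]
       @[n --> \oo] --> 0%E) /\
  (forall c : T -> T -> R,
     (forall t u, (mn s r n)%:R / pn X g s r b n *
        fine (covariance P (Vn X g s r b n 1 t) (Vn X g s r b n 1 u))
          @[n --> \oo] --> c t u) ->
     exists (d' : measure_display) (Omega' : measurableType d')
       (P' : probability Omega' R) (G : T -> {RV P' >-> R}),
       [/\ centered_gaussian_process P' (fun t => G t) c,
           fidi_cvg P (Zn X g s r b) P' (fun t => G t) &
           fidi_cvg P (Zbarn X g s r b) P' (fun t => G t)]).
Proof.
split; first exact: sup_norm_Zn_sub_outer.
move=> c hc; have [M _ gM] := functional_bound gmax_bounded.
(* [c] is given only as a limit of covariances; its symmetry, needed for polarization, passes to the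
   limit. *)
have csym t u : c t u = c u t.
  apply: (cvg_unique _ (hc t u)); first by [].
  by apply: cvg_trans (hc u t); apply: near_eq_cvg; apply: nearW => n; rewrite covarianceC.
have mZ n t : measurable_fun setT (Zn X g s r b n t) by exact: (bdm_centered_sum X s r b g_meas gM n _ t).1.
have mZb n t : measurable_fun setT (Zbarn X g s r b n t) by exact: (bdm_centered_sum X s r b g_meas gM n _ t).1.
have hZ : chf_cvg c P (Zn X g s r b) by move=> k t a; exact: Zn_chf_limit.
have hZb : chf_cvg c P (Zbarn X g s r b) by move=> k t a; exact: Zbarn_chf_limit.
(* [G] is built from [Zn] alone. Since [Zbarn] has the same limiting characteristic functions, it
   converges to the same [G]. *)
have [d' [W' [Q [G [hG cG]]]]] := gaussian_limit_exists csym mZ hZ.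
have mG t : measurable_fun setT (G t : W' -> R) by exact: measurable_funPT.
exists d', W', Q, G; split => //.
- exact: chf_gaussian_fidi_cvg mG cG.
- exact: chf_gaussian_fidi_cvg mG cG.
Qed.
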